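(* Consider the standard $k$NN classifier $g(\mathbf{x})=\operatorname{sign}(\hat\eta(\mathbf{x}))$ with $k=k(N)$ the same for all test points. (Upper bound.) If $(f,\eta)$ satisfies conditions (a), (b), (c), (d) of the context and $k$ is optimally selected, then the convergence rate of the excess risk is $$R-R^*=\begin{cases}\mathcal{O}\left(N^{-\min\left\{\frac{\beta(\alpha+1)}{2\beta+\alpha+1},\ \frac{2\beta(\alpha+1)}{\beta d+2(\alpha+2\beta)}\right\}}\right) & \text{if } \beta\neq \frac{2}{d},\\[2mm] \mathcal{O}\left(N^{-\frac{\beta(\alpha+1)}{2\beta+\alpha+1}}\ln N\right) & \text{if } \beta=\frac{2}{d}.\end{cases}$$ This rate is attained if $$k\sim\begin{cases}N^{\frac{2\beta}{2\beta+\alpha+1}} & \text{if } \beta\le\frac{2}{d},\\[1mm] N^{\frac{4\beta}{2\alpha+\beta(d+4)}} & \text{if } \beta>\frac{2}{d}.\end{cases}$$ (Lower bound.) Moreover, this bound is almost tight. In particular, let $\mathcal{S}$ be the set of all pairs $(f,\eta)$ such that (a)-(d) hold with sufficiently large $C_a,C_b,C_c$. Then for the standard $k$NN classifier $$\inf_{k}\ \sup_{(f,\eta)\in\mathcal{S}}(R-R^* )=\Omega\left(N^{-\min\left\{\frac{\beta(\alpha+1)}{2\beta+\alpha+1},\ \frac{2\beta(\alpha+1)}{\beta d+2(\alpha+2\beta)}\right\}}\right).$$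
   Context: Classification setting. $(\mathbf{X},Y)$ takes values in $\mathbb{R}^d\times\{-1,1\}$; $\mathbf{X}$ has probability density $f$, and $\eta(\mathbf{x}):=\mathbb{E}[Y|\mathbf{X}=\mathbf{x}]$. A classifier $g$ is built from $N$ i.i.d. training samples $(\mathbf{X}_i,Y_i)$, $i=1,\dots,N$, with the law of $(\mathbf{X},Y)$, independent of the test pair $(\mathbf{X},Y)$. Its risk is $R=\mathrm{P}(g(\mathbf{X})\neq Y)$ (probability over the training samples and the test pair). The Bayes classifier is $g^*(\mathbf{x})=\operatorname{sign}(\eta(\mathbf{x}))$, with Bayes risk $R^*=\mathrm{P}(g^*(\mathbf{X})\ne Y)$; the excess risk is $R-R^*=\mathbb{E}[\mathbf{1}(g(\mathbf{X})\neq g^*(\mathbf{X}))|\eta(\mathbf{X})|]$. Let $\|\cdot\|$ be any fixed norm on $\mathbb{R}^d$. $B(\mathbf{x},r)$ is the ball with center $\mathbf{x}$ and radius $r$ in this norm, $V(\cdot)$ denotes volume, and $\mathrm{P}(B(\mathbf{x},r))$ is the probability mass of $B(\mathbf{x},r)$ under the law of $\mathbf{X}$. $\hat\eta(\mathbf{x})=\frac1k\sum_{i=1}^kY^{(i)}$, where $Y^{(i)}$ is the label of the $i$-th nearest neighbor $\mathbf{X}^{(i)}$ of $\mathbf{x}$ among $\mathbf{X}_1,\dots,\mathbf{X}_N$ with respect to $\|\cdot\|$. Conditions on $(f,\eta)$: there exist finite constants $C_a,C_b,C_c$, a constant $C_d>0$, and $\alpha>0$, $\beta>0$ such that (a) for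 all $t>0$, $\mathrm{P}(0<|\eta(\mathbf{X})|\le t)\le C_at^\alpha$; (b) for all $t>0$, $\mathrm{P}(f(\mathbf{X})\le t)\le C_bt^\beta$; (c) for every $r>0$ and every $\mathbf{x}$ in the support of $f$, $|\eta(B(\mathbf{x},r))-\eta(\mathbf{x})|\le C_cr^2$, where $\eta(B(\mathbf{x},r)):=\mathbb{E}[Y|\mathbf{X}\in B(\mathbf{x},r)]$; (d) there is $D>0$ such that $\mathrm{P}(B(\mathbf{x},r))\ge C_df(\mathbf{x})V(B(\mathbf{x},r))$ for all $\mathbf{x}$ and all $0<r<D$. $a_N\sim b_N$ means that the two sequences are of the same order (each is bounded by a constant times the other). $\mathcal{O}$ and $\Omega$ are with respect to $N\to\infty$, with constants not depending on $N$. *)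

(* Defs.v *)
From HB Require Import structures.
From mathcomp Require Import all_boot all_order all_algebra.
From mathcomp Require Import all_classical all_reals all_analysis.

Set Implicit Arguments.
Unset Strict Implicit.
Unset Printing Implicit Defensive.

Import Order.TTheory GRing.Theory Num.Theory.
Import numFieldNormedType.Exports.

Local Open Scope classical_set_scope.
Local Open Scope ring_scope.

(* R^n carries the sigma-algebra generated by its coordinates, which is its
   Borel sigma-algebra. *)
Section measurable_rV.
Context (R : realType) (n : nat).

Let coors : 'I_n -> 'rV[R]_n -> R := fun i x => x ord0 i.

Let rV_set0 : g_sigma_preimage coors set0.
Proof. exact: sigma_algebra0. Qed.

Let rV_setC A : g_sigma_preimage coors A -> g_sigma_preimage coors (~` A).
Proof. exact: sigma_algebraC. Qed.

Let rV_bigcup (F : (set 'rV[R]_n)^nat) :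
  (forall i, g_sigma_preimage coors (F i)) ->
  g_sigma_preimage coors (\bigcup_i (F i)).
Proof. exact: sigma_algebra_bigcup. Qed.

HB.instance Definition _ := @isMeasurable.Build
  (measure_tuple_display default_measure_display) 'rV[R]_n
  (g_sigma_preimage coors) rV_set0 rV_setC rV_bigcup.

End measurable_rV.

Section cons_measure.
Context d (T : measurableType d) (R : realType) (n : nat).

Definition cons_tuple (z : T * n.-tuple T) : n.+1.-tuple T :=
  [the n.+1.-tuple T of z.1 :: z.2].

Lemma measurable_cons_tuple : measurable_fun [set: T * n.-tuple T] cons_tuple.
Proof. exact: measurable_cons measurable_fst measurable_snd. Qed.

Variables (mu : {sigma_finite_measure set T -> \bar R})
  (nu : {sigma_finite_measure set (n.-tuple T) -> \bar R}).

Definition cons_measure : set (n.+1.-tuple T) -> \bar R :=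
  pushforward (mu \x nu)%E cons_tuple.

Let cons_measure0 : cons_measure set0 = 0%E.
Proof. by rewrite /cons_measure /pushforward preimage_set0 measure0. Qed.

Let cons_measure_ge0 A : (0 <= cons_measure A)%E.
Proof. by rewrite /cons_measure /pushforward; apply: measure_ge0. Qed.

Let cons_measure_sigma_additive : semi_sigma_additive cons_measure.
Proof.
move=> F mF tF mUF; rewrite /cons_measure /pushforward preimage_bigcup.
apply: measure_semi_sigma_additive.
- move=> i; rewrite -[X in measurable X]setTI.
  exact: measurable_cons_tuple.
- apply/trivIsetP => /= i j _ _ ij; rewrite -preimage_setI.
  by move/trivIsetP : tF => /(_ _ _ _ _ ij) ->//; rewrite preimage_set0.
- rewrite -preimage_bigcup -[X in measurable X]setTI.
  exact: measurable_cons_tuple.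
Qed.

HB.instance Definition _ := isMeasure.Build _ _ _ cons_measure
  cons_measure0 cons_measure_ge0 cons_measure_sigma_additive.

Let cons_measure_sigma_finite : sigma_finite setT cons_measure.
Proof.
have /sigma_finiteP[F [TF ndF Foo]] := sigma_finiteT mu.
have /sigma_finiteP[G [TG ndG Goo]] := sigma_finiteT nu.
pose g (t : n.+1.-tuple T) : T * n.-tuple T := (thead t, [tuple of behead t]).
have mg : measurable_fun setT g.
  by apply/measurable_fun_pair; [exact: measurable_tnth|exact: measurable_behead].
have gK z : g (cons_tuple z) = z.
  by case: z => x t; congr pair; apply: val_inj.
exists (fun i => g @^-1` (F i `*` G i)).
  apply/esym; rewrite -subTset => t _.
  have [i _ Fi] : (\bigcup_i F i) (thead t) by rewrite -TF.
  have [j _ Gj] : (\bigcup_i G i) [tuple of behead t] by rewrite -TG.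
  exists (maxn i j) => //; split => /=.
    by move: Fi; exact/subsetPset/ndF/leq_maxl.
  by move: Gj; exact/subsetPset/ndG/leq_maxr.
move=> i; have [mF Fio] := Foo i; have [mG Gio] := Goo i; split.
  by rewrite -[X in measurable X]setTI; apply: mg => //; exact: measurableX.
rewrite /cons_measure /pushforward -comp_preimage.
rewrite (_ : g \o cons_tuple = id); last exact/funext.
by rewrite preimage_id product_measure1E// lte_mul_pinfty// ge0_fin_numE.
Qed.

HB.instance Definition _ := @Measure_isSigmaFinite.Build _ _ _ cons_measure
  cons_measure_sigma_finite.

End cons_measure.

(* The n-fold product of mu. *)
Fixpoint tuple_measure d (T : measurableType d) (R : realType)
    (mu : {sigma_finite_measure set T -> \bar R}) (n : nat) :
    {sigma_finite_measure set (n.-tuple T) -> \bar R} :=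
  if n is m.+1 then cons_measure mu (tuple_measure mu m)
  else (\d_ ([tuple] : 0.-tuple T))%R.

Section lebesgue_rV.
Context (R : realType) (n : nat).

Definition rV_of_tuple (t : n.-tuple (measurableTypeR R)) : 'rV[R]_n :=
  \row_i tnth t i.

Lemma measurable_rV_of_tuple : measurable_fun setT rV_of_tuple.
Proof.
move=> _; apply: (@smallest_sub _ _ _ [set A | measurable (setT `&` rV_of_tuple @^-1` A)]).
  split=> /=.
  - by rewrite preimage_set0 setI0.
  - move=> A; rewrite !setTI => mA; rewrite setTD.
    by rewrite preimage_setC; exact: measurableC.
  - move=> F mF; rewrite setTI preimage_bigcup; apply: bigcup_measurable => i _.
    by move: (mF i); rewrite setTI.
rewrite -bigcup_seq => A [i _ [B mB <-]] /=; rewrite !setTI.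
rewrite (_ : _ @^-1` _ = (@tnth _ _)^~ i @^-1` B).
  by rewrite -[X in measurable X]setTI; exact: measurable_tnth.
by apply/funext => t; rewrite /preimage /= mxE.
Qed.

Definition lebesgue_rV : set 'rV[R]_n -> \bar R :=
  pushforward (tuple_measure (@lebesgue_measure R) n) rV_of_tuple.

Let lebesgue_rV0 : lebesgue_rV set0 = 0%E.
Proof. by rewrite /lebesgue_rV /pushforward preimage_set0 measure0. Qed.

Let lebesgue_rV_ge0 A : (0 <= lebesgue_rV A)%E.
Proof. by rewrite /lebesgue_rV /pushforward; apply: measure_ge0. Qed.

Let lebesgue_rV_sigma_additive : semi_sigma_additive lebesgue_rV.
Proof.
move=> F mF tF mUF; rewrite /lebesgue_rV /pushforward preimage_bigcup.
apply: measure_semi_sigma_additive.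
- move=> i; rewrite -[X in measurable X]setTI.
  exact: measurable_rV_of_tuple.
- apply/trivIsetP => /= i j _ _ ij; rewrite -preimage_setI.
  by move/trivIsetP : tF => /(_ _ _ _ _ ij) ->//; rewrite preimage_set0.
- rewrite -preimage_bigcup -[X in measurable X]setTI.
  exact: measurable_rV_of_tuple.
Qed.

HB.instance Definition _ := isMeasure.Build _ _ _ lebesgue_rV
  lebesgue_rV0 lebesgue_rV_ge0 lebesgue_rV_sigma_additive.

End lebesgue_rV.

Record is_norm (R : realType) (V : lmodType R) (nrm : V -> R) : Prop := IsNorm {
  is_norm_ge0 : forall x, 0 <= nrm x ;
  is_norm_eq0 : forall x, nrm x = 0 -> x = 0 ;
  is_normZ : forall a x, nrm (a *: x) = `|a| * nrm x ;
  is_normD : forall x y, nrm (x + y) <= nrm x + nrm y }.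

(* The pair (f, eta) with the law of (X, Y) that it determines. The last field
   is the defining property of eta(X) = E[Y | X]. *)
Record model (R : realType) (d : nat) := Model {
  dens : 'rV[R]_d -> R ;
  reg : 'rV[R]_d -> R ;
  law : probability ('rV[R]_d * R)%type R ;
  law_label : law [set z | z.2 = 1 \/ z.2 = -1] = 1%E ;
  dens_ge0 : forall x, 0 <= dens x ;
  measurable_dens : measurable_fun setT dens ;
  measurable_reg : measurable_fun setT reg ;
  law_dens : forall A : set 'rV[R]_d, measurable A ->
    law (A `*` setT) = (\int[@lebesgue_rV R d]_(x in A) (dens x)%:E)%E ;
  law_reg : forall A : set 'rV[R]_d, measurable A ->
    (\int[law]_(z in A `*` setT) (z.2)%:E =
     \int[law]_(z in A `*` setT) (reg z.1)%:E)%E }.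

Section knn.
Context (R : realType) (d : nat) (nrm : 'rV[R]_d -> R).

Definition massB (M : model R d) (x : 'rV[R]_d) (r : R) : \bar R :=
  law M (ball_ nrm x r `*` setT).

Definition regB (M : model R d) (x : 'rV[R]_d) (r : R) : R :=
  fine (\int[law M]_(z in ball_ nrm x r `*` setT) (z.2)%:E)%E
    / fine (massB M x r).

Definition margin_cond (Ca alpha : R) (M : model R d) : Prop :=
  forall t, 0 < t ->
    (law M [set z | (0 < `|reg M z.1| <= t)%R] <= (Ca * t `^ alpha)%:E)%E.

Definition tail_cond (Cb beta : R) (M : model R d) : Prop :=
  forall t, 0 < t ->
    (law M [set z | (dens M z.1 <= t)%R] <= (Cb * t `^ beta)%:E)%E.

Definition smooth_cond (Cc : R) (M : model R d) : Prop :=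
  forall r x, 0 < r -> closure [set y | dens M y != 0] x ->
    `|regB M x r - reg M x| <= Cc * r ^+ 2.

Definition min_mass_cond (Cd : R) (M : model R d) : Prop :=
  exists2 D : R, 0 < D & forall x r, 0 < r < D ->
    ((Cd * dens M x)%:E * lebesgue_rV (ball_ nrm x r) <= massB M x r)%E.

Definition model_class (alpha beta Ca Cb Cc Cd : R) : set (model R d) :=
  [set M | [/\ margin_cond Ca alpha M, tail_cond Cb beta M,
               smooth_cond Cc M & min_mass_cond Cd M]].

(* sign with values in {-1, 1}; the value at 0 is 1. *)
Definition label_sign (t : R) : R := if 0 <= t then 1 else -1.

(* sort is stable: distance ties are broken by the index in the sample. *)
Definition nearest (k N : nat) (s : N.-tuple ('rV[R]_d * R)%type)
    (x : 'rV[R]_d) : seq ('rV[R]_d * R) :=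
  take k (sort (fun u v => nrm (u.1 - x) <= nrm (v.1 - x)) s).

Definition reg_hat (k N : nat) (s : N.-tuple ('rV[R]_d * R)%type)
    (x : 'rV[R]_d) : R :=
  k%:R^-1 * \sum_(z <- nearest k s x) z.2.

Definition knn_classifier (k N : nat) (s : N.-tuple ('rV[R]_d * R)%type)
    (x : 'rV[R]_d) : R :=
  label_sign (reg_hat k s x).

(* The first component w.1 of w is the training sample, w.2 the test pair. *)
Definition knn_risk (k N : nat) (M : model R d) : R :=
  fine ((tuple_measure (law M) N \x law M)%E
    [set w | knn_classifier k w.1 w.2.1 != w.2.2]).

Definition bayes_risk (M : model R d) : R :=
  fine (law M [set z | label_sign (reg M z.1) != z.2]).

Definition excess_risk (k N : nat) (M : model R d) : R :=
  knn_risk k N M - bayes_risk M.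

End knn.

Section rates.
Context (R : realType) (d : nat) (alpha beta : R).

Definition rate_exponent1 : R :=
  beta * (alpha + 1) / (2 * beta + alpha + 1).

Definition rate_exponent2 : R :=
  2 * beta * (alpha + 1) / (beta * d%:R + 2 * (alpha + 2 * beta)).

Definition lower_rate (N : nat) : R :=
  N%:R `^ (- Num.min rate_exponent1 rate_exponent2).

Definition upper_rate (N : nat) : R :=
  if beta == 2 / d%:R then N%:R `^ (- rate_exponent1) * ln N%:R
  else lower_rate N.

Definition k_exponent : R :=
  if beta <= 2 / d%:R then 2 * beta / (2 * beta + alpha + 1)
  else 4 * beta / (2 * alpha + beta * (d%:R + 4)).

End rates.

(* Main.v *)
(* Upper bound. At a point x, let rho be the distance to the (k+1)-th nearest
   sample point. Conditionally on rho, the k nearer points are independent draws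
   from the open ball of radius rho, where by the smoothness condition the mean of
   sign(eta(x)) Y is at least |eta(x)| / 2 as soon as |eta(x)| exceeds twice the
   bias Cc rho^2. A Chernoff bound makes the error probability at most
   exp(-k eta(x)^2 / 8), plus exp(-k) for the event that rho exceeds its typical
   size, which the minimal mass condition bounds by a multiple of
   (k / (N f(x)))^(1/d). Integrating |eta| times these bounds gives
   (k/N)^beta (low density), k^(-(1+alpha)/2) (variance), and a bias term that is
   split over dyadic shells of the density f.

   Lower bound. The radius D of the minimal mass condition may depend on the
   model, so the class contains all {-1, 1}-valued regression functions that are
   constant on each of 2N+1 well separated cells of volume 1/(2N+1) carrying a
   uniform X. With probability at least 1/2 the sample misses the cell of the
   test point; averaging over the labels of the cells, the excess risk is then at
   least 1/4 for every k, which dominates the rate. *)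

Require Import Defs.
From HB Require Import structures.
From mathcomp Require Import all_boot all_order all_algebra.
From mathcomp Require Import all_classical all_reals all_analysis.
From mathcomp Require Import measurable_realfun.
From mathcomp Require Import ring lra zify.

Set Implicit Arguments.
Unset Strict Implicit.
Unset Printing Implicit Defensive.

Import Order.TTheory GRing.Theory Num.Theory.
Import numFieldNormedType.Exports.

Local Open Scope classical_set_scope.
Local Open Scope ring_scope.

(** * Integrals over product measures *)

(** The independence given rho is obtained without conditional laws. Each index [j] that may be the
    (k+1)-th nearest point is treated separately: Tonelli makes that point the outermost variable,
    and once it is fixed, which of the others are nearer is decided coordinate by coordinate. Ties
    are the obstacle. A point at distance exactly rho counts as nearer iff its index is below [j],
    so some coordinates are tested against the closed ball and others against the open one, and the
    estimate for open balls is carried to closed ones by continuity of the measure. Summing over [j]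
    costs no factor, since at most one point has a given rank.

    The exponent [k * eta ^ 2 / 8] is [k * D ^ 2 / 2] at [D = |eta| / 2], the mean that survives the
    bias. The critical radius has mass [p >= 4 * k / N], which turns the Chernoff bound
    [exp (k - N * p / 2)] into [exp (- k)]. The number of dyadic shells stays free until the rates
    are computed, because its best value depends on how [beta] compares with [2 / d]. *)

Section measurability.
Context d (T : measurableType d) (R : realType).

Lemma measurable_bool_nat (b : T -> bool) :
  measurable_fun setT b -> measurable_fun setT (fun t => b t : nat).
Proof. by move=> mb; exact: (measurable_fun_ifT mb). Qed.

Lemma measurable_boolR (b : T -> bool) :
  measurable_fun setT b -> measurable_fun setT (fun t => (b t)%:R : R).
Proof.
move=> mb; rewrite (_ : (fun _ => _) = fun t => if b t then 1 else 0 : R).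
  exact: (measurable_fun_ifT mb).
by apply/funext => t; case: (b t).
Qed.

Lemma measurable_sumn n (f : 'I_n -> T -> nat) :
  (forall i, measurable_fun setT (f i)) ->
  measurable_fun setT (fun t => \sum_(i < n) f i t)%N.
Proof.
elim: n f => [|n IH] f mf.
  by under eq_fun do rewrite big_ord0; exact: measurable_cst.
under eq_fun do rewrite big_ord_recl.
by apply: measurable_fun_addn => //; exact: IH.
Qed.

Lemma measurable_prodR n (f : 'I_n -> T -> R) :
  (forall i, measurable_fun setT (f i)) ->
  measurable_fun setT (fun t => \prod_(i < n) f i t).
Proof.
elim: n f => [|n IH] f mf.
  by under eq_fun do rewrite big_ord0; exact: measurable_cst.
under eq_fun do rewrite big_ord_recl.
by apply: measurable_funM => //; exact: IH.
Qed.

Lemma measurable_sumR n (f : 'I_n -> T -> R) :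
  (forall i, measurable_fun setT (f i)) ->
  measurable_fun setT (fun t => \sum_(i < n) f i t).
Proof.
elim: n f => [|n IH] f mf.
  by under eq_fun do rewrite big_ord0; exact: measurable_cst.
under eq_fun do rewrite big_ord_recl.
by apply: measurable_funD => //; exact: IH.
Qed.

Lemma measurable_comp_tnth d' (T' : measurableType d') n (i : 'I_n)
    (f : T -> T') : measurable_fun setT f ->
  measurable_fun [set: n.-tuple T] (fun t => f (tnth t i)).
Proof.
by move=> mf; apply: (measurableT_comp mf); exact: measurable_tnth.
Qed.

Lemma measurable_set_bool (b : T -> bool) :
  measurable_fun setT b -> measurable [set t | b t].
Proof.
by move=> mb; rewrite -[X in measurable X]setTI; exact: (mb measurableT [set true]).
Qed.

Lemma integral_boolR (P : {measure set T -> \bar R}) (b : T -> bool) :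
  measurable_fun setT b ->
  (\int[P]_t (b t)%:R%:E = P [set t | b t])%E.
Proof.
move=> mb; rewrite -(setIT [set t | b t]) -integral_indic//; last exact: measurable_set_bool.
apply: eq_integral => t _; rewrite indicE; congr (_ %:R%:E).
by case: (boolP (b t)) => bt; [rewrite mem_set|rewrite memNset//; exact/negP].
Qed.

End measurability.

Section tuple_integral.
Context d (T : measurableType d) (R : realType).

(** [unlift] keeps the other coordinates in order, so that comparisons of indices, which break ties,
    survive the removal of coordinate [j]. *)
Definition tuple_insert n (j : 'I_n.+1) (y : T) (t : n.-tuple T) :
    n.+1.-tuple T := [tuple oapp (tnth t) y (unlift j i) | i < n.+1].

Lemma tnth_insert_at n (j : 'I_n.+1) y (t : n.-tuple T) :
  tnth (tuple_insert j y t) j = y.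
Proof. by rewrite tnth_mktuple unlift_none. Qed.

Lemma tnth_insert_lift n (j : 'I_n.+1) y (t : n.-tuple T) i :
  tnth (tuple_insert j y t) (lift j i) = tnth t i.
Proof. by rewrite tnth_mktuple liftK. Qed.

Lemma tuple_insert0 n y (t : n.-tuple T) :
  tuple_insert ord0 y t = Defs.cons_tuple (y, t).
Proof.
apply: eq_from_tnth => i; have [j ->|->] := unliftP ord0 i.
  by rewrite tnth_insert_lift tnthS.
by rewrite tnth_insert_at.
Qed.

Lemma tuple_insertS n (j : 'I_n.+1) x y (t : n.-tuple T) :
  tuple_insert (lift ord0 j) y (Defs.cons_tuple (x, t)) =
  Defs.cons_tuple (x, tuple_insert j y t).
Proof.
apply: eq_from_tnth => i; have [k ->|->] := unliftP ord0 i; last first.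
  have -> : ord0 = lift (lift ord0 j) ord0 by apply: val_inj.
  rewrite tnth_insert_lift.
  have -> : lift (lift ord0 j) ord0 = ord0 :> 'I_n.+2 by apply: val_inj.
  by [].
rewrite [RHS]tnthS; have [l ->|->] := unliftP j k; last first.
  by rewrite !tnth_insert_at.
have -> : lift ord0 (lift j l) = lift (lift ord0 j) (lift ord0 l).
  by apply: val_inj; rewrite /= /bump/=; lia.
by rewrite !tnth_insert_lift tnthS.
Qed.

Lemma measurable_tuple_insert n (j : 'I_n.+1) :
  measurable_fun setT (fun z : T * n.-tuple T => tuple_insert j z.1 z.2).
Proof.
apply/measurable_fun_tnthP => i; have [k ->|->] := unliftP j i.
  rewrite (_ : _ \o _ = (@tnth n T ^~ k) \o snd).
    by apply: measurableT_comp => //; exact: measurable_tnth.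
  by apply/funext => z /=; rewrite tnth_insert_lift.
rewrite (_ : _ \o _ = fst)//.
by apply/funext => z /=; rewrite tnth_insert_at.
Qed.

Local Open Scope ereal_scope.

Section sigma_finite.
Variable mu : {sigma_finite_measure set T -> \bar R}.

Lemma integral_tuple_measureS n (H : n.+1.-tuple T -> \bar R) :
  measurable_fun setT H -> (forall t, 0 <= H t) ->
  \int[tuple_measure mu n.+1]_t H t =
  \int[mu]_x \int[tuple_measure mu n]_t H (Defs.cons_tuple (x, t)).
Proof.
move=> mH H0.
rewrite [LHS](@ge0_integral_pushforward _ _ _ _ _ (@Defs.cons_tuple _ T n)
  (@measurable_cons_tuple _ T n) (mu \x tuple_measure mu n) setT H)//=.
rewrite preimage_setT fubini_tonelli1//=.
by apply: measurableT_comp => //; exact: measurable_cons_tuple.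
Qed.

(** Exchangeability of the coordinates. By construction the head is integrated outermost; induction
    on the length and Tonelli exchange it with the inserted coordinate. *)
Lemma integral_tuple_insert n (j : 'I_n.+1) (H : n.+1.-tuple T -> \bar R) :
  measurable_fun setT H -> (forall t, 0 <= H t) ->
  \int[tuple_measure mu n.+1]_t H t =
  \int[mu]_y \int[tuple_measure mu n]_t H (tuple_insert j y t).
Proof.
elim: n j H => [|n IH] j H mH H0; rewrite (integral_tuple_measureS mH H0).
  rewrite ord1; apply: eq_integral => y _.
  by apply: eq_integral => t _; rewrite tuple_insert0.
have [k ->|->] := unliftP ord0 j; last first.
  apply: eq_integral => y _.
  by apply: eq_integral => t _; rewrite tuple_insert0.
transitivity (\int[mu]_x \int[mu]_y \int[tuple_measure mu n]_t
    H (Defs.cons_tuple (x, tuple_insert k y t))).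
  apply: eq_integral => x _; rewrite (IH k)//.
  apply: (measurableT_comp mH).
  apply: (measurableT_comp (@measurable_cons_tuple _ T n.+1)).
  exact: measurable_fun_pair.
pose F z := \int[tuple_measure mu n]_t
  H (Defs.cons_tuple (z.1, tuple_insert k z.2 t)).
rewrite (fubini_tonelli F)//; last 2 first.
- apply: (@measurable_fun_fubini_tonelli_F _ _ _ _ _ _
    (fun z : (T * T) * n.-tuple T =>
       H (Defs.cons_tuple (z.1.1, tuple_insert k z.1.2 z.2)))) => //.
  apply: (measurableT_comp mH).
  apply: (measurableT_comp (@measurable_cons_tuple _ T n.+1)).
  apply: measurable_fun_pair; first exact: measurableT_comp.
  have /(measurableT_comp (measurable_tuple_insert k)) :
      measurable_fun setT (fun z : (T * T) * n.-tuple T => (z.1.2, z.2)).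
    by apply: measurable_fun_pair => //; exact: measurableT_comp.
  by [].
- by move=> z; apply: integral_ge0.
apply: eq_integral => y _; rewrite integral_tuple_measureS; last 2 first.
  apply: (measurableT_comp mH).
  have /(measurableT_comp (measurable_tuple_insert (lift ord0 k))) :
      measurable_fun setT (fun z : n.+1.-tuple T => (y, z)).
    exact: measurable_fun_pair.
  by [].
  by [].
apply: eq_integral => x _; apply: eq_integral => t _.
by rewrite /F/= tuple_insertS.
Qed.

Lemma measurable_integral_insert n (j : 'I_n.+1) (H : n.+1.-tuple T -> \bar R) :
  measurable_fun setT H -> (forall t, 0 <= H t) ->
  measurable_fun setT
    (fun y => \int[tuple_measure mu n]_t H (tuple_insert j y t)).
Proof.
move=> mH H0.
apply: (@measurable_fun_fubini_tonelli_F _ _ _ _ _ _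
  (fun z : T * n.-tuple T => H (tuple_insert j z.1 z.2))) => //.
exact: (measurableT_comp mH (measurable_tuple_insert j)).
Qed.

(** The factors are indexed by [nat] so that the induction hypothesis applies to the shifted
    families [h \o S] and [c \o S]. Sigma-finite [mu] covers both volumes of boxes and expectations
    over the sample. *)
Lemma integral_tuple_prod n (h : nat -> T -> R) (c : nat -> R) :
  (forall i, measurable_fun setT (h i)) -> (forall i x, (0 <= h i x)%R) ->
  (forall i, \int[mu]_x (h i x)%:E = (c i)%:E) ->
  \int[tuple_measure mu n]_t (\prod_(i < n) h i (tnth t i))%:E =
  (\prod_(i < n) c i)%:E.
Proof.
elim: n h c => [|n IH] h c mh h0 hc.
  under eq_integral do rewrite big_ord0.
  by rewrite integral_cst// mul1e big_ord0 [LHS]diracT.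
have mprod m (g : nat -> T -> R) : (forall i, measurable_fun setT (g i)) ->
    measurable_fun setT (fun t : m.-tuple T => (\prod_(i < m) g i (tnth t i))%:E).
  move=> mg; apply/measurable_EFinP; apply: measurable_prodR => i.
  exact: measurable_comp_tnth.
rewrite integral_tuple_measureS; last 2 first.
- exact: mprod.
- by move=> t; rewrite lee_fin prodr_ge0.
transitivity (\int[mu]_x ((h 0%N x)%:E * (\prod_(i < n) c i.+1)%:E)).
  apply: eq_integral => x _.
  rewrite -(IH (h \o S) (c \o S)); last 3 first.
  - by move=> i; exact: mh.
  - by move=> i y; exact: h0.
  - by move=> i; exact: hc.
  rewrite -ge0_integralZl//; last 3 first.
  - by apply: mprod => i; exact: mh.
  - by move=> t _; rewrite lee_fin prodr_ge0// => i _; exact: h0.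
  - by rewrite lee_fin h0.
  apply: eq_integral => t _; rewrite big_ord_recl EFinM.
  by congr (_ * _%:E); apply: eq_bigr => i _; rewrite tnthS.
have c0 i : (0 <= c i)%R.
  by rewrite -lee_fin -hc integral_ge0// => y _; rewrite lee_fin.
rewrite ge0_integralZr//; last 3 first.
- exact/measurable_EFinP.
- by move=> x _; rewrite lee_fin.
- by rewrite lee_fin prodr_ge0.
by rewrite hc big_ord_recl.
Qed.

End sigma_finite.

Section probability.
Variable P : probability T R.

Lemma tuple_measure_setT n : tuple_measure P n setT = 1.
Proof.
elim: n => [|n IH]; first by rewrite /= diracT.
have := @integral_tuple_measureS P n (cst 1) (measurable_cst _) (fun=> lee01).
rewrite integral_cst// mul1e => ->; rewrite /=.
have -> : (fun=> \int[tuple_measure P n]_t 1) = cst 1 :> (T -> \bar R).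
  apply/funext => x; rewrite (integral_cst _ measurableT 1%E) mul1e.
  exact: IH.
by rewrite integral_cst// mul1e; exact: probability_setT.
Qed.

Lemma integral_tuple_cst n (c : \bar R) :
  \int[tuple_measure P n]_t c = c.
Proof. by rewrite (integral_cst _ measurableT c) [X in _ * X]tuple_measure_setT mule1. Qed.

(** The test [a i] may depend on the place [i], because the tie-break does. *)
Definition hits n (a : nat -> T -> bool) (t : n.-tuple T) : nat :=
  (\sum_(i < n) a i (tnth t i))%N.

Lemma hits_cons n a x (t : n.-tuple T) :
  hits a (Defs.cons_tuple (x, t)) = (a 0%N x + hits (a \o S) t)%N.
Proof.
rewrite /hits big_ord_recl/=; congr (_ + _)%N.
by apply: eq_bigr => i _; rewrite tnthS.
Qed.

Lemma measurable_hits n a : (forall i, measurable_fun setT (a i)) ->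
  measurable_fun setT (@hits n a).
Proof.
move=> ma; apply: measurable_sumn => i; apply: measurable_bool_nat.
exact: measurable_comp_tnth.
Qed.

Definition hit_weight n (a : nat -> T -> bool) (phi : T -> R) (t : n.-tuple T) :
    R := \prod_(i < n) (if a i (tnth t i) then phi (tnth t i) else 1%R).

Lemma hit_weight_cons n a phi x (t : n.-tuple T) :
  hit_weight a phi (Defs.cons_tuple (x, t)) =
  ((if a 0%N x then phi x else 1) * hit_weight (a \o S) phi t)%R.
Proof.
rewrite /hit_weight big_ord_recl/=; congr (_ * _)%R.
by apply: eq_bigr => i _; rewrite tnthS.
Qed.

Lemma measurable_hit_weight n a phi : (forall i, measurable_fun setT (a i)) ->
  measurable_fun setT phi -> measurable_fun setT (@hit_weight n a phi).
Proof.
move=> ma mphi; apply: measurable_prodR => i.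
apply: (@measurable_comp_tnth _ _ _ _ _ _
  (fun x => if a i x then phi x else 1%R)).
exact: measurable_fun_ifT.
Qed.

Lemma hit_weight_ge0 n a phi (t : n.-tuple T) : (forall x, (0 <= phi x)%R) ->
  (0 <= hit_weight a phi t)%R.
Proof. by move=> phi0; apply: prodr_ge0 => i _; case: ifP. Qed.

(* Independence of the coordinates: given which of them are hit, the hit ones
   contribute one factor of at most q each. *)
Lemma integral_hit_weight_le n (a : nat -> T -> bool) (phi : T -> R) (q : R) k :
  (forall i, measurable_fun setT (a i)) -> measurable_fun setT phi ->
  (forall x, (0 <= phi x)%R) -> (0 <= q)%R ->
  (forall i, \int[P]_(x in [set x | a i x]) (phi x)%:E <=
             q%:E * P [set x | a i x]) ->
  \int[tuple_measure P n]_t ((hits a t == k)%:R * hit_weight a phi t)%:E <=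
  (q ^+ k)%:E * \int[tuple_measure P n]_t (hits a t == k)%:R%:E.
Proof.
move=> + mphi phi0 q0; elim: n a k => [|n IH] a k ma ha.
  rewrite (eq_integral (cst (0%N == k)%:R%:E)); last first.
    by move=> t _; rewrite /hits /hit_weight !big_ord0 mulr1.
  rewrite [X in _ <= _ * X](eq_integral (cst (0%N == k)%:R%:E)); last first.
    by move=> t _; rewrite /hits big_ord0.
  rewrite !integral_tuple_cst; case: k => [|k]; first by rewrite expr0 mul1e.
  by rewrite mule0.
set A := [set x | a 0%N x].
have mA : measurable A by exact: measurable_set_bool.
have maS i : measurable_fun setT ((a \o S) i) by exact: ma.
have haS i : \int[P]_(x in [set x | (a \o S) i x]) (phi x)%:E <=
             q%:E * P [set x | (a \o S) i x] by exact: ha.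
pose w j := \int[tuple_measure P n]_t
  ((hits (a \o S) t == j)%:R * hit_weight (a \o S) phi t)%:E.
pose p j := \int[tuple_measure P n]_t (hits (a \o S) t == j)%:R%:E : \bar R.
have wp j : w j <= (q ^+ j)%:E * p j by exact: IH.
have p0 j : 0 <= p j by apply: integral_ge0.
have w0 j : 0 <= w j.
  by apply: integral_ge0 => t _; rewrite lee_fin mulr_ge0// hit_weight_ge0.
have mhits m (b : nat -> T -> bool) j : (forall i, measurable_fun setT (b i)) ->
    measurable_fun setT (fun t : m.-tuple T => (hits b t == j)%:R : R).
  move=> mb; apply: measurable_boolR; apply: measurable_fun_eqn => //.
  exact: measurable_hits.
have mhw m (b : nat -> T -> bool) j : (forall i, measurable_fun setT (b i)) ->
    measurable_fun setT (fun t : m.-tuple T =>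
      ((hits b t == j)%:R * hit_weight b phi t)%:E).
  move=> mb; apply/measurable_EFinP/measurable_funM; first exact: mhits.
  exact: measurable_hit_weight.
have splitA (F : T -> \bar R) : measurable_fun setT F -> (forall x, 0 <= F x) ->
    \int[P]_x F x = \int[P]_(x in A) F x + \int[P]_(x in ~` A) F x.
  move=> mF F0; rewrite -ge0_integral_setU//; last 3 first.
  - exact: measurableC.
  - by rewrite setUv.
  - by rewrite disj_set2E setICr.
  by rewrite setUv.
(* What remains once the head [x] is fixed: if it is hit, the tail needs one hit less, which is
   impossible for [k = 0]; otherwise the tail needs all [k]. *)
pose p1 x := if a 0%N x then (if k is k'.+1 then p k' else 0) else p k.
pose w1 x := if a 0%N x then (if k is k'.+1 then (phi x)%:E * w k' else 0)
             else w k.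
have -> : \int[tuple_measure P n.+1]_t (hits a t == k)%:R%:E = \int[P]_x p1 x.
  rewrite integral_tuple_measureS; last 2 first.
  - by apply/measurable_EFinP; exact: (mhits _ a k ma).
  - by move=> t; rewrite lee_fin.
  apply: eq_integral => x _; rewrite /p1.
  under eq_integral do rewrite hits_cons.
  case: (a 0%N x) => //=; case: (k) => [|k'] //.
  by rewrite integral0_eq.
have -> : \int[tuple_measure P n.+1]_t
    ((hits a t == k)%:R * hit_weight a phi t)%:E = \int[P]_x w1 x.
  rewrite integral_tuple_measureS; last 2 first.
  - exact: (mhw _ a k ma).
  - by move=> t; rewrite lee_fin mulr_ge0// hit_weight_ge0.
  apply: eq_integral => x _; rewrite /w1.
  under eq_integral do rewrite hits_cons hit_weight_cons.
  case: (a 0%N x) => /=; last first.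
    by under eq_integral do rewrite add0n mul1r.
  case: (k) => [|k'].
    by rewrite integral0_eq// => t _; rewrite mul0r.
  under eq_integral do rewrite add1n eqSS mulrCA EFinM.
  rewrite ge0_integralZl//; last 3 first.
  - exact: (mhw _ (a \o S) k' maS).
  - by move=> t _; rewrite lee_fin mulr_ge0// hit_weight_ge0.
  - by rewrite lee_fin.
have mp1 : measurable_fun setT p1.
  by apply: measurable_fun_ifT; [exact: ma|exact: measurable_cst..].
have mw1 : measurable_fun setT w1.
  apply: measurable_fun_ifT; [exact: ma| |exact: measurable_cst].
  case: (k) => [|k']; first exact: measurable_cst.
  apply: emeasurable_funM; last exact: measurable_cst.
  exact/measurable_EFinP.
have p10 x : 0 <= p1 x by rewrite /p1; case: ifP => // _; case: (k).
have w10 x : 0 <= w1 x.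
  by rewrite /w1; case: ifP => // _; case: (k) => // k'; rewrite mule_ge0 ?lee_fin.
rewrite !splitA//.
rewrite (@eq_integral _ _ _ P A (fun x => if k is k'.+1 then (phi x)%:E * w k' else 0));
  last by move=> x /set_mem; rewrite /A/= /w1 => ->.
rewrite (@eq_integral _ _ _ P (~` A) (cst (w k)));
  last by move=> x /set_mem /negP/negbTE; rewrite /w1 => ->.
rewrite [X in _ <= _ * (X + _)](@eq_integral _ _ _ P A (cst (if k is k'.+1 then p k' else 0)));
  last by move=> x /set_mem; rewrite /A/= /p1 => ->.
rewrite [X in _ <= _ * (_ + X)](@eq_integral _ _ _ P (~` A) (cst (p k)));
  last by move=> x /set_mem /negP/negbTE; rewrite /p1 => ->.
rewrite !integral_cst//; [|exact: measurableC..].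
rewrite ge0_muleDr; [|rewrite mule_ge0//; by case: (k)|exact: mule_ge0].
apply: leeD; last by rewrite muleA; exact: lee_wpmul2r.
case: k {p1 w1 mp1 mw1 p10 w10} => [|k']; first by rewrite integral0 mul0e mule0.
rewrite ge0_integralZr//; last 2 first.
- by apply/measurable_EFinP; exact: measurable_funTS.
- by move=> x _; rewrite lee_fin.
(* One factor [q] comes from the head, by hypothesis, and [q ^ k'] from the tail, by induction. *)
apply: (@le_trans _ _ (q%:E * P A * ((q ^+ k')%:E * p k'))).
  by apply: lee_pmul => //; [apply: integral_ge0 => x _; rewrite lee_fin|exact: ha].
by rewrite exprS EFinM !muleA (muleAC _ (P A)) (muleAC _ (P A)).
Qed.
End probability.
End tuple_integral.

(** * Ranks of nearest neighbours *)

Section measurable_row.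
Context (R : realType) (n : nat).

Lemma measurable_row_coord (i : 'I_n) :
  measurable_fun setT (fun x : 'rV[R]_n => x ord0 i).
Proof.
move=> _ Y mY; rewrite setTI; apply: sub_sigma_algebra => /=.
rewrite -bigcup_seq/=; exists i => /=; first by rewrite mem_index_enum.
by exists Y => //; rewrite setTI.
Qed.

Lemma measurable_fun_row d (T : measurableType d) (f : T -> 'rV[R]_n) :
  (forall i, measurable_fun setT (fun t => f t ord0 i)) ->
  measurable_fun setT f.
Proof.
move=> mf _.
apply: (@smallest_sub _ _ _ [set A | measurable (setT `&` f @^-1` A)]).
  split=> /=.
  - by rewrite preimage_set0 setI0.
  - move=> A; rewrite !setTI => mA; rewrite setTD.
    by rewrite preimage_setC; exact: measurableC.
  - move=> F mF; rewrite setTI preimage_bigcup; apply: bigcup_measurable => i _.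
    by move: (mF i); rewrite setTI.
rewrite -bigcup_seq => A [i _ [B mB <-]] /=; rewrite !setTI.
by rewrite -[X in measurable X]setTI; exact: mf.
Qed.

Lemma measurable_rowB d (T : measurableType d) (f g : T -> 'rV[R]_n) :
  measurable_fun setT f -> measurable_fun setT g ->
  measurable_fun setT (fun t => f t - g t).
Proof.
move=> mf mg; apply: measurable_fun_row => i.
under eq_fun do rewrite !mxE.
apply: measurable_funB.
  exact: (measurableT_comp (measurable_row_coord i) mf).
exact: (measurableT_comp (measurable_row_coord i) mg).
Qed.

End measurable_row.

Section nearest_rank.
Context (R : realType) (d : nat) (nrm : 'rV[R]_d -> R) (N : nat).
Local Notation Z := ('rV[R]_d * R)%type.
Implicit Types (s : N.-tuple Z) (x : 'rV[R]_d).

Definition dist_at s x (i : 'I_N) : R := nrm ((tnth s i).1 - x).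

(* Lexicographic on (distance, index): the tie-break of the stable sort. *)
Definition nearer s x (i j : 'I_N) : bool :=
  (dist_at s x i <= dist_at s x j) &&
  ((dist_at s x j <= dist_at s x i) ==> (i < j)%N).

Definition nn_rank s x (j : 'I_N) : nat := (\sum_(i < N) nearer s x i j)%N.

Let order s x : seq 'I_N :=
  sort (fun i j => dist_at s x i <= dist_at s x j) (enum 'I_N).

Lemma nearer_irr s x i : nearer s x i i = false.
Proof. by rewrite /nearer lexx ltnn. Qed.

Lemma nearer_asym s x i j : nearer s x i j -> nearer s x j i = false.
Proof.
rewrite /nearer => /andP[ij /implyP h]; apply/negbTE/negP => /andP[ji /implyP h'].
by have := h ji; have := h' ij; lia.
Qed.

Lemma nearer_trans s x : transitive (nearer s x).
Proof.
move=> j i k /andP[ij /implyP h1] /andP[jk /implyP h2].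
rewrite /nearer (le_trans ij jk)/=; apply/implyP => ki.
by apply: ltn_trans (h1 _) (h2 _); [exact: le_trans jk ki|exact: le_trans ki ij].
Qed.

Let perm_order s x : perm_eq (order s x) (enum 'I_N).
Proof. by rewrite perm_sort. Qed.

Let mem_order s x i : i \in order s x.
Proof. by rewrite (perm_mem (perm_order s x)) mem_enum. Qed.

Let uniq_order s x : uniq (order s x).
Proof. by rewrite (perm_uniq (perm_order s x)) enum_uniq. Qed.

Let size_order s x : size (order s x) = N.
Proof. by rewrite size_sort size_enum_ord. Qed.

(** [sort] is stable and the enumeration increases with the index, so equal distances stay in index
    order. This links the list in [nearest] to the tie-break built into [nearer]. *)
Let pairwise_order s x : pairwise (nearer s x) (order s x).
Proof.
rewrite -sorted_pairwise; last exact: nearer_trans.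
apply: (sort_stable (leT' := fun i j : 'I_N => (i < j)%N)).
- by move=> i j; exact: le_total.
- by move=> j i k; exact: ltn_trans.
- by have := iota_ltn_sorted 0 N; rewrite -val_enum_ord sorted_map.
Qed.

(** In a list that is pairwise increasing for [nearer], each entry before [j] adds 1 to the rank of
    [j], and each entry after it adds 0 by asymmetry. *)
Lemma nn_rank_order s x j : nn_rank s x j = index j (order s x).
Proof.
rewrite /nn_rank -big_enum/= -(perm_big _ (perm_order s x))/=.
have := pairwise_order s x; have := uniq_order s x; have := mem_order s x j.
move: (order s x) => o jo; case/splitPr: jo => o1 o2.
rewrite cat_uniq => /and3P[_ jo1 /andP[jo2 _]].
rewrite pairwise_cat => /and3P[/allrelP h12 _ /andP[/allP h2 _]].
rewrite big_cat big_cons/= nearer_irr add0n.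
rewrite (eq_big_seq (fun=> 1%N)); last first.
  by move=> i io1; rewrite h12// mem_head.
rewrite [X in (_ + X)%N](eq_big_seq (fun=> 0%N)); last first.
  by move=> i io2; rewrite nearer_asym// h2.
rewrite big1_eq addn0 sum1_size index_cat ifN/=; last first.
  by apply: contra jo1 => jo1; apply/hasP; exists j; rewrite ?mem_head.
by rewrite eqxx addn0.
Qed.

Lemma nn_rank_inj s x : injective (nn_rank s x).
Proof.
move=> i j; rewrite !nn_rank_order => ij.
by rewrite -(nth_index i (mem_order s x i)) ij nth_index.
Qed.

Lemma nn_rank_ex s x k : (k < N)%N -> exists j, nn_rank s x j = k.
Proof.
move=> kN; have j0 : 'I_N by exact: (Ordinal kN).
exists (nth j0 (order s x) k).
by rewrite nn_rank_order index_uniq// size_order.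
Qed.

Lemma nn_rank_ltn s x i j : (nn_rank s x i < nn_rank s x j)%N = nearer s x i j.
Proof.
have lt i' j' : (nn_rank s x i' < nn_rank s x j')%N -> nearer s x i' j'.
  rewrite !nn_rank_order => ij.
  have /(pairwiseP i')/(_ (index i' (order s x)) (index j' (order s x))) :=
    pairwise_order s x.
  by rewrite !nth_index//; apply => //; rewrite inE index_mem.
apply/idP/idP; first exact: lt.
move=> nij; rewrite ltnNge leq_eqVlt; apply/negP => /orP[/eqP/nn_rank_inj ji|].
  by move: nij; rewrite ji nearer_irr.
by move/lt; rewrite nearer_asym.
Qed.

(** Trades the sorted list for a sum over all sample places. In this form measurability is checked
    per coordinate, and the exponential of the sum is a product over places. *)
Lemma sum_nearest k s x : \sum_(z <- nearest nrm k s x) z.2 =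
  \sum_(i < N) (if (nn_rank s x i < k)%N then (tnth s i).2 else 0).
Proof.
rewrite /nearest -[in LHS](map_tnth_enum s) sort_map -map_take big_map.
rewrite [RHS](eq_bigr (fun i =>
  if (index i (order s x) < k)%N then (tnth s i).2 else 0)); last first.
  by move=> i _; rewrite nn_rank_order.
rewrite -[RHS]big_enum/= -(perm_big _ (perm_order s x))/=.
rewrite -[X in _ = \sum_(_ <- X) _](cat_take_drop k) big_cat/=.
rewrite [X in _ = _ + X](eq_big_seq (fun=> 0)) ?big1_eq ?addr0; last first.
  move=> i id; rewrite ifF//; apply/negbTE; rewrite -in_take//.
  apply/negP => it; have := uniq_order s x.
  rewrite -[X in uniq X](cat_take_drop k) cat_uniq => /and3P[_ /hasP + _].
  by apply; exists i.
by apply: eq_big_seq => i it; rewrite -in_take// it.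
Qed.

(** If point [j] lay at distance at least [r], every point within [r] would be nearer, and the rank
    of [j] would be at least their number. *)
Lemma nn_rank_dist k s x j r : nn_rank s x j = k ->
  (k < \sum_(i < N) (dist_at s x i < r)%R)%N -> dist_at s x j < r.
Proof.
move=> jk; rewrite ltNge -{1}jk; apply: contraL => rj; rewrite -leqNgt.
apply: leq_sum => i _; case: ltP => // ir; rewrite lt0b /nearer.
have ij := lt_le_trans ir rj.
by rewrite (ltW ij)/= leNgt ij.
Qed.

End nearest_rank.

Section measurable_knn.
Context (R : realType) (d : nat) (nrm : 'rV[R]_d -> R).
Hypothesis mnrm : measurable_fun setT nrm.
Context (N : nat).
Local Notation Z := ('rV[R]_d * R)%type.
Context disp (T : measurableType disp) (fs : T -> N.-tuple Z) (fx : T -> 'rV[R]_d).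
Hypothesis mfs : measurable_fun setT fs.
Hypothesis mfx : measurable_fun setT fx.

Let measurable_coord i : measurable_fun setT (fun t => tnth (fs t) i).
Proof. exact: (measurableT_comp (measurable_tnth i) mfs). Qed.

Lemma measurable_dist_at i :
  measurable_fun setT (fun t => dist_at nrm (fs t) (fx t) i).
Proof.
apply: (measurableT_comp mnrm); apply: measurable_rowB => //.
exact: (measurableT_comp measurable_fst (measurable_coord i)).
Qed.

Lemma measurable_nearer i j :
  measurable_fun setT (fun t => nearer nrm (fs t) (fx t) i j).
Proof.
apply: measurable_and.
  by apply: measurable_fun_ler; exact: measurable_dist_at.
under eq_fun do rewrite implybE.
apply: measurable_or; last exact: measurable_cst.
by apply: measurable_neg; apply: measurable_fun_ler; exact: measurable_dist_at.
Qed.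

Lemma measurable_nn_rank j :
  measurable_fun setT (fun t => nn_rank nrm (fs t) (fx t) j).
Proof.
apply: measurable_sumn => i; apply: measurable_bool_nat.
exact: measurable_nearer.
Qed.

Lemma measurable_knn_classifier k :
  measurable_fun setT (fun t => knn_classifier nrm k (fs t) (fx t)).
Proof.
rewrite /knn_classifier /label_sign /reg_hat.
apply: measurable_fun_ifT => //.
apply: measurable_fun_ler => //; apply: measurable_funM => //.
under eq_fun do rewrite sum_nearest.
apply: measurable_sumR => i; apply: measurable_fun_ifT => //.
  by apply: measurable_fun_ltn => //; exact: measurable_nn_rank.
exact: (measurableT_comp measurable_snd (measurable_coord i)).
Qed.

End measurable_knn.

(** * Norms and Lebesgue measure on row vectors *)

Section box.
Context (R : realType) (n : nat).

Definition box (a b : 'I_n -> R) : set 'rV[R]_n :=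
  [set x | forall i, a i <= x ord0 i <= b i].

Lemma measurable_box a b : measurable (box a b).
Proof.
rewrite (_ : box a b = \bigcap_(i in [set: 'I_n])
    ((fun x : 'rV[R]_n => x ord0 i) @^-1` `[a i, b i])).
  apply: fin_bigcap_measurable => // i _; rewrite -[X in measurable X]setTI.
  exact: measurable_row_coord.
apply/seteqP; split=> x /= h i; first by move=> _; rewrite /= in_itv/=; exact: h.
by have := h i Logic.I; rewrite /= in_itv.
Qed.

Lemma lebesgue_box a b : (forall i, a i <= b i) ->
  lebesgue_rV (box a b) = (\prod_(i < n) (b i - a i))%:E.
Proof.
move=> ab; rewrite /lebesgue_rV /pushforward.
(* The bounds are extended by 0 beyond [n], since [integral_tuple_prod] takes factors indexed by
   [nat]. *)
pose a' (j : nat) := if insub j is Some i then a i else 0.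
pose b' (j : nat) := if insub j is Some i then b i else 0.
have a'E (i : 'I_n) : a' i = a i by rewrite /a' valK.
have b'E (i : 'I_n) : b' i = b i by rewrite /b' valK.
have ab' j : a' j <= b' j by rewrite /a' /b'; case: insubP.
pose h (j : nat) (x : R) : R := \1_(`[a' j, b' j]%classic) x.
have mh j : measurable_fun setT (h j : measurableTypeR R -> R).
  exact: measurable_indic.
have -> : \prod_(i < n) (b i - a i) = \prod_(i < n) (b' i - a' i).
  by apply: eq_bigr => i _; rewrite a'E b'E.
rewrite -(@integral_tuple_prod _ (measurableTypeR R) R (@lebesgue_measure R) n h
  (fun j => b' j - a' j))//; last first.
  move=> j; rewrite /h integral_indic// setIT.
  rewrite [LHS](lebesgue_measure_itv `[a' j, b' j])/= lte_fin.
  case: ltP => // ba; rewrite (_ : b' j = a' j) ?subrr//.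
  by apply/eqP; rewrite eq_le ba ab'.
set S := _ @^-1` _.
have mS : measurable S.
  rewrite -[X in measurable X]setTI.
  by apply: measurable_rV_of_tuple => //; exact: measurable_box.
rewrite -(setIT S) -integral_indic//; apply: eq_integral => t _; congr EFin.
rewrite indicE; have [/set_mem St|/negP St] := boolP (t \in S).
  rewrite big1// => i _; rewrite /h indicE mem_set//= in_itv/= a'E b'E.
  by have := St i; rewrite mxE.
have [i iab] : exists i, ~ (a i <= tnth t i <= b i).
  apply: contrapT => /forallNP ni; apply: St; apply/mem_set => i.
  by rewrite /rV_of_tuple mxE; apply: contrapT => /ni.
rewrite (bigD1 i)//= /h indicE memNset ?mul0r//= in_itv/= a'E b'E.
exact: iab.
Qed.

End box.

Section norm_on_rows.
Context (R : realType) (n : nat) (nrm : 'rV[R]_n -> R).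
Hypothesis nrm_norm : is_norm nrm.
Implicit Types x y : 'rV[R]_n.

Lemma nrm0 : nrm 0 = 0.
Proof. by rewrite -(scale0r 0) (is_normZ nrm_norm) normr0 mul0r. Qed.

Lemma nrmN x : nrm (- x) = nrm x.
Proof. by rewrite -scaleN1r (is_normZ nrm_norm) normrN1 mul1r. Qed.

Lemma nrmC x y : nrm (x - y) = nrm (y - x).
Proof. by rewrite -nrmN opprB. Qed.

Lemma nrm_le_coord x :
  nrm x <= \sum_i `|x ord0 i| * nrm (delta_mx ord0 i).
Proof.
rewrite {1}(row_sum_delta x); elim/big_rec2: _ => [|i y z _ zy].
  by rewrite nrm0.
by rewrite (le_trans (is_normD nrm_norm _ _))// (is_normZ nrm_norm) lerD2l.
Qed.

(** A constant bounding the norm by the sup norm; the summand 1 keeps it at least 1 for every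
    [n]. *)
Definition nrm_coef : R := 1 + \sum_i nrm (delta_mx ord0 i).

Lemma nrm_coef_gt0 : 0 < nrm_coef.
Proof.
by rewrite ltr_wpDr// sumr_ge0// => i _; exact: is_norm_ge0.
Qed.

Lemma nrm_le_box x e : 0 <= e -> (forall i, `|x ord0 i| <= e) ->
  nrm x <= e * nrm_coef.
Proof.
move=> e0 xe; apply: le_trans (nrm_le_coord x) _.
rewrite mulrDr mulr1 mulr_sumr ler_wpDl// ler_sum// => i _.
by apply: ler_wpM2r => //; exact: is_norm_ge0.
Qed.

(** The sigma-algebra is generated by the coordinates, so continuity of the norm does not give
    measurability at once. The norm is instead the infimum over the countably many rational points
    [q] of functions [g q] built from coordinates. *)
Lemma measurable_nrm : measurable_fun setT nrm.
Proof.
pose g (q : 'rV[rat]_n) (x : 'rV[R]_n) : R := nrm (map_mx ratr q) +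
  \sum_(i < n) `|x ord0 i - ratr (q ord0 i)| * nrm (delta_mx ord0 i).
have mg q : measurable_fun setT (g q).
  apply: measurable_funD; first exact: measurable_cst.
  apply: measurable_sumR => i; apply: measurable_funM; last exact: measurable_cst.
  apply: measurableT_comp => //; apply: measurable_funB => //.
  exact: measurable_row_coord.
have nrm_g q x : nrm x <= g q x.
  rewrite -{1}(subrK (map_mx ratr q) x) addrC.
  rewrite (le_trans (is_normD nrm_norm _ _))// lerD2l.
  apply: le_trans (nrm_le_coord _) _.
  by apply: ler_sum => i _; rewrite !mxE.
have g_nrm x a : nrm x < a -> exists q, g q x < a.
  (* Two errors of at most [e * (nrm_coef - 1)] must fit into [a - nrm x]: one from replacing [x] by
     the rational point inside the norm, one from the sum in [g]. *)
  move=> xa; pose e := (a - nrm x) / (2 * nrm_coef).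
  have e0 : 0 < e by rewrite divr_gt0 ?subr_gt0// mulr_gt0// nrm_coef_gt0.
  have ex (i : 'I_n) : exists q, `|x ord0 i - ratr q| < e.
    have [|q] := @rat_in_itvoo R (x ord0 i - e) (x ord0 i + e); first by lra.
    by rewrite in_itv/= => xq; exists q; rewrite distrC ltr_distl.
  have [f xf] := fin_all_exists ex; exists (\row_i f i).
  have S : \sum_(i < n) `|x ord0 i - ratr ((\row_i f i) ord0 i)| *
      nrm (delta_mx ord0 i) <= e * (nrm_coef - 1).
    rewrite /nrm_coef addrAC subrr add0r mulr_sumr; apply: ler_sum => i _.
    by rewrite ler_wpM2r ?(is_norm_ge0 nrm_norm)// mxE ltW.
  have Q : nrm (map_mx ratr (\row_i f i)) <= nrm x + e * (nrm_coef - 1).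
    rewrite -(subrK x (map_mx _ _)) addrC.
    rewrite (le_trans (is_normD nrm_norm _ _))// lerD2l nrmC.
    apply: le_trans (nrm_le_coord _) _; apply: le_trans S.
    by apply: ler_sum => i _; rewrite !mxE.
  have eL : e * nrm_coef * 2 = a - nrm x.
    by rewrite /e; field; rewrite gt_eqF// nrm_coef_gt0.
  rewrite /g; lra.
apply: (measurability _ (RGenInftyO.measurableE R)) => // _ [_ [a ->] <-].
rewrite setTI (_ : _ @^-1` _ = \bigcup_q (g q @^-1` `]-oo, a[)).
  apply: countable_bigcupT_measurable => // q.
  by rewrite -[X in measurable X]setTI; exact: mg.
apply/seteqP; split=> x /=; rewrite in_itv/=.
  by move=> /g_nrm[q qa]; exists q => //=; rewrite in_itv.
by move=> [q _ /=]; rewrite in_itv/=; exact: le_lt_trans.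
Qed.

(** Equivalence with the sup norm: [c] is the minimum of the continuous [nrm] over the compact
    sup-norm unit sphere, which [0 < n] makes nonempty. *)
Lemma nrm_ge_coord : (0 < n)%N ->
  exists2 c, 0 < c & forall x i, c * `|x ord0 i| <= nrm x.
Proof.
move=> n0.
pose A : set 'rV[R]_n := [set x | `|x| = 1].
have coord_le (x : 'rV[R]_n) i : `|x ord0 i| <= `|x|.
  rewrite [leRHS]/Num.norm/= mx_normrE; apply/bigmax_geP; right.
  by exists (ord0, i).
have le_coord (x : 'rV[R]_n) e : 0 <= e -> (forall i, `|x ord0 i| <= e) -> `|x| <= e.
  move=> e0 xe; rewrite [leLHS]/Num.norm/= mx_normrE; apply/bigmax_leP; split=> //.
  by move=> [i j] _ /=; rewrite ord1.
have A0 : A !=set0.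
  exists (const_mx 1); rewrite /A/=; apply/eqP; rewrite eq_le; apply/andP; split.
    by apply: le_coord => // i; rewrite mxE normr1.
  by have := coord_le (const_mx 1) (Ordinal n0); rewrite mxE normr1.
have cA : compact A.
  apply: bounded_closed_compact.
    by exists 1; split => // y y1 x /= ->; exact: ltW.
  rewrite (_ : A = (fun x : 'rV[R]_n => `|x|) @^-1` [set 1])//.
  by apply: closed_comp => [x _|]; [exact: norm_continuous|exact: closed_eq].
have cnrm : continuous nrm.
  move=> x; apply/(@cvgrPdist_lt _ _ _ _ (nbhs_filter x)) => e e0.
  apply: (proj2 (@nbhs_normP R 'rV[R]_n x _)); exists (e / nrm_coef) => /=.
    by rewrite divr_gt0// nrm_coef_gt0.
  move=> y /=.
  rewrite ltr_pdivlMr ?nrm_coef_gt0//; apply: le_lt_trans.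
  have D z t : nrm z - nrm t <= nrm (z - t).
    by rewrite lerBlDr (le_trans _ (is_normD nrm_norm _ _))// subrK.
  have : nrm (x - y) <= `|x - y| * nrm_coef.
    by apply: nrm_le_box => // i; exact: coord_le.
  apply: le_trans; rewrite ler_norml D andbT lerNl opprB nrmC.
  exact: D.
have [c /set_mem Ac minc] := EVT_min_rV A0 cA (continuous_subspaceT cnrm).
have c0 : 0 < nrm c.
  rewrite lt_neqAle (is_norm_ge0 nrm_norm) andbT eq_sym.
  apply/eqP => /(is_norm_eq0 nrm_norm) c0; move: Ac.
  by rewrite c0 /A/= normr0 => /eqP; rewrite eq_sym oner_eq0.
exists (nrm c) => // x i.
have [->|x0] := eqVneq x 0.
  by rewrite mxE normr0 mulr0; exact: is_norm_ge0.
have nx0 : 0 < `|x| by rewrite normr_gt0.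
apply: (@le_trans _ _ (nrm c * `|x|)); first by rewrite ler_wpM2l ?coord_le// ltW.
rewrite -ler_pdivlMr//.
have -> : nrm x / `|x| = nrm (`|x|^-1 *: x).
  by rewrite (is_normZ nrm_norm) normrV ?unitfE ?gt_eqF// normr_id mulrC.
apply: minc; apply/mem_set; rewrite /A/= normrZ normrV ?unitfE ?gt_eqF//.
by rewrite normr_id mulVf// gt_eqF.
Qed.

Lemma measurable_ball_nrm x r : measurable (ball_ nrm x r).
Proof.
have : measurable_fun setT (fun y => nrm (x - y)).
  by apply: (measurableT_comp measurable_nrm); exact: measurable_rowB.
move=> /(_ measurableT `]-oo, r[%classic (measurable_itv _)).
by rewrite setTI (_ : _ @^-1` _ = ball_ nrm x r).
Qed.

(** The cube of side [r / nrm_coef] centred at [x] stays within distance [r / 2] of [x], which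
    leaves room for the strict inequality of the open ball. *)
Lemma lebesgue_ball_ge x r : 0 < r ->
  (((r / nrm_coef) ^+ n)%:E <= lebesgue_rV (ball_ nrm x r))%E.
Proof.
move=> r0; pose e := r / (2 * nrm_coef).
have L0 := nrm_coef_gt0.
have e0 : 0 < e by rewrite divr_gt0// mulr_gt0.
pose a (i : 'I_n) := x ord0 i - e; pose b (i : 'I_n) := x ord0 i + e.
apply: (@le_trans _ _ (lebesgue_rV (box a b))).
  rewrite lebesgue_box; last by move=> i; rewrite /a /b; lra.
  rewrite (eq_bigr (fun=> r / nrm_coef)); last first.
    by move=> i _; rewrite /a /b /e; field; rewrite gt_eqF.
  by rewrite prodr_const card_ord.
apply: le_measure; rewrite ?inE; [exact: measurable_box|exact: measurable_ball_nrm|].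
move=> y xy; rewrite /ball_/=.
apply: (@le_lt_trans _ _ (e * nrm_coef)).
  apply: nrm_le_box; first exact: ltW.
  move=> i; rewrite !mxE distrC ler_distl; exact: xy.
rewrite /e invfM mulrA mulrVK ?unitfE ?gt_eqF//.
by rewrite ltr_pdivrMr// ltr_pMr// ltr1n.
Qed.

Lemma lebesgue_ball_le c x r : 0 < c -> (forall x i, c * `|x ord0 i| <= nrm x) ->
  0 < r -> (lebesgue_rV (ball_ nrm x r) <= ((2 * r / c) ^+ n)%:E)%E.
Proof.
move=> c0 hc r0.
pose a (i : 'I_n) := x ord0 i - r / c; pose b (i : 'I_n) := x ord0 i + r / c.
have rc0 : 0 < r / c by rewrite divr_gt0.
apply: (@le_trans _ _ (lebesgue_rV (box a b))).
  apply: le_measure; rewrite ?inE; [exact: measurable_ball_nrm|exact: measurable_box|].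
  move=> y; rewrite /ball_/= => xy i.
  rewrite -ler_distl distrC ler_pdivlMr// mulrC.
  by have := hc (x - y) i; rewrite !mxE => /le_trans; apply; exact: ltW.
rewrite lebesgue_box; last by move=> i; rewrite /a /b; lra.
rewrite (eq_bigr (fun=> 2 * r / c)); last by move=> i _; rewrite /a /b; ring.
by rewrite prodr_const card_ord.
Qed.

End norm_on_rows.

(** * The excess risk as an integral *)

Section model_law.
Context (R : realType) (d : nat) (M : model R d).
Local Notation Z := ('rV[R]_d * R)%type.
Local Notation P := (law M).
Local Open Scope ereal_scope.

Lemma ae_label : {ae P, forall z : Z, z.2 = 1%R \/ z.2 = (-1)%R}.
Proof.
have mL : measurable [set z : Z | z.2 = 1%R \/ z.2 = (-1)%R].
  rewrite (_ : [set _ | _] = snd @^-1` ([set 1%R] `|` [set (-1)%R]))//.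
  rewrite -[X in measurable X]setTI.
  by apply: measurable_snd => //; exact: measurableU.
exists (~` [set z : Z | z.2 = 1%R \/ z.2 = (-1)%R]); split => //.
- exact: measurableC.
- by rewrite probability_setC// law_label subee.
Qed.

Lemma measurable_reg1 : measurable_fun setT (fun z : Z => reg M z.1).
Proof. exact: (measurableT_comp (measurable_reg M)). Qed.

Lemma measurable_cylinder (A : set 'rV[R]_d) :
  measurable A -> measurable (A `*` [set: R]).
Proof. by move=> mA; exact: measurableX. Qed.

Lemma integrable_label (B : set Z) : measurable B ->
  P.-integrable B (fun z => z.2%:E).
Proof.
move=> mB; apply/integrableP; split.
  by apply/measurable_EFinP; exact: measurable_funTS.
apply: (@le_lt_trans _ _ (\int[P]_(z in B) (cst 1 z))).
  apply: ae_ge0_le_integral => //.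
  - by apply: measurableT_comp => //; apply/measurable_EFinP; exact: measurable_funTS.
  - apply: filterS ae_label => z h _; rewrite lee_fin.
    by case: h => ->; rewrite ?normrN normr1.
by rewrite integral_cst// mul1e ltey_eq fin_num_measure.
Qed.

(* [reg] is not assumed integrable: [law_reg] yields it on every set where
   [reg] has constant sign. *)
Lemma integral_reg_abs (A : set 'rV[R]_d) (sg : R) : measurable A ->
  (sg = 1 \/ sg = -1)%R ->
  (forall x, A x -> `|reg M x| = sg * reg M x)%R ->
  \int[P]_(z in A `*` setT) `|reg M z.1|%:E =
  \int[P]_(z in A `*` setT) (sg * z.2)%:E.
Proof.
move=> mA sg1 Asg; have mAT := measurable_cylinder mA.
have E : \int[P]_(z in A `*` setT) `|reg M z.1|%:E =
         sg%:E * \int[P]_(z in A `*` setT) (reg M z.1)%:E.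
  have -> : \int[P]_(z in A `*` setT) `|reg M z.1|%:E =
            \int[P]_(z in A `*` setT) (sg * reg M z.1)%:E.
    by apply: eq_integral => z /set_mem[Az _]; rewrite Asg.
  case: sg1 => sgE; rewrite {sg}sgE in Asg *.
    by under eq_integral do rewrite mul1r; rewrite mul1e.
  have -> : \int[P]_(z in A `*` setT) (-1 * reg M z.1)%:E =
            \int[P]_(z in A `*` setT) `|reg M z.1|%:E.
    by apply: eq_integral => z /set_mem[Az _]; rewrite Asg.
  have -> : \int[P]_(z in A `*` setT) (reg M z.1)%:E =
            \int[P]_(z in A `*` setT) - `|reg M z.1|%:E.
    apply: eq_integral => z /set_mem[Az _].
    by rewrite -EFinN Asg// mulN1r opprK.
  by rewrite integral_ge0N// mulN1e oppeK.
by rewrite E -(law_reg M)// -integralZl//; exact: integrable_label.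
Qed.

(** On the set where [sg * reg M] exceeds 1, the integral of its absolute value equals that of
    [sg * Y], hence is at most the mass of the set. The excess over 1 is positive there with
    integral 0, so the set is negligible. *)
Lemma ae_reg_le1 : {ae P, forall z : Z, `|reg M z.1| <= 1}%R.
Proof.
have H sg : (sg = 1 \/ sg = -1)%R ->
    P.-negligible [set z : Z | 1 < sg * reg M z.1]%R.
  move=> sg1; pose A : set 'rV[R]_d := [set x | 1 < sg * reg M x]%R.
  have mA : measurable A.
    have : measurable_fun setT (fun x => sg * reg M x)%R.
      by apply: measurable_funM => //; exact: measurable_reg.
    move=> /(_ measurableT `]1%R, +oo[%classic (measurable_itv _)).
    by rewrite setTI (_ : _ @^-1` _ = A)//; apply/seteqP; split=> x /=;
      rewrite /A/= in_itv/= andbT.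
  have Asg x : A x -> (`|reg M x| = sg * reg M x)%R.
    rewrite /A/=; case: sg1 => ->; rewrite ?mul1r ?mulN1r => h.
      by rewrite ger0_norm//; lra.
    by rewrite ler0_norm//; lra.
  have mAT := measurable_cylinder mA.
  have mf : measurable_fun (A `*` setT) (fun z : Z => (`|reg M z.1| - 1)%:E).
    apply/measurable_EFinP; apply: measurable_funTS.
    apply: measurable_funB => //; apply: measurableT_comp => //.
    exact: measurable_reg1.
  have f0 z : (A `*` [set: R]) z -> 0 <= (`|reg M z.1| - 1)%:E.
    by move=> [Az _]; rewrite lee_fin subr_ge0 Asg//; exact: ltW.
  have I0 : \int[P]_(z in A `*` setT) (`|reg M z.1| - 1)%:E = 0.
    apply/eqP; rewrite eq_le integral_ge0// andbT.
    (* The finite mass of [A] is added to both sides, since splitting the integral of a difference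
       would require [reg] to be integrable. *)
    have PA : P (A `*` setT) \is a fin_num by exact: fin_num_measure.
    rewrite -(leeD2rE _ _ PA) add0e.
    rewrite -[X in _ + X]mul1e -integral_cst// -ge0_integralD//.
    under eq_integral do rewrite -EFinD subrK.
    rewrite (integral_reg_abs mA sg1 Asg).
    rewrite -[leRHS]mul1e -integral_cst//.
    apply: (@le_trans _ _ (\int[P]_(z in A `*` setT) `|sg * z.2|%:E)).
      apply: le_integral => //.
      - under eq_fun do rewrite EFinM.
        by apply: integrableZl => //; exact: integrable_label.
      - under eq_fun do rewrite normrM EFinM.
        apply: integrableZl => //.
        by apply: (integrable_abse (integrable_label mAT)).
      - by move=> z _; rewrite lee_fin ler_norm.
    apply: ae_ge0_le_integral => //.
    - apply/measurable_EFinP; apply: measurable_funTS.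
      apply: measurableT_comp => //; exact: measurable_funM.
    - apply: filterS ae_label => z h _; rewrite lee_fin normrM.
      by case: sg1 => ->; case: h => ->; rewrite ?normrN normr1 mulr1.
  have /ae_eq_integral_abs : \int[P]_(z in A `*` setT) `|(`|reg M z.1| - 1)%:E| = 0.
    by rewrite -[RHS]I0; apply: eq_integral => z /set_mem Az; rewrite gee0_abs// f0.
  move=> /(_ mAT mf) [N [mN N0 sub]]; exists N; split => // z Az.
  apply: sub => /= /(_ (conj Az Logic.I)) /eqP.
  by rewrite eqe subr_eq0 Asg// gt_eqF.
apply: (@negligibleS _ _ _ P _ _ _ (negligibleU (H 1%R _) (H (-1)%R _))).
- move=> z /= /negP; rewrite -ltNge lter_normr => /orP[h|h]; [left|right] => /=.
    by rewrite mul1r.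
  by rewrite mulN1r.
- by left.
- by right.
Qed.

(** Where [g] agrees with the Bayes rule, both err together. Where they differ exactly one errs, and
    the difference of the error indicators is [Y] times the Bayes label, whose integral is that of
    the absolute value of [reg]. *)
Lemma risk_regret (g : 'rV[R]_d -> R) : measurable_fun setT g ->
  (forall x, g x = 1 \/ g x = -1)%R ->
  P [set z | g z.1 != z.2] = P [set z | label_sign (reg M z.1) != z.2] +
  \int[P]_z (`|reg M z.1| * (g z.1 != label_sign (reg M z.1))%:R)%:E.
Proof.
move=> mg g1; pose gs x := label_sign (reg M x).
have gs1 x : (gs x = 1 \/ gs x = -1)%R.
  by rewrite /gs /label_sign; case: ifP => _; [left|right].
have mgs : measurable_fun setT gs.
  apply: measurable_fun_ifT => //; apply: measurable_fun_ler => //.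
  exact: measurable_reg.
have mneq h : measurable_fun setT h ->
    measurable_fun setT (fun z : Z => h z.1 != z.2).
  move=> mh; apply: measurable_neg; apply: measurable_fun_eqr => //.
  exact: measurableT_comp.
rewrite -(integral_boolR P (mneq _ mg)) -(integral_boolR P (mneq _ mgs)).
(* A set of disagreement with constant Bayes label [sg]: there [reg] has constant sign, as
   [integral_reg_abs] requires. *)
have flip (sg : R) A : measurable A -> (sg = 1 \/ sg = -1)%R ->
    (forall x, A x -> gs x = sg /\ g x = - sg)%R ->
    \int[P]_(z in A `*` setT) (g z.1 != z.2)%:R%:E =
    \int[P]_(z in A `*` setT) (gs z.1 != z.2)%:R%:E +
    \int[P]_(z in A `*` setT) (`|reg M z.1| * (g z.1 != gs z.1)%:R)%:E.
  move=> mA sg1 Asg; have mAT := measurable_cylinder mA.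
  have gsg z : (A `*` [set: R]) z -> (g z.1 != gs z.1) = true.
    move=> [/Asg[-> ->] _]; apply/eqP.
    by case: sg1 => -> h; have := oner_neq0 R; lra.
  have Aabs x : A x -> (`|reg M x| = sg * reg M x)%R.
    move=> /Asg[+ _]; rewrite /gs /label_sign; case: ifPn => [r0|]; last first.
      by rewrite -ltNge => r0 <-; rewrite ltr0_norm// mulN1r.
    by move=> <-; rewrite ger0_norm// mul1r.
  have -> : \int[P]_(z in A `*` setT) (`|reg M z.1| * (g z.1 != gs z.1)%:R)%:E =
            \int[P]_(z in A `*` setT) (sg * z.2)%:E.
    rewrite -integral_reg_abs//; apply: eq_integral => z /set_mem Az.
    by rewrite gsg// mulr1.
  rewrite -integralD//; last 2 first.
  - apply: (@measurable_bounded_integrable _ _ _ P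
      (fun z => (gs z.1 != z.2)%:R)) => //.
    + by rewrite ltey_eq fin_num_measure.
    + by apply: measurable_funTS; apply: measurable_boolR; exact: mneq.
    + exists 1%R; split => // y y1 z _ /=; rewrite (le_trans _ (ltW y1))//.
      by case: (_ != _); rewrite ?normr0 ?normr1.
  - under eq_fun do rewrite EFinM.
    by apply: integrableZl => //; exact: integrable_label.
  apply: ae_eq_integral => //.
  - by apply/measurable_EFinP/measurable_funTS/measurable_boolR; exact: mneq.
  - apply: emeasurable_funD; apply/measurable_EFinP/measurable_funTS.
      by apply: measurable_boolR; exact: mneq.
    exact: measurable_funM.
  apply: filterS ae_label => z h Az; have [/Asg[-> ->] _] := Az.
  have n11 : ((1 : R) == -1)%R = false by apply/eqP; lra.
  have n12 : ((-1 : R) == 1)%R = false by apply/eqP; lra.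
  rewrite -EFinD; congr EFin.
  by case: sg1 => ->; case: h => ->; rewrite ?opprK ?eqxx ?n11 ?n12/=; lra.
have meqs (f1 f2 : 'rV[R]_d -> R) : measurable_fun setT f1 ->
    measurable_fun setT f2 -> measurable [set x | f1 x == f2 x].
  by move=> m1 m2; exact/measurable_set_bool/measurable_fun_eqr.
pose A0 : set 'rV[R]_d := [set x | g x == gs x].
have mA0 : measurable A0 by exact: meqs.
pose Ap : set 'rV[R]_d := ~` A0 `&` [set x | gs x == 1%R].
pose Am : set 'rV[R]_d := ~` A0 `&` [set x | gs x == (-1)%R].
have mAp : measurable Ap.
  by apply: measurableI; [exact: measurableC|exact: (meqs _ (cst 1%R))].
have mAm : measurable Am.
  by apply: measurableI; [exact: measurableC|exact: (meqs _ (cst (-1)%R))].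
have split3 (F : Z -> \bar R) : measurable_fun setT F -> (forall z, 0 <= F z) ->
    \int[P]_z F z = \int[P]_(z in A0 `*` setT) F z +
      (\int[P]_(z in Ap `*` setT) F z + \int[P]_(z in Am `*` setT) F z).
  move=> mF F0; have := measurable_cylinder mA0.
  have := measurable_cylinder mAp; have := measurable_cylinder mAm => m1 m2 m3.
  rewrite -ge0_integral_setU//; last 2 first.
  - exact: measurable_funTS.
  - rewrite disj_set2E; apply/eqP; rewrite -subset0 => z [[[_ /eqP h] _] [[_ /eqP]]].
    by move=> /= + _; rewrite h/=; lra.
  rewrite -ge0_integral_setU//; last 3 first.
  - exact: measurableU.
  - exact: measurable_funTS.
  - rewrite disj_set2E; apply/eqP; rewrite -subset0.
    by move=> z [[h _] [[[+ _] _]|[[+ _] _]]].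
  congr (integral _ _ _); apply/esym; rewrite -subTset => z _.
  have [h|h] := pselect (A0 z.1); first by left.
  right; case: (gs1 z.1) => e; [left|right]; split => //; split => //; exact/eqP.
have mT (h : Z -> bool) : measurable_fun setT h ->
    measurable_fun setT (fun z => (h z)%:R%:E : \bar R).
  by move=> mh; apply/measurable_EFinP; exact: measurable_boolR.
rewrite !split3//; last 3 first.
- by apply: mT; exact: mneq.
- by apply: mT; exact: mneq.
- apply/measurable_EFinP/measurable_funM.
    by apply: measurableT_comp => //; exact: measurable_reg1.
  apply/measurable_boolR/measurable_neg/measurable_fun_eqr.
    exact: (measurableT_comp mg).
  exact: (measurableT_comp mgs).
have E0 : \int[P]_(z in A0 `*` setT) (g z.1 != z.2)%:R%:E =
    \int[P]_(z in A0 `*` setT) (gs z.1 != z.2)%:R%:E.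
  by apply: eq_integral => z /set_mem[/= /eqP -> _].
have E1 : \int[P]_(z in A0 `*` setT)
    (`|reg M z.1| * (g z.1 != gs z.1)%:R)%:E = 0.
  by apply: integral0_eq => z [/= h _]; rewrite h mulr0.
rewrite E0 E1 add0e (flip 1%R Ap)//; last 2 first.
- by left.
- move=> x [/= /negP/eqP h /eqP gx]; split => //.
  by case: (g1 x) => // gx1; case: h; rewrite gx1 gx.
rewrite (flip (-1)%R Am)//; last 2 first.
- by right.
- move=> x [/= /negP/eqP h /eqP gx]; split => //.
  by rewrite opprK; case: (g1 x) => // gx1; case: h; rewrite gx1 gx.
have assoc (a b c e f : \bar R) :
    a + ((b + c) + (e + f)) = (a + (b + e)) + (c + f) by rewrite [X in a + X]addeACA -[RHS]addeA.
exact: assoc.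
Qed.

Section regret.
Variable nrm : 'rV[R]_d -> R.
Hypothesis nrm_norm : is_norm nrm.
Variables (k N : nat).

Let mnrm := measurable_nrm nrm_norm.

Lemma measurable_label_sign_reg :
  measurable_fun setT (fun x => label_sign (reg M x)).
Proof.
apply: measurable_fun_ifT => //; apply: measurable_fun_ler => //.
exact: measurable_reg.
Qed.

Let wrong (w : N.-tuple Z * Z) : bool :=
  knn_classifier nrm k w.1 w.2.1 != label_sign (reg M w.2.1).

Let mknn : measurable_fun setT
  (fun w : N.-tuple Z * Z => knn_classifier nrm k w.1 w.2.1).
Proof.
apply: (measurable_knn_classifier mnrm) => //.
exact: (measurableT_comp measurable_fst measurable_snd).
Qed.

Let mwrong : measurable_fun setT wrong.
Proof.
apply/measurable_neg/measurable_fun_eqr => //.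
apply: (measurableT_comp measurable_label_sign_reg).
exact: (measurableT_comp measurable_fst measurable_snd).
Qed.

Lemma measurable_wrong_at x : measurable_fun setT (fun s : N.-tuple Z =>
  knn_classifier nrm k s x != label_sign (reg M x)).
Proof.
apply/measurable_neg/measurable_fun_eqr => //.
exact: (measurable_knn_classifier mnrm).
Qed.

Lemma measurable_error_prob : measurable_fun setT (fun z : Z =>
  tuple_measure P N [set s | knn_classifier nrm k s z.1 !=
                             label_sign (reg M z.1)]).
Proof.
have mW : measurable [set w | wrong w].
  exact: (measurable_set_bool mwrong).
rewrite (_ : (fun _ => _) = tuple_measure P N \o ysection [set w | wrong w]).
  exact: measurable_fun_ysection.
apply/funext => z /=; congr (tuple_measure _ _ _).
by apply/seteqP; split=> s; rewrite /ysection/= inE.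
Qed.

(** [risk_regret] for each fixed sample, followed by Tonelli to integrate over the sample at a fixed
    test point. *)
Lemma excess_riskE : (excess_risk nrm k N M)%:E =
  \int[P]_z (`|reg M z.1|%:E *
    tuple_measure P N [set s | knn_classifier nrm k s z.1 !=
                               label_sign (reg M z.1)]).
Proof.
pose h w : \bar R := (`|reg M w.2.1| * (wrong w)%:R)%:E.
have mh : measurable_fun setT h.
  apply/measurable_EFinP/measurable_funM; last exact: measurable_boolR.
  by apply: measurableT_comp => //; exact: (measurableT_comp measurable_reg1).
have h0 w : 0 <= h w by rewrite lee_fin mulr_ge0.
pose L := P [set z | label_sign (reg M z.1) != z.2].
pose W : set (N.-tuple Z * Z) :=
  [set w | knn_classifier nrm k w.1 w.2.1 != w.2.2].
have E : (tuple_measure P N \x P) W =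
    L + \int[tuple_measure P N]_s \int[P]_z h (s, z).
  transitivity (\int[tuple_measure P N]_s (L + \int[P]_z h (s, z))).
    apply: eq_integral => s _; rewrite /h/= -(risk_regret (g := knn_classifier nrm k s)).
    - congr (P _); apply/seteqP; split=> z; rewrite /xsection/= inE//.
    - exact: (measurable_knn_classifier mnrm).
    - by move=> x; rewrite /knn_classifier /label_sign; case: ifP => _; [left|right].
  rewrite ge0_integralD//; last 3 first.
  - by move=> s _; exact: measure_ge0.
  - by move=> s _; exact: integral_ge0.
  - exact: measurable_fun_fubini_tonelli_F.
  by rewrite integral_tuple_cst.
(* [excess_risk] subtracts [fine] values, so both risks must first be seen to be finite. *)
have W1 : (tuple_measure P N \x P) W <= 1.
  have mW : measurable W.
    have mb : measurable_fun setT (fun w : N.-tuple Z * Z =>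
        knn_classifier nrm k w.1 w.2.1 != w.2.2).
      apply/measurable_neg/measurable_fun_eqr => //.
      exact: (measurableT_comp measurable_snd measurable_snd).
    exact: (measurable_set_bool mb).
  apply: (@le_trans _ _ ((tuple_measure P N \x P) (setT `*` setT))).
    by apply: le_measure; rewrite ?inE//; exact: measurableX.
  by rewrite product_measure1E// [X in X * _]tuple_measure_setT mul1e; exact: probability_le1.
have Lf : L \is a fin_num.
  apply: fin_num_measure; apply: measurable_set_bool.
  apply/measurable_neg/measurable_fun_eqr => //.
  exact: (measurableT_comp measurable_label_sign_reg).
have If : \int[tuple_measure P N]_s \int[P]_z h (s, z) \is a fin_num.
  rewrite ge0_fin_numE; last first.
    by apply: integral_ge0 => s _; exact: integral_ge0.
  by apply: le_lt_trans (ltry 1%R); apply: le_trans W1; rewrite E leeDr//; exact: measure_ge0.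
have Wf : (tuple_measure P N \x P) W \is a fin_num by rewrite E fin_numD Lf If.
have -> : excess_risk nrm k N M = (fine ((tuple_measure P N \x P) W) - fine L)%R.
  by [].
rewrite EFinB !fineK// E addeAC subee// add0e.
rewrite (fubini_tonelli h)//; apply: eq_integral => z _; rewrite /h/=.
rewrite -integral_boolR; last exact: measurable_wrong_at.
rewrite -ge0_integralZl//.
by apply/measurable_EFinP/measurable_boolR; exact: measurable_wrong_at.
Qed.

End regret.
End model_law.

(** * Error probability at a point *)

Section nearest_weight.
Context (R : realType) (d : nat) (nrm : 'rV[R]_d -> R).
Hypothesis nrm_norm : is_norm nrm.
Local Notation Z := ('rV[R]_d * R)%type.
Variables (P : probability Z R) (x : 'rV[R]_d) (phi : Z -> R) (q r0 : R).
Hypothesis mphi : measurable_fun setT phi.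
Hypothesis phi0 : forall z, 0 <= phi z.
Hypothesis q0 : 0 <= q.
Local Open Scope ereal_scope.
Hypothesis phi_ball : forall r, (0 < r < r0)%R ->
  \int[P]_(z in ball_ nrm x r `*` setT) (phi z)%:E <=
  q%:E * P (ball_ nrm x r `*` setT).

Let mnrm := measurable_nrm nrm_norm.

Let measurable_dist : measurable_fun setT (fun z : Z => nrm (z.1 - x)).
Proof. by apply: (measurableT_comp mnrm); exact: measurable_rowB. Qed.

(* [c] tells whether the sphere is included. *)
Let near (rho : R) (c : bool) (z : Z) : bool :=
  ((nrm (z.1 - x) <= rho) && ((rho <= nrm (z.1 - x)) ==> c))%R.

Let measurable_near rho c : measurable_fun setT (near rho c).
Proof.
apply: measurable_and; first exact: measurable_fun_ler.
under eq_fun do rewrite implybE.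
by apply: measurable_or => //; apply: measurable_neg; exact: measurable_fun_ler.
Qed.

(** The hypothesis on [phi] concerns open balls. For the closed ball the radii [e n] decrease to
    [rho] while staying below [r0], and continuity of [P] from above passes the bound to the
    limit. *)
Let phi_near rho c : (rho < r0)%R ->
  \int[P]_(z in [set z | near rho c z]) (phi z)%:E <= q%:E * P [set z | near rho c z].
Proof.
move=> rr0; have mE (D : set Z) : measurable_fun D (fun z => (phi z)%:E).
  by apply/measurable_EFinP; exact: measurable_funTS.
have mB r : measurable (ball_ nrm x r `*` [set: R]).
  by apply: measurable_cylinder; exact: measurable_ball_nrm.
case: c.
  have [rho0|rho0] := ltP rho 0%R.
    rewrite (_ : [set z | near rho true z] = set0).
      by rewrite integral_set0 measure0 mule0.
    rewrite -subset0 => z /=; rewrite /near implybT andbT => h.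
    by have := le_lt_trans h rho0; rewrite ltNge (is_norm_ge0 nrm_norm).
  (* [n.+2] keeps every radius, also that for [n = 0], strictly below [r0]. *)
  pose e n := (rho + (r0 - rho) / n.+2%:R)%R.
  have e_gt n : (rho < e n < r0)%R.
    rewrite /e ltrDl divr_gt0 ?subr_gt0//= -ltrBrDl ltr_pdivrMr//.
    by rewrite ltr_pMr ?subr_gt0// ltr1n.
  pose B n := ball_ nrm x (e n) `*` [set: R].
  set A := [set z | _].
  have AB n : A `<=` B n.
    move=> z; rewrite /A/B/near/= implybT andbT => h; split => //.
    rewrite /ball_/= (nrmC nrm_norm); apply: le_lt_trans h _.
    by case/andP: (e_gt n).
  have AE : A = \bigcap_n B n.
    apply/seteqP; split=> [z Az n _|z Bz]; first exact: AB.
    rewrite /A/=/near implybT andbT leNgt; apply/negP => zr.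
    have d0 : (0 < nrm (z.1 - x) - rho)%R by rewrite subr_gt0.
    (* For this [n] the radius [e n] is at most the distance of [z] from [x], so [z] is outside
       [B n]. *)
    pose n := Num.truncn ((r0 - rho) / (nrm (z.1 - x) - rho)).
    have [+ _] := Bz n Logic.I; rewrite /ball_/= (nrmC nrm_norm) /e ltNge.
    move=> /negP; apply; rewrite -lerBrDl ler_pdivrMr// mulrC -ler_pdivrMr//.
    by apply/ltW/(lt_trans (truncnS_gt _)); rewrite ltr_nat.
  have cvgB : P \o B @ \oo --> P A.
    rewrite AE; apply: nonincreasing_cvg_mu.
    - by rewrite ltey_eq fin_num_measure//; exact: mB.
    - by move=> n; exact: mB.
    - by apply: bigcapT_measurable => n; exact: mB.
    - apply/nonincreasing_seqP => n; apply/subsetPset => z [h _]; split => //.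
      move: h; rewrite /ball_/= => /lt_le_trans; apply.
      by rewrite lerD2l ler_wpM2l ?subr_ge0 ?(ltW rr0)// lef_pV2 ?posrE// ler_nat.
  have cvgqB : (fun n => q%:E * P (B n)) @ \oo --> q%:E * P A.
    by apply: cvgeZl => //; exact: cvgB.
  rewrite -(cvg_lim _ cvgqB)//; apply: lime_ge; first by apply/cvg_ex; eexists; exact: cvgqB.
  apply: nearW => n; apply: (@le_trans _ _ (\int[P]_(z in B n) (phi z)%:E)).
    apply: ge0_subset_integral => //.
    - exact: measurable_set_bool.
    - exact: mB.
    - by move=> z _; rewrite lee_fin.
  apply: phi_ball; have /andP[h ->] := e_gt n.
  by rewrite andbT (le_lt_trans rho0 h).
have [rho0|rho0] := leP rho 0%R.
  rewrite (_ : [set z | near rho false z] = set0).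
    by rewrite integral_set0 measure0 mule0.
  rewrite -subset0 => z /=; rewrite /near implybF -ltNge => /andP[_ h].
  by have := lt_le_trans h rho0; rewrite ltNge (is_norm_ge0 nrm_norm).
rewrite (_ : [set z | near rho false z] = ball_ nrm x rho `*` setT).
  by apply: phi_ball; rewrite rho0.
apply/seteqP; split=> z; rewrite /near /ball_/= implybF -ltNge (nrmC nrm_norm).
  by move=> /andP[_ ->].
by move=> [h _]; rewrite h ltW.
Qed.

(** With the point at place [j] fixed, its rank is the number of hits among the other points and the
    product is the weight of the hit ones, so [integral_hit_weight_le] applies. The factor with [r0]
    confines the radius to where the ball estimate holds. *)
Lemma integral_nearest_weight_le n (k : nat) (j : 'I_n.+1) :
  \int[tuple_measure P n.+1]_s ((dist_at nrm s x j < r0)%R%:R *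
    ((nn_rank nrm s x j == k)%:R *
     \prod_(i < n.+1) (if nearer nrm s x i j then phi (tnth s i) else 1)))%R%:E <=
  (q ^+ k)%:E * \int[tuple_measure P n.+1]_s (nn_rank nrm s x j == k)%:R%:E.
Proof.
(* [bump j i] is the place in the full sample of coordinate [i] of the shortened one; its comparison
   with [j] selects the closed or the open ball. *)
pose a (y : Z) (i : nat) := near (nrm (y.1 - x)) (bump j i < j)%N.
have distE (y : Z) t : dist_at nrm (tuple_insert j y t) x j = nrm (y.1 - x).
  by rewrite /dist_at tnth_insert_at.
have nearE (y : Z) (t : n.-tuple Z) i :
    nearer nrm (tuple_insert j y t) x (lift j i) j = a y i (tnth t i).
  by rewrite /nearer /dist_at tnth_insert_at tnth_insert_lift.
have rankE (y : Z) t : nn_rank nrm (tuple_insert j y t) x j = hits (a y) t.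
  rewrite /nn_rank (bigD1_ord j)//= nearer_irr add0n.
  by apply: eq_bigr => i _; rewrite nearE.
have prodE (y : Z) t : (\prod_(i < n.+1)
    (if nearer nrm (tuple_insert j y t) x i j
     then phi (tnth (tuple_insert j y t) i) else 1) =
    hit_weight (a y) phi t)%R.
  rewrite (bigD1_ord j)//= nearer_irr mul1r.
  by apply: eq_bigr => i _; rewrite nearE tnth_insert_lift.
have mrank : measurable_fun setT (fun s : n.+1.-tuple Z =>
    (nn_rank nrm s x j == k)%:R : R).
  apply: measurable_boolR; apply: measurable_fun_eqn => //.
  exact: (measurable_nn_rank mnrm).
have mprod : measurable_fun setT (fun s : n.+1.-tuple Z =>
    \prod_(i < n.+1) (if nearer nrm s x i j then phi (tnth s i) else 1))%R.
  apply: measurable_prodR => i; apply: measurable_fun_ifT => //.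
    exact: (measurable_nearer mnrm).
  exact: measurable_comp_tnth.
set F := fun s => EFin _; set G := fun s => EFin _.
have mF : measurable_fun setT F.
  apply/measurable_EFinP; apply: measurable_funM; last exact: measurable_funM.
  apply: measurable_boolR; apply: measurable_fun_ltr => //.
  exact: (measurable_dist_at mnrm).
have F0 s : 0 <= F s.
  by rewrite lee_fin !mulr_ge0// prodr_ge0// => i _; case: ifP.
have mG : measurable_fun setT G by exact/measurable_EFinP.
have G0 s : 0 <= G s by rewrite lee_fin.
rewrite !(integral_tuple_insert P j)//.
have mFj := measurable_integral_insert P j mF F0.
have mGj := measurable_integral_insert P j mG G0.
rewrite -ge0_integralZl//; last 2 first.
- by move=> y _; exact: integral_ge0.
- by rewrite lee_fin exprn_ge0.
apply: ge0_le_integral => //.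
- by move=> y _; apply: integral_ge0 => t _; exact: F0.
- exact: emeasurable_funM.
rewrite /F /G {F G mF F0 mG G0 mFj mGj}.
move=> y _; under eq_integral do rewrite distE rankE prodE.
under [X in _ <= _ * X]eq_integral do rewrite rankE.
case: ltP => [yr0|_]; last first.
  rewrite integral0_eq//; last by move=> t _; rewrite mul0r.
  rewrite mule_ge0 ?lee_fin ?exprn_ge0//.
  by apply: integral_ge0 => t _; rewrite lee_fin.
under eq_integral do rewrite mul1r.
apply: integral_hit_weight_le => //; first by move=> i; exact: measurable_near.
by move=> i; exact: phi_near.
Qed.

End nearest_weight.

Section error_at_point.
Context (R : realType) (d : nat) (nrm : 'rV[R]_d -> R).
Hypothesis nrm_norm : is_norm nrm.
Variables (M : model R d) (x : 'rV[R]_d) (n k : nat) (r0 D : R).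
Local Notation Z := ('rV[R]_d * R)%type.
Local Notation P := (law M).
Hypothesis k_gt0 : (0 < k)%N.
Hypothesis k_le : (k <= n)%N.
Hypothesis D01 : 0 < D < 1.
Let sg := label_sign (reg M x).
Local Open Scope ereal_scope.
Hypothesis bias : forall r, (0 < r < r0)%R ->
  D%:E * P (ball_ nrm x r `*` setT) <=
  \int[P]_(z in ball_ nrm x r `*` setT) (sg * z.2)%:E.

Let mnrm := measurable_nrm nrm_norm.

Let sg1 : (sg = 1 \/ sg = -1)%R.
Proof. by rewrite /sg /label_sign; case: ifP => _; [left|right]. Qed.

Let kap := Num.sqrt (1 - D ^+ 2).

Let kap2 : (kap ^+ 2 = (1 - D) * (1 + D))%R.
Proof.
rewrite sqr_sqrtr; first by ring.
by case/andP: D01 => D0 D1; rewrite subr_ge0 expr_le1// ltW.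
Qed.

Let kap_gt0 : (0 < kap)%R.
Proof.
case/andP: D01 => D0 D1.
by rewrite sqrtr_gt0 subr_gt0 expr_lt1// ltW.
Qed.

(* Among variables with values in {-1, 1} and mean at least [D], the largest
   value of E exp (- lam Y) is smallest at this [lam], where it is [kap]. *)
Let lam := ln ((1 + D) / kap).

Let phi (z : Z) : R := expR (- (lam * (sg * z.2))).

Let expRlam : expR lam = ((1 + D) / kap)%R.
Proof. by rewrite lnK// posrE divr_gt0//; case/andP: D01 => *; lra. Qed.

Let lam_ge0 : (0 <= lam)%R.
Proof.
case/andP: D01 => D0 D1; rewrite ln_ge0// ler_pdivlMr// mul1r.
rewrite -(@ler_pXn2r _ 2)// ?nnegrE ?(ltW kap_gt0)//; last lra.
by rewrite kap2; nra.
Qed.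

Let mphi : measurable_fun setT phi.
Proof.
apply: measurableT_comp => //; apply: measurable_funN.
by apply: measurable_funM => //; exact: measurable_funM.
Qed.

Let phi_ball r : (0 < r < r0)%R ->
  \int[P]_(z in ball_ nrm x r `*` setT) (phi z)%:E <=
  kap%:E * P (ball_ nrm x r `*` setT).
Proof.
move=> rr0; set B := _ `*` _.
case/andP: (D01) => D0 D1.
have mB : measurable B.
  by apply: measurable_cylinder; exact: measurable_ball_nrm.
have il := integrable_label M mB.
have PB : P B \is a fin_num by exact: fin_num_measure.
have isy : P.-integrable B (fun z => (sg * z.2)%:E).
  by under eq_fun do rewrite EFinM; exact: integrableZl.
(* For [t] equal to 1 or -1, [exp (- lam * t)] coincides with the affine function
   [(1 - D * t) / kap]; a mean of at least [D] then yields [(1 - D ^ 2) / kap = kap]. *)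
have -> : \int[P]_(z in B) (phi z)%:E =
    \int[P]_(z in B) (kap^-1%:E * (1%:E - D%:E * (sg * z.2)%:E)).
  apply: ae_eq_integral => //.
  - by apply/measurable_EFinP; exact: measurable_funTS.
  - apply: emeasurable_funM => //; apply: emeasurable_funB => //.
    by apply: emeasurable_funM => //; exact: measurable_int isy.
  apply: filterS (ae_label M) => z h _.
  rewrite -!EFinM; congr EFin; rewrite /phi.
  have e1 : expR (- lam) = (kap^-1 * (1 - D))%R.
    rewrite expRN expRlam invf_div; apply: (@mulfI _ (kap * (1 + D))%R).
      by rewrite mulf_neq0 ?gt_eqF//; lra.
    by field: kap2; rewrite !gt_eqF//; lra.
  have h' : (sg * z.2 = 1 \/ sg * z.2 = -1)%R.
    by case: sg1 => ->; case: h => ->; [left|right|right|left]; ring.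
  case: h' => ->; rewrite ?mulr1 ?e1//.
  by rewrite mulrN1 opprK expRlam mulrN1 opprK mulrC.
have iD : P.-integrable B (fun z => D%:E * (sg * z.2)%:E).
  exact: integrableZl.
have i1 : P.-integrable B (cst 1%:E) by exact: finite_measure_integrable_cst.
rewrite integralZl//; last exact: integrableB.
rewrite integralB// integral_cst// mul1e integralZl//.
have Ifin : \int[P]_(z in B) (sg * z.2)%:E \is a fin_num.
  exact: integrable_fin_num.
have := bias rr0; rewrite -/B.
rewrite -[X in _ -> _ * (X - _) <= _](fineK PB) -(fineK PB) -(fineK Ifin).
move: (fine (\int[P]_(z in B) _)) (fine (P B)) => I p.
rewrite -!EFinM !lee_fin => DpI.
rewrite /= mulrC ler_pdivrMr// mulrAC -expr2 kap2.
have : (0 <= D * (I - D * p))%R by rewrite mulr_ge0 ?subr_ge0// ltW.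
by lra.
Qed.

Let inball (_ : nat) (z : Z) : bool := (nrm (z.1 - x) < r0)%R.

Let minball i : measurable_fun setT (inball i).
Proof.
apply: measurable_fun_ltr => //; apply: (measurableT_comp mnrm).
exact: measurable_rowB.
Qed.

Let err (s : n.+1.-tuple Z) : bool := knn_classifier nrm k s x != sg.

(* If more than [k] sample points lie within [r0], the (k+1)-th nearest one [j]
   does, and an error makes the product of [phi] over the [k] points nearer
   than [j] at least 1. *)
Lemma err_le (s : n.+1.-tuple Z) : ((err s)%:R <= (hits inball s <= k)%N%:R +
  \sum_(j < n.+1) ((dist_at nrm s x j < r0)%R%:R * ((nn_rank nrm s x j == k)%:R *
     \prod_(i < n.+1) (if nearer nrm s x i j then phi (tnth s i) else 1))))%R.
Proof.
have T0 j : (0 <= (dist_at nrm s x j < r0)%R%:R * ((nn_rank nrm s x j == k)%:R *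
    \prod_(i < n.+1) (if nearer nrm s x i j then phi (tnth s i) else 1)) :> R)%R.
  rewrite !mulr_ge0// prodr_ge0// => i _; case: ifP => // _; exact: expR_ge0.
case: leqP => [_|kh].
  apply: (@le_trans _ _ 1%R); first by case: (err s).
  by rewrite lerDl sumr_ge0.
rewrite add0r; case: (boolP (err s)) => [es|_]; last by rewrite sumr_ge0.
(* Ranks start at 0, so rank [k] is the (k+1)-th neighbour; it exists because [k <= n] and the
   sample has [n.+1] points. *)
have [j jk] : exists j, nn_rank nrm s x j = k by apply: nn_rank_ex; lia.
rewrite (bigD1 j)//= -[leLHS]addr0 lerD ?sumr_ge0//.
rewrite (nn_rank_dist jk kh) jk eqxx !mul1r.
rewrite (eq_bigr (fun i => expR (- (lam * (sg *
   (if (nn_rank nrm s x i < k)%N then (tnth s i).2 else 0))))%R)); last first.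
  move=> i _; rewrite -nn_rank_ltn jk; case: ifP => // _.
  by rewrite !mulr0 oppr0 expR0.
rewrite -expR_sum -[leLHS]expR0 ler_expR.
have -> : (\sum_(i < n.+1) - (lam * (sg *
    (if (nn_rank nrm s x i < k)%N then (tnth s i).2 else 0))))%R =
    (- (lam * (sg * \sum_(z <- nearest nrm k s x) z.2)))%R.
  by rewrite sum_nearest !mulr_sumr sumrN.
(* An error means that [sg] times the label sum is at most 0, so the exponent is nonnegative. *)
rewrite oppr_ge0 mulr_ge0_le0//; move: es.
have k0 : (0 <= k%:R^-1 :> R)%R by [].
rewrite /err /knn_classifier /reg_hat /sg /label_sign.
rewrite pmulr_rge0 ?invr_gt0 ?ltr0n//.
set S := (\sum_(z <- _) z.2)%R; case: (leP 0%R S) => S0.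
  by case: leP => _; rewrite ?eqxx//= => _; rewrite mulN1r oppr_le0.
by case: leP => _; rewrite ?eqxx//= => _; rewrite mul1r ltW.
Qed.

Let p := fine (P (ball_ nrm x r0 `*` setT)).

(** Chernoff bound with parameter 1: the indicator is at most [exp (k - hits)], and each sample
    point contributes [1 - p * (1 - exp (-1))], which is at most [exp (- p / 2)] because
    [2 <= exp 1]. *)
Let hits_le : \int[tuple_measure P n.+1]_s ((hits inball s <= k)%N%:R : R)%:E <=
  (expR (k%:R - n.+1%:R * p / 2))%:E.
Proof.
pose h (z : Z) : R := expR (- (inball 0 z)%:R).
have mh : measurable_fun setT h.
  by apply: measurableT_comp => //; apply: measurable_funN; exact: measurable_boolR.
have mB : measurable (ball_ nrm x r0 `*` [set: R]).
  by apply: measurable_cylinder; exact: measurable_ball_nrm.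
have BE : [set z | inball 0 z] = ball_ nrm x r0 `*` setT.
  by apply/seteqP; split=> z; rewrite /inball /ball_/= (nrmC nrm_norm) => // -[].
have p01 : (0 <= p <= 1)%R.
  rewrite /p fine_ge0//=; rewrite -lee_fin fineK ?fin_num_measure//.
  exact: probability_le1.
pose c := (1 - p * (1 - expR (-1)))%R.
have hc : \int[P]_z (h z)%:E = c%:E.
  have -> : \int[P]_z (h z)%:E = \int[P]_z ((1 : R)%:E - (1 - expR (-1))%:E * (inball 0 z)%:R%:E).
    apply: eq_integral => z _; rewrite -EFinM -EFinB /h; congr EFin.
    by case: (inball 0 z); rewrite ?oppr0 ?expR0 ?mulr1 ?mulr0; ring.
  have ib : P.-integrable setT (fun z => ((inball 0 z)%:R : R)%:E).
    apply: (@measurable_bounded_integrable _ _ _ P (fun z => (inball 0 z)%:R)) => //.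
    - by rewrite ltey_eq fin_num_measure.
    - exact: measurable_boolR.
    - exists 1%R; split => // y y1 z _ /=; rewrite (le_trans _ (ltW y1))//.
      by case: (inball _ _); rewrite ?normr0 ?normr1.
  rewrite integralB//; last 2 first.
  - exact: finite_measure_integrable_cst.
  - exact: integrableZl.
  rewrite integral_cst// mul1e integralZl// integral_boolR// BE.
  rewrite -[X in _ - _ * X]fineK ?fin_num_measure//.
  rewrite [X in X - _](_ : _ = 1%E); last exact: probability_setT.
  by rewrite -EFinM -EFinB /c mulrC.
have cp : (c <= expR (- (p / 2)))%R.
  apply: le_trans (expR_ge1Dx _); rewrite /c lerD2l lerN2.
  have e2 : (2 <= expR 1 :> R)%R by have := expR_ge1Dx (1 : R); lra.
  have : (expR (-1) <= 2^-1 :> R)%R.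
    by rewrite expRN lef_pV2 ?posrE// expR_gt0.
  by case/andP: p01; nra.
have c0 : (0 <= c)%R.
  rewrite -lee_fin -hc; apply: integral_ge0 => z _; rewrite lee_fin.
  exact: expR_ge0.
apply: (@le_trans _ _ (\int[tuple_measure P n.+1]_s
   ((expR k%:R)%:E * (\prod_(i < n.+1) h (tnth s i))%R%:E))).
  apply: ge0_le_integral => //.
  - apply/measurable_EFinP/measurable_boolR/measurable_fun_leq => //.
    exact: measurable_hits.
  - apply: emeasurable_funM => //; apply/measurable_EFinP.
    by apply: measurable_prodR => i; exact: measurable_comp_tnth.
  move=> s _; rewrite -EFinM lee_fin; case: leqP => [hk|_]; last first.
    rewrite mulr_ge0 ?expR_ge0// prodr_ge0// => i _; exact: expR_ge0.
  rewrite /h -expR_sum -expRD -[leLHS]expR0 ler_expR.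
  by rewrite sumrN subr_ge0 -natr_sum ler_nat.
rewrite ge0_integralZl//; last 2 first.
- apply/measurable_EFinP.
  by apply: measurable_prodR => i; exact: measurable_comp_tnth.
- by move=> s _; rewrite lee_fin prodr_ge0// => i _; exact: expR_ge0.
rewrite (@integral_tuple_prod _ _ _ P n.+1 (fun=> h) (fun=> c))//; last first.
  by move=> _ z; exact: expR_ge0.
rewrite prodr_const card_ord -EFinM lee_fin expRD ler_wpM2l ?expR_ge0//.
rewrite -mulrA -mulrN expRM_natl; by apply: lerXn2r; rewrite ?nnegrE// expR_ge0.
Qed.

(** The first term of [err_le] is handled by [hits_le]. In the second, at most one place has rank
    [k], so the rank probabilities add up to at most 1 and the whole sum over [j] is bounded by
    [kap ^ k]. *)
Lemma knn_error_prob_le :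
  tuple_measure P n.+1 [set s | knn_classifier nrm k s x != label_sign (reg M x)]
  <= (expR (k%:R - n.+1%:R * p / 2) + expR (- (k%:R * D ^+ 2 / 2)))%:E.
Proof.
have merr : measurable_fun setT err by exact: measurable_wrong_at.
pose T j (s : n.+1.-tuple Z) := ((dist_at nrm s x j < r0)%R%:R *
  ((nn_rank nrm s x j == k)%:R *
   \prod_(i < n.+1) (if nearer nrm s x i j then phi (tnth s i) else 1)))%R.
have T0 j s : (0 <= T j s)%R.
  rewrite !mulr_ge0// prodr_ge0// => i _; case: ifP => // _; exact: expR_ge0.
have mrank j : measurable_fun setT (fun s : n.+1.-tuple Z =>
    (nn_rank nrm s x j == k)%:R : R).
  apply: measurable_boolR; apply: measurable_fun_eqn => //.
  exact: (measurable_nn_rank mnrm).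
have mT j : measurable_fun setT (T j).
  apply: measurable_funM.
    apply: measurable_boolR; apply: measurable_fun_ltr => //.
    exact: (measurable_dist_at mnrm).
  apply: measurable_funM => //; apply: measurable_prodR => i.
  apply: measurable_fun_ifT => //; first exact: (measurable_nearer mnrm).
  exact: measurable_comp_tnth.
have mhit : measurable_fun setT (fun s : n.+1.-tuple Z =>
    (hits inball s <= k)%N%:R : R).
  by apply/measurable_boolR/measurable_fun_leq => //; exact: measurable_hits.
rewrite -integral_boolR//.
apply: (@le_trans _ _ (\int[tuple_measure P n.+1]_s
    (((hits inball s <= k)%N%:R : R)%:E + \sum_(j < n.+1) (T j s)%:E))).
  apply: ge0_le_integral => //.
  - exact/measurable_EFinP/measurable_boolR.
  - apply: emeasurable_funD; first exact/measurable_EFinP.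
    by apply: emeasurable_sum => j; exact/measurable_EFinP.
  - by move=> s _; rewrite sumEFin -EFinD lee_fin; exact: err_le.
rewrite ge0_integralD//; last 3 first.
- exact/measurable_EFinP.
- by move=> s _; rewrite sume_ge0// => j _; rewrite lee_fin.
- by apply: emeasurable_sum => j; exact/measurable_EFinP.
rewrite EFinD; apply: leeD; first exact: hits_le.
rewrite ge0_integral_sum//; last 2 first.
- by move=> j; exact/measurable_EFinP.
- by move=> j s _; rewrite lee_fin.
apply: (@le_trans _ _ (\sum_(j < n.+1) ((kap ^+ k)%:E *
   \int[tuple_measure P n.+1]_s ((nn_rank nrm s x j == k)%:R : R)%:E))).
  apply: lee_sum => j _; apply: (integral_nearest_weight_le nrm_norm) => //.
  - by move=> z; exact: expR_ge0.
  - exact: ltW.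
rewrite -ge0_sume_distrr; last by move=> j _; apply: integral_ge0 => s _; rewrite lee_fin.
rewrite -ge0_integral_sum//; last by move=> j; exact/measurable_EFinP.
apply: (@le_trans _ _ ((kap ^+ k)%:E * 1)).
  apply: lee_wpmul2l; first by rewrite lee_fin exprn_ge0// ltW.
  rewrite -(integral_tuple_cst P n.+1 1); apply: ge0_le_integral => //.
  - by move=> s _; rewrite sume_ge0// => j _; rewrite lee_fin.
  - by apply: emeasurable_sum => j; exact/measurable_EFinP.
  move=> s _; rewrite sumEFin lee_fin -natr_sum lern1.
  have [[j jk]|nj] := pselect (exists j, nn_rank nrm s x j = k).
    rewrite (bigD1 j)//= jk eqxx big1// => i ij; apply/eqP; rewrite eqb0.
    by apply: contra ij => /eqP ik; apply/eqP/(@nn_rank_inj _ _ nrm _ s x); rewrite ik.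
  rewrite big1// => i _; apply/eqP; rewrite eqb0; apply/eqP => ik.
  by apply: nj; exists i.
rewrite mule1 lee_fin.
(* What is used is [kap ^ 2 = 1 - D ^ 2 <= exp (- D ^ 2)]. *)
have -> : (- (k%:R * D ^+ 2 / 2) = k%:R * (- (D ^+ 2 / 2)))%R by ring.
rewrite expRM_natl; apply: lerXn2r; rewrite ?nnegrE ?expR_ge0 ?(ltW kap_gt0)//.
rewrite -(@ler_pXn2r _ 2)// ?nnegrE ?expR_ge0 ?(ltW kap_gt0)//.
rewrite kap2 -expRM_natl; apply: le_trans (expR_ge1Dx _).
suff -> : (2 * - (D ^+ 2 / 2) = - D ^+ 2)%R by lra.
by field.
Qed.

End error_at_point.

(** * Error probability under the smoothness and minimal mass conditions *)

Section error_in_class.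
Context (R : realType) (d : nat) (d_gt0 : (0 < d)%N) (nrm : 'rV[R]_d -> R).
Hypothesis nrm_norm : is_norm nrm.
Variables (M : model R d) (Cc Cd D0 : R).
Local Notation Z := ('rV[R]_d * R)%type.
Local Notation P := (law M).
Hypothesis Cd_gt0 : 0 < Cd.
Hypothesis D0_gt0 : 0 < D0.
Hypothesis smooth : smooth_cond nrm Cc M.
Hypothesis minmass : forall x r, 0 < r < D0 ->
  ((Cd * dens M x)%:E * lebesgue_rV (ball_ nrm x r) <= massB nrm M x r)%E.

(** When [r0 ^ d = knn_scale * u / f], the minimal mass condition and [lebesgue_ball_ge] give the
    ball of radius [r0] a mass of at least [4 * u]. *)
Definition knn_scale : R := 4 * nrm_coef nrm ^+ d / Cd.

(** Densities above [low_density * u] are those for which this [r0] lies below [D0], the range of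
    the minimal mass condition. *)
Definition low_density : R := knn_scale / D0 ^+ d.

(** Turns [|Cc| * r0 ^ 2] into a multiple of the power [2 / d] of [u / f]; the absolute value allows
    for a negative [Cc]. *)
Definition bias_coef : R := `|Cc| * knn_scale `^ (2 / d%:R).

Lemma knn_scale_gt0 : 0 < knn_scale.
Proof. by rewrite divr_gt0// mulr_gt0// exprn_gt0// nrm_coef_gt0. Qed.

Lemma low_density_gt0 : 0 < low_density.
Proof. by rewrite divr_gt0 ?knn_scale_gt0// exprn_gt0. Qed.

Lemma bias_coef_ge0 : 0 <= bias_coef.
Proof. by rewrite mulr_ge0// powR_ge0. Qed.

(** Within [r0] the bias is at most half of the absolute value of [reg M x], so [knn_error_prob_le]
    applies with [D] equal to that half. *)
Lemma knn_error_in_class (x : 'rV[R]_d) (n k : nat) (u := k%:R / n.+1%:R : R) :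
  (0 < k <= n)%N -> low_density * u < dens M x -> `|reg M x| <= 1 ->
  2 * (bias_coef * (u / dens M x) `^ (2 / d%:R)) <= `|reg M x| ->
  reg M x != 0 ->
  (tuple_measure P n.+1
     [set s | knn_classifier nrm k s x != label_sign (reg M x)] <=
   (expR (- k%:R) + expR (- (k%:R * reg M x ^+ 2 / 8)))%:E)%E.
Proof.
move=> /andP[k0 kn] fx eta1 beta eta0.
have k0' : 0 < k%:R :> R by rewrite ltr0n.
have u0 : 0 < u by rewrite divr_gt0.
have f0 : 0 < dens M x.
  by apply: le_lt_trans fx; rewrite mulr_ge0// ltW// low_density_gt0.
have L0 := nrm_coef_gt0 nrm_norm.
have A0 := knn_scale_gt0.
have d0 : d%:R != 0 :> R by rewrite pnatr_eq0 -lt0n.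
pose y := knn_scale * (u / dens M x).
have y0 : 0 < y by rewrite mulr_gt0// divr_gt0.
pose r0 := y `^ (d%:R^-1).
have r00 : 0 < r0 by rewrite powR_gt0.
have r0d : r0 ^+ d = y by rewrite -powR_mulrn ?powR_ge0// -powRrM mulVf// powRr1 ?ltW.
have r0D : r0 < D0.
  rewrite -(@ltr_pXn2r _ d)// ?nnegrE ?ltW// r0d /y mulrA ltr_pdivrMr//.
  by move: fx; rewrite /low_density mulrAC ltr_pdivrMr ?exprn_gt0// [ltRHS]mulrC.
have r02 : r0 ^+ 2 = y `^ (2 / d%:R).
  by rewrite -powR_mulrn ?powR_ge0// -powRrM mulrC.
have massB_gt0 r : 0 < r < D0 -> (0 < massB nrm M x r)%E.
  move=> rD; apply: lt_le_trans (minmass x rD).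
  case/andP: rD => r_gt0 _; rewrite mule_gt0// ?lte_fin ?mulr_gt0//.
  by apply: lt_le_trans (lebesgue_ball_ge nrm_norm x r_gt0); rewrite lte_fin exprn_gt0// divr_gt0.
have mB r : measurable (ball_ nrm x r `*` [set: R]).
  by apply: measurable_cylinder; exact: measurable_ball_nrm.
have mass_fin r : massB nrm M x r \is a fin_num by exact: fin_num_measure.
pose sg := label_sign (reg M x).
have sg1 : sg = 1 \/ sg = -1 by rewrite /sg /label_sign; case: ifP => _; [left|right].
have sgeta : sg * reg M x = `|reg M x|.
  rewrite /sg /label_sign; case: ifPn => [h|]; first by rewrite mul1r ger0_norm.
  by rewrite -ltNge => h; rewrite mulN1r ltr0_norm.
have D01 : 0 < `|reg M x| / 2 < 1.
  by rewrite divr_gt0 ?normr_gt0//= ltr_pdivrMr// mul1r; lra.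
have supp : closure [set y | dens M y != 0] x.
  by apply: subset_closure => /=; rewrite gt_eqF.
have bias r : 0 < r < r0 -> ((`|reg M x| / 2)%:E * P (ball_ nrm x r `*` setT) <=
    \int[P]_(z in ball_ nrm x r `*` setT) (sg * z.2)%:E)%E.
  move=> /andP[r_gt0 rr0].
  have rD : 0 < r < D0 by rewrite r_gt0 (lt_trans rr0).
  have Bgt0 := massB_gt0 r rD.
  have := @smooth r x r_gt0 supp; rewrite /regB => hs.
  under eq_integral do rewrite EFinM.
  have il := integrable_label M (mB r).
  rewrite integralZl//.
  have Ifin := integrable_fin_num (mB r) il.
  rewrite -(fineK (mass_fin r)) in Bgt0.
  rewrite -[X in (_ * X <= _)%E](fineK (mass_fin r)) -(fineK Ifin) -!EFinM lee_fin.
  move: hs; rewrite lte_fin in Bgt0.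
  set I := fine (\int[_]_(_ in _) _)%E; set m := fine _ => hs.
  have hb : Cc * r ^+ 2 <= `|reg M x| / 2.
    apply: (@le_trans _ _ (`|Cc| * r0 ^+ 2)).
      apply: (@le_trans _ _ (`|Cc| * r ^+ 2)).
        by apply: ler_wpM2r; [exact/exprn_ge0/ltW|exact: ler_norm].
      by apply: ler_wpM2l => //; rewrite lerXn2r// ?nnegrE ltW.
    have yE : y `^ (2 / d%:R) =
        knn_scale `^ (2 / d%:R) * (u / dens M x) `^ (2 / d%:R).
      by rewrite /y powRM// ltW// divr_gt0.
    by move: beta; rewrite /bias_coef r02 yE -mulrA; lra.
  have Im : I = (I / m) * m by rewrite divfK// gt_eqF.
  rewrite Im mulrA; apply: ler_wpM2r; first exact: ltW.
  have {}hs := le_trans hs hb.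
  (* Multiplying by the sign turns closeness of the local mean to [reg M x] into a lower bound for
     the mean of [sg * Y]. *)
  have hsg : `|sg * (I / m) - sg * reg M x| <= `|reg M x| / 2.
    rewrite -mulrBr normrM (_ : `|sg| = 1) ?mul1r//.
    by case: sg1 => ->; rewrite ?normrN normr1.
  by move: hsg; rewrite sgeta ler_norml => /andP[+ _]; lra.
apply: le_trans (knn_error_prob_le nrm_norm k0 kn D01 bias) _.
rewrite lee_fin; apply: lerD; rewrite ler_expR; last first.
  by rewrite expr_div_n real_normK ?num_real//; lra.
have pmass : 4 * u <= fine (P (ball_ nrm x r0 `*` setT)).
  have r0D' : 0 < r0 < D0 by rewrite r00.
  rewrite -lee_fin (fineK (mass_fin r0)).
  apply: le_trans (minmass x r0D').
  apply: (@le_trans _ _ ((Cd * dens M x)%:E * ((r0 / nrm_coef nrm) ^+ d)%:E)%E); last first.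
    apply: lee_wpmul2l; first by rewrite lee_fin mulr_ge0// ltW.
    exact: lebesgue_ball_ge.
  rewrite -EFinM lee_fin expr_div_n r0d /y /knn_scale le_eqVlt; apply/orP; left.
  by apply/eqP; field; apply/and3P; split; rewrite gt_eqF// exprn_gt0.
have : n.+1%:R * (4 * u) / 2 <= n.+1%:R * fine (P (ball_ nrm x r0 `*` setT)) / 2.
  by rewrite ler_pM2r// ler_pM2l.
rewrite (_ : n.+1%:R * (4 * u) / 2 = 2 * k%:R); first by lra.
rewrite /u mulrCA [_ * (_ / _)]mulrC divfK ?pnatr_eq0//.
by lra.
Qed.

End error_in_class.

(** * Integration under the margin and tail conditions *)

Section shells.
Context disp (T : measurableType disp) (R : realType) (P : probability T R).

Lemma sum_expr_le_lt1 (r : R) J : 0 <= r < 1 -> \sum_(j < J) r ^+ j <= (1 - r)^-1.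
Proof.
move=> /andP[r0 r1]; rewrite -[leRHS]mul1r ler_pdivlMr ?subr_gt0// mulrC.
have -> : (1 - r) * \sum_(j < J) r ^+ j = 1 - r ^+ J.
  by rewrite -[RHS]opprB subrX1 -mulNr opprB.
by rewrite gerBl exprn_ge0.
Qed.

Lemma sum_expr_le_gt1 (r : R) J : 1 < r -> \sum_(j < J) r ^+ j <= r ^+ J / (r - 1).
Proof.
move=> r1; rewrite ler_pdivlMr ?subr_gt0// mulrC -subrX1.
by rewrite gerBl.
Qed.

Variables (U : T -> R) (C a : R).
Hypothesis mU : measurable_fun setT U.
Hypothesis tail : forall t, 0 < t -> (P [set z | 0 < U z <= t]%R <= (C * t `^ a)%:E)%E.

Lemma tail_coef_ge0 : 0 <= C.
Proof.
have h := tail ltr01; rewrite powR1 mulr1 in h.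
by rewrite -lee_fin; apply: le_trans h; exact: measure_ge0.
Qed.

(** On each dyadic shell the negative power is bounded by its value at the lower end and the mass by
    the tail at the upper end, whence the factor 2 to the power [a]. The sum stays finite because
    its ratio may exceed 1. *)
Lemma shell_integral_le (q s : R) (J : nat) : 0 <= q -> 0 < s ->
  (\int[P]_z ((s < U z <= s * 2 ^+ J)%R%:R * U z `^ (- q))%:E <=
   (C * 2 `^ a * s `^ (a - q) * \sum_(j < J) (2 `^ (a - q)) ^+ j)%:E)%E.
Proof.
move=> q0 s0.
have s2 (j : nat) : 0 < s * 2 ^+ j by rewrite mulr_gt0// exprn_gt0.
have mb t : measurable_fun setT (fun z => (0 < U z <= t)%R).
  by apply: measurable_and; [exact: measurable_fun_ltr|exact: measurable_fun_ler].
have shell z J' : (s < U z <= s * 2 ^+ J')%R%:R * U z `^ (- q) <=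
    \sum_(j < J') (s * 2 ^+ j) `^ (- q) * (0 < U z <= s * 2 ^+ j.+1)%R%:R.
  elim: J' => [|J' IH].
    by rewrite big_ord0 expr0 mulr1; case: ltP => //= ?; case: leP; rewrite ?mul0r//; lra.
  rewrite big_ord_recr/=.
  have S0 : 0 <= \sum_(j < J') (s * 2 ^+ j) `^ (- q) * (0 < U z <= s * 2 ^+ j.+1)%R%:R.
    by apply: sumr_ge0 => j _; rewrite mulr_ge0// powR_ge0.
  have [/andP[sU US]|_] := boolP (s < U z <= s * 2 ^+ J'.+1); last first.
    by rewrite mul0r addr_ge0// mulr_ge0// powR_ge0.
  have U0 : 0 < U z by exact: lt_trans sU.
  rewrite mul1r (_ : (0 < U z <= s * 2 ^+ J'.+1) = true) ?mulr1; last first.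
    by rewrite U0.
  have [h|h] := leP (U z) (s * 2 ^+ J').
    move: IH; rewrite sU h/= mul1r => IH; apply: le_trans IH _.
    by rewrite lerDl powR_ge0.
  rewrite -[leLHS]add0r lerD// !powRN lef_pV2 ?posrE ?powR_gt0//.
  by rewrite ge0_ler_powR// ?nnegrE ltW.
apply: (@le_trans _ _ (\int[P]_z (\sum_(j < J) ((s * 2 ^+ j) `^ (- q))%:E *
    (0 < U z <= s * 2 ^+ j.+1)%R%:R%:E)%E)%E).
  apply: ge0_le_integral => //.
  - by move=> z _; rewrite lee_fin mulr_ge0// powR_ge0.
  - apply/measurable_EFinP/measurable_funM; last first.
      exact: (measurableT_comp (@measurable_powR R (- q)) mU).
    by apply: measurable_boolR; apply: measurable_and;
      [exact: measurable_fun_ltr|exact: measurable_fun_ler].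
  - apply: emeasurable_sum => j; apply: emeasurable_funM => //.
    by apply/measurable_EFinP; exact: measurable_boolR.
  - move=> z _; under eq_bigr do rewrite -EFinM.
    by rewrite sumEFin lee_fin; exact: shell.
rewrite ge0_integral_sum//; last 2 first.
- move=> j; apply: emeasurable_funM => //.
  by apply/measurable_EFinP; exact: measurable_boolR.
- by move=> j z _; rewrite -EFinM lee_fin mulr_ge0// powR_ge0.
rewrite mulr_sumr -sumEFin; apply: lee_sum => j _.
rewrite ge0_integralZl//; last 2 first.
- by apply/measurable_EFinP; exact: measurable_boolR.
- by rewrite lee_fin powR_ge0.
rewrite integral_boolR//.
apply: (@le_trans _ _ (((s * 2 ^+ j) `^ (- q))%:E * (C * (s * 2 ^+ j.+1) `^ a)%:E)%E).
  by apply: lee_wpmul2l; [rewrite lee_fin powR_ge0|exact: tail].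
rewrite -EFinM lee_fin le_eqVlt; apply/orP; left; apply/eqP.
have -> : (s * 2 ^+ j.+1) `^ a = (s * 2 ^+ j) `^ a * 2 `^ a.
  by rewrite exprSr mulrA powRM// ltW.
have -> : (2 `^ (a - q)) ^+ j = (2 ^+ j) `^ (a - q) :> R.
  rewrite -(@powR_mulrn _ 2 j)// -powRrM mulrC powRrM.
  by rewrite powR_mulrn// powR_ge0.
have E : (s * 2 ^+ j) `^ (- q) * (s * 2 ^+ j) `^ a = s `^ (a - q) * (2 ^+ j) `^ (a - q).
  rewrite -powRM ?exprn_ge0// ?ltW// addrC powRD//.
  by apply/implyP => _; rewrite gt_eqF.
rewrite -[RHS]mulrA -E; ring.
Qed.

End shells.

Section margin_integral.
Context (R : realType).

(** The power [m] of the inequality [exp (y / m) >= y / m], inverted. *)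
Lemma expRN_le_powR (m : nat) (y : R) : (0 < m)%N -> 0 < y ->
  expR (- y) <= (m%:R / y) ^+ m.
Proof.
move=> m0 y0; have m0' : 0 < m%:R :> R by rewrite ltr0n.
rewrite expRN -[leRHS]invrK lef_pV2 ?posrE ?expR_gt0 ?invr_gt0 ?exprn_gt0 ?divr_gt0//.
have -> : expR y = expR (y / m%:R) ^+ m.
  by rewrite -expRM_natl mulrC divfK// gt_eqF.
have y0' := ltW y0.
rewrite -exprVn invf_div lerXn2r ?nnegrE ?expR_ge0 ?divr_ge0//.
by apply: le_trans (expR_ge1Dx _); rewrite lerDr.
Qed.

(** Split at [s], the inverse square root of [k]. Below it, [U] is at most [s] on an event whose
    mass the tail bounds; above it, the exponential is traded for a high negative power and the
    shells form a convergent series. [K] is chosen before [P], [U] and [k]. *)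
Lemma margin_integral_le (C a : R) : 0 < a -> exists K : R,
  forall disp (T : measurableType disp) (P : probability T R) (U : T -> R) (k : nat),
  measurable_fun setT U -> (forall z, 0 <= U z) ->
  (forall t, 0 < t -> (P [set z | 0 < U z <= t]%R <= (C * t `^ a)%:E)%E) ->
  (0 < k)%N ->
  (\int[P]_z ((U z <= 1)%R%:R * (U z * expR (- (k%:R * U z ^+ 2 / 8))))%:E <=
   (K * k%:R `^ (- ((1 + a) / 2)))%:E)%E.
Proof.
(* The exponent left from [U * (1 / U ^ 2) ^ m] is [- q] with [q = 2 * m - 1]; taking [m > 1 + a]
   makes [q] exceed [a], so the ratio [r] is below 1. *)
move=> a0; pose m := (Num.truncn (1 + a)).+1.
have m_gt : 1 + a < m%:R by exact: truncnS_gt.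
pose q : R := (2 * m).-1%:R.
have qE : q = 2 * m%:R - 1 by rewrite /q -subn1 natrB// natrM.
have m1 : 1 <= m%:R :> R by rewrite ler1n.
have q0 : 0 <= q by rewrite qE; lra.
have aq : a - q < 0 by rewrite qE; lra.
pose r : R := 2 `^ (a - q).
have r01 : 0 <= r < 1.
  rewrite powR_ge0/= /r -opprB powRN invf_lt1 ?powR_gt0//.
  have : (1 : R) `^ (q - a) < 2 `^ (q - a).
    by apply: gt0_ltr_powR; rewrite ?nnegrE ?ltr1n//; lra.
  by rewrite powR1.
pose B : R := (m%:R * 8) ^+ m.
exists (C + B * (C * 2 `^ a * (1 - r)^-1)) => disp T P U k mU U0 tail k0.
have k0' : 0 < k%:R :> R by rewrite ltr0n.
pose s : R := k%:R `^ (- 2^-1).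
have s0 : 0 < s by rewrite powR_gt0.
have s0' := ltW s0.
have s2 : s ^+ 2 = k%:R^-1.
  by rewrite -powR_mulrn// -powRrM mulNr mulVf// powR_inv1.
(* [k] shells reach up to 1, since [s >= s ^ 2 = 1 / k] and [2 ^ k >= k]. *)
have s1 : 1 <= s * 2 ^+ k.
  have s_le1 : s <= 1.
    rewrite -(@ler_pXn2r _ 2)// ?nnegrE// s2 expr1n invf_le1//.
    by rewrite ler1n.
  apply: (@le_trans _ _ (s ^+ 2 * k%:R)); first by rewrite s2 mulVf ?gt_eqF.
  apply: ler_pM => //; first exact: exprn_ge0 (ltW s0).
    by rewrite expr2 ler_piMl// ltW.
  by rewrite -natrX ler_nat ltnW// ltn_expl.
have mb t t' : measurable_fun setT (fun z => (t < U z <= t')%R).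
  by apply: measurable_and; [exact: measurable_fun_ltr|exact: measurable_fun_ler].
have mshell : measurable_fun setT
    (fun z => (s < U z <= s * 2 ^+ k)%R%:R * U z `^ (- q)).
  apply: measurable_funM; first exact: measurable_boolR.
  exact: (measurableT_comp (@measurable_powR R (- q)) mU).
have mexp : measurable_fun setT (fun z => U z * expR (- (k%:R * U z ^+ 2 / 8))).
  apply: measurable_funM => //; apply: measurableT_comp => //.
  apply: measurable_funN; apply: measurable_funM => //; apply: measurable_funM => //.
  exact: measurable_funX.
have ptw z : (U z <= 1)%R%:R * (U z * expR (- (k%:R * U z ^+ 2 / 8))) <=
    s * (0 < U z <= s)%R%:R + B * s ^+ (2 * m) *
      ((s < U z <= s * 2 ^+ k)%R%:R * U z `^ (- q)).
  have R0 : 0 <= B * s ^+ (2 * m) * ((s < U z <= s * 2 ^+ k)%R%:R * U z `^ (- q)).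
    by rewrite !mulr_ge0 ?powR_ge0 ?exprn_ge0 ?mulr_ge0.
  have L0 : 0 <= s * (0 < U z <= s)%R%:R by rewrite mulr_ge0.
  case: (leP (U z) 1) => U1; last by rewrite mul0r addr_ge0.
  rewrite mul1r; have [Uz|Uz] := eqVneq (U z) 0; first by rewrite [X in X * _]Uz mul0r addr_ge0.
  have Upos : 0 < U z by rewrite lt_neqAle eq_sym Uz U0.
  have [Us|sU] := leP (U z) s.
    rewrite Upos/= mulr1 mul0r mulr0 addr0; apply: le_trans Us.
    rewrite -[leRHS]mulr1; apply: ler_wpM2l => //.
    by rewrite expR_le1 oppr_le0 !mulr_ge0 ?exprn_ge0.
  rewrite Upos/= mulr0 add0r (le_trans U1 s1)/= mul1r.
  have y0 : 0 < k%:R * U z ^+ 2 / 8 by rewrite !mulr_gt0 ?exprn_gt0.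
  apply: (@le_trans _ _ (U z * (m%:R / (k%:R * U z ^+ 2 / 8)) ^+ m)).
    by rewrite ler_wpM2l// expRN_le_powR.
  rewrite le_eqVlt; apply/orP; left; apply/eqP.
  have -> : m%:R / (k%:R * U z ^+ 2 / 8) = m%:R * 8 * s ^+ 2 / U z ^+ 2.
    by rewrite s2; field; rewrite Uz gt_eqF.
  have -> : (m%:R * 8 * s ^+ 2 / U z ^+ 2) ^+ m =
      B * s ^+ (2 * m) / U z ^+ (2 * m).
    by rewrite /B !exprM !exprMn exprVn [in LHS]expr2 exprMn.
  have -> : U z ^+ (2 * m) = U z * U z ^+ (2 * m).-1 by rewrite -exprS.
  by rewrite powRN powR_mulrn// invfM mulrCA mulVKf.
apply: (@le_trans _ _ (\int[P]_z ((s * (0 < U z <= s)%R%:R)%:E +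
    (B * s ^+ (2 * m))%:E * ((s < U z <= s * 2 ^+ k)%R%:R * U z `^ (- q))%:E)%E)%E).
  apply: ge0_le_integral => //.
  - by move=> z _; rewrite lee_fin !mulr_ge0// expR_ge0.
  - apply/measurable_EFinP/measurable_funM => //.
    by apply: measurable_boolR; exact: measurable_fun_ler.
  - apply: emeasurable_funD.
      by apply/measurable_EFinP/measurable_funM => //; exact: measurable_boolR.
    by apply: emeasurable_funM => //; exact/measurable_EFinP.
  - by move=> z _; rewrite -EFinM -EFinD lee_fin; exact: ptw.
have B0 : 0 <= B * s ^+ (2 * m) by rewrite mulr_ge0 ?exprn_ge0 ?mulr_ge0.
rewrite ge0_integralD//; last 4 first.
- by move=> z _; rewrite lee_fin mulr_ge0.
- by apply/measurable_EFinP/measurable_funM => //; exact: measurable_boolR.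
- by move=> z _; rewrite -EFinM lee_fin mulr_ge0// mulr_ge0// powR_ge0.
- by apply: emeasurable_funM => //; exact/measurable_EFinP.
under eq_integral do rewrite EFinM.
rewrite ge0_integralZl//; last first.
  by apply/measurable_EFinP; exact: measurable_boolR.
rewrite ge0_integralZl//; last 2 first.
- exact/measurable_EFinP.
- by move=> z _; rewrite lee_fin mulr_ge0// powR_ge0.
rewrite integral_boolR//.
have C0 := tail_coef_ge0 tail.
apply: (@le_trans _ _ (s%:E * (C * s `^ a)%:E + (B * s ^+ (2 * m))%:E *
    (C * 2 `^ a * s `^ (a - q) * \sum_(j < k) r ^+ j)%:E)%E).
  apply: leeD; apply: lee_wpmul2l; rewrite ?lee_fin ?(ltW s0)//.
    exact: tail.
  exact: shell_integral_le.
rewrite -!EFinM -EFinD lee_fin.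
have -> : k%:R `^ (- ((1 + a) / 2)) = s `^ (1 + a).
  by rewrite -powRrM; congr (_ `^ _); field.
have E1 : s * (C * s `^ a) = C * s `^ (1 + a).
  have -> : s `^ (1 + a) = s * s `^ a.
    rewrite powRD; first by rewrite powRr1.
    by rewrite (gt_eqF s0) implybT.
  by ring.
have E2 : s ^+ (2 * m) * s `^ (a - q) = s `^ (1 + a).
  rewrite -powR_mulrn// -powRD; last by rewrite (gt_eqF s0) implybT.
  by congr (_ `^ _); rewrite qE natrM; ring.
rewrite E1 mulrDl lerD2l.
have -> : B * s ^+ (2 * m) * (C * 2 `^ a * s `^ (a - q) * \sum_(j < k) r ^+ j) =
    B * (C * 2 `^ a * \sum_(j < k) r ^+ j) * s `^ (1 + a).
  by rewrite -E2; ring.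
rewrite ler_wpM2r ?powR_ge0// ler_wpM2l// ?exprn_ge0// ler_wpM2l ?mulr_ge0 ?powR_ge0//.
exact: sum_expr_le_lt1.
Qed.

End margin_integral.

Lemma powR_div (R : realType) (x y a : R) :
  0 <= x -> 0 <= y -> (x / y) `^ a = x `^ a * y `^ (- a).
Proof.
move=> x0 y0; rewrite powRM ?invr_ge0//.
by rewrite -(powR_inv1 y0) -powRrM mulN1r.
Qed.

(** * Excess risk of one model in terms of [k], the sample size and the number of shells *)

Section excess_in_class.
Context (R : realType) (d : nat) (d_gt0 : (0 < d)%N) (nrm : 'rV[R]_d -> R).
Hypothesis nrm_norm : is_norm nrm.
Variables (alpha beta : R).
Hypothesis alpha_gt0 : 0 < alpha.
Variables (M : model R d) (Ca Cb Cc Cd D0 : R).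
Local Notation Z := ('rV[R]_d * R)%type.
Local Notation P := (law M).
Hypothesis Cd_gt0 : 0 < Cd.
Hypothesis D0_gt0 : 0 < D0.
Hypothesis margin : margin_cond Ca alpha M.
Hypothesis dtail : tail_cond Cb beta M.
Hypothesis smooth : smooth_cond nrm Cc M.
Hypothesis minmass : forall x r, 0 < r < D0 ->
  ((Cd * dens M x)%:E * lebesgue_rV (ball_ nrm x r) <= massB nrm M x r)%E.

Let gam : R := 2 / d%:R.
Let A0 := low_density nrm Cd D0.
Let A1 := bias_coef nrm Cc Cd.
Let U (z : Z) : R := `|reg M z.1|.
Let f (z : Z) : R := dens M z.1.

Let mU : measurable_fun setT U.
Proof. by apply: measurableT_comp => //; exact: measurable_reg1. Qed.

Let mf : measurable_fun setT f.
Proof. exact: (measurableT_comp (measurable_dens M)). Qed.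

Let U0 z : 0 <= U z. Proof. exact: normr_ge0. Qed.

Let gam_gt0 : 0 < gam.
Proof. by rewrite divr_gt0// ltr0n. Qed.

Let A0_gt0 : 0 < A0. Proof. exact: low_density_gt0. Qed.

Let A1_ge0 : 0 <= A1. Proof. exact: bias_coef_ge0. Qed.

Let ftail t : 0 < t -> (P [set z | 0 < f z <= t]%R <= (Cb * t `^ beta)%:E)%E.
Proof.
move=> t0; apply: le_trans (dtail t0); apply: le_measure; rewrite ?inE.
- apply: measurable_set_bool; apply: measurable_and; first exact: measurable_fun_ltr.
  exact: measurable_fun_ler.
- by apply: measurable_set_bool; exact: measurable_fun_ler.
- by move=> z /andP[].
Qed.

Let Ca_ge0 : 0 <= Ca. Proof. exact: (tail_coef_ge0 margin). Qed.

Let Cb_ge0 : 0 <= Cb. Proof. exact: (tail_coef_ge0 ftail). Qed.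

(** Points of sufficient density whose margin may be consumed by the bias, so that
    [knn_error_in_class] does not apply. Among them are points with [U z = 0], harmless because the
    weight is [U z]. *)
Let biased (u : R) (z : Z) : bool :=
  (U z <= 1) && ((A0 * u < f z) && (U z <= 2 * (A1 * (u / f z) `^ gam))).

Let mbiased u : 0 <= u -> measurable_fun setT (biased u).
Proof.
move=> u0; apply: measurable_and; first exact: measurable_fun_ler.
apply: measurable_and; first exact: measurable_fun_ltr.
apply: measurable_fun_ler => //; do 2 apply: measurable_funM => //.
rewrite (_ : (fun z => _) = (fun z => u `^ gam * f z `^ (- gam))).
  apply: measurable_funM => //.
  exact: (measurableT_comp (@measurable_powR R (- gam)) mf).
by apply/funext => z; rewrite powR_div// /f dens_ge0.
Qed.

(* Dyadic shells of the density up to [A0 * u * 2 ^ J]; above that level a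
   biased point has [U z <= tau], and the margin condition applies. *)
Let bias_integral_le (u : R) (J : nat) (tau := 2 * A1 * A0 `^ (- gam) * (2 ^+ J) `^ (- gam)) :
  0 < u ->
  (\int[P]_z ((biased u z)%:R * U z)%:E <=
   (2 * A1 * (Cb * 2 `^ beta * A0 `^ (beta - gam)) *
      (u `^ beta * \sum_(j < J) (2 `^ (beta - gam)) ^+ j) +
    Ca * tau `^ (1 + alpha))%:E)%E.
Proof.
move=> u0; have u0' := ltW u0; pose s := A0 * u.
have s0 : 0 < s by rewrite mulr_gt0.
have s0' := ltW s0; have A00 := ltW A0_gt0; have g0 := ltW gam_gt0.
pose T := s * 2 ^+ J.
have T0 : 0 < T by rewrite mulr_gt0// exprn_gt0.
(* [u] cancels against [s = A0 * u], so the threshold [tau] varies with [J] alone. *)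
have us : u `^ gam * s `^ (- gam) = A0 `^ (- gam).
  rewrite /s powRM// mulrCA -powRD ?subrr ?powRr0 ?mulr1//.
  by rewrite (gt_eqF u0) implybT.
have tauE : tau = 2 * A1 * (u `^ gam * T `^ (- gam)).
  by rewrite /tau /T powRM// ?exprn_ge0// -us; ring.
have tau0 : 0 <= tau by rewrite tauE !mulr_ge0 ?powR_ge0.
have mb t t' : measurable_fun setT (fun z => (t < f z <= t')%R).
  by apply: measurable_and; [exact: measurable_fun_ltr|exact: measurable_fun_ler].
have mbU : measurable_fun setT (fun z => (0 < U z <= tau)%R).
  by apply: measurable_and; [exact: measurable_fun_ltr|exact: measurable_fun_ler].
have mshell : measurable_fun setT (fun z => (s < f z <= T)%R%:R * f z `^ (- gam)).
  apply: measurable_funM; first exact: measurable_boolR.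
  exact: (measurableT_comp (@measurable_powR R (- gam)) mf).
have c0 : 0 <= 2 * A1 * u `^ gam by rewrite !mulr_ge0// powR_ge0.
have ptw z : (biased u z)%:R * U z <=
    2 * A1 * u `^ gam * ((s < f z <= T)%R%:R * f z `^ (- gam)) +
    tau * (0 < U z <= tau)%R%:R.
  have X0 : 0 <= 2 * A1 * u `^ gam * ((s < f z <= T)%R%:R * f z `^ (- gam)).
    by rewrite mulr_ge0// mulr_ge0// powR_ge0.
  have Y0 : 0 <= tau * (0 < U z <= tau)%R%:R by rewrite mulr_ge0.
  have [/and3P[U1 sf]|_] := boolP (biased u z); last by rewrite mul0r addr_ge0.
  rewrite powR_div// ?dens_ge0// mul1r => Ub.
  have [fT|fT] := leP (f z) T.
    rewrite [s < _]sf mul1r; apply: (@le_trans _ _ (2 * A1 * u `^ gam * f z `^ (- gam))).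
      by apply: le_trans Ub _; rewrite !mulrA.
    by rewrite lerDl.
  rewrite andbF mul0r mulr0 add0r.
  have Ut : U z <= tau.
    apply: le_trans Ub _; rewrite tauE -mulrA ler_wpM2l// ler_wpM2l// ler_wpM2l ?powR_ge0//.
    rewrite !powRN lef_pV2 ?posrE ?powR_gt0//; last exact: lt_trans fT.
    by rewrite ge0_ler_powR// ?nnegrE ltW//; exact: lt_trans fT.
  have [Uz|Uz] := eqVneq (U z) 0; first by rewrite (le_trans _ Y0)// Uz.
  by rewrite Ut lt_neqAle eq_sym Uz U0/= mulr1.
apply: (@le_trans _ _ (\int[P]_z ((2 * A1 * u `^ gam)%:E *
    ((s < f z <= T)%R%:R * f z `^ (- gam))%:E +
    tau%:E * (0 < U z <= tau)%R%:R%:E))%E).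
  apply: ge0_le_integral => //.
  - by move=> z _; rewrite lee_fin mulr_ge0.
  - apply/measurable_EFinP/measurable_funM => //.
    by apply: measurable_boolR; exact: mbiased.
  - apply: emeasurable_funD; apply: emeasurable_funM => //; apply/measurable_EFinP => //.
    exact: measurable_boolR.
  - by move=> z _; rewrite -!EFinM -EFinD lee_fin.
rewrite ge0_integralD//; last 4 first.
- by move=> z _; rewrite -EFinM lee_fin mulr_ge0// mulr_ge0// powR_ge0.
- by apply: emeasurable_funM => //; exact/measurable_EFinP.
- by move=> z _; rewrite -EFinM lee_fin mulr_ge0.
- by apply: emeasurable_funM => //; apply/measurable_EFinP; exact: measurable_boolR.
rewrite ge0_integralZl//; last 2 first.
- exact/measurable_EFinP.
- by move=> z _; rewrite lee_fin mulr_ge0// powR_ge0.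
rewrite ge0_integralZl//; last by apply/measurable_EFinP; exact: measurable_boolR.
rewrite integral_boolR// EFinD; apply: leeD.
  apply: (@le_trans _ _ ((2 * A1 * u `^ gam)%:E *
     (Cb * 2 `^ beta * s `^ (beta - gam) * \sum_(j < J) (2 `^ (beta - gam)) ^+ j)%:E)%E).
    apply: lee_wpmul2l; first by rewrite lee_fin.
    exact: shell_integral_le.
  rewrite -EFinM lee_fin.
  have -> : s `^ (beta - gam) = A0 `^ (beta - gam) * u `^ (beta - gam).
    by rewrite /s powRM.
  have -> : u `^ beta = u `^ gam * u `^ (beta - gam).
    rewrite -powRD; first by congr (_ `^ _); ring.
    by rewrite (gt_eqF u0) implybT.
  by rewrite le_eqVlt; apply/orP; left; apply/eqP; ring.
(* [tau] vanishes when [Cc = 0], and the margin condition speaks of positive [t] only. *)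
have [->|tn0] := eqVneq tau 0.
  by rewrite mul0e lee_fin mulr_ge0// powR_ge0.
have tpos : 0 < tau by rewrite lt_neqAle eq_sym tn0.
have := margin tpos; move=> /(lee_wpmul2l (x := tau%:E)) h.
apply: le_trans (h _) _; first by rewrite lee_fin.
rewrite -EFinM lee_fin le_eqVlt; apply/orP; left; apply/eqP.
rewrite powRD; first by rewrite powRr1//; ring.
by rewrite (gt_eqF tpos) implybT.
Qed.

(** Almost every point falls into one of three cases: low density, where the loss is at most 1 and
    the tail condition bounds the mass; [biased], left to the hypothesis with [B]; and the rest,
    where [knn_error_in_class] bounds the error probability. *)
Lemma excess_le_bias (K : R) (n k : nat) (u := k%:R / n.+1%:R : R) (B : R) :
  (forall disp (T : measurableType disp) (Q : probability T R) (V : T -> R) (j : nat),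
    measurable_fun setT V -> (forall z, 0 <= V z) ->
    (forall t, 0 < t -> (Q [set z | 0 < V z <= t]%R <= (Ca * t `^ alpha)%:E)%E) ->
    (0 < j)%N ->
    (\int[Q]_z ((V z <= 1)%R%:R * (V z * expR (- (j%:R * V z ^+ 2 / 8))))%:E <=
     (K * j%:R `^ (- ((1 + alpha) / 2)))%:E)%E) ->
  (0 < k <= n)%N -> (\int[P]_z ((biased u z)%:R * U z)%:E <= B%:E)%E ->
  excess_risk nrm k n.+1 M <=
  Cb * (A0 * u) `^ beta + expR (- k%:R) + K * k%:R `^ (- ((1 + alpha) / 2)) + B.
Proof.
move=> HK kn HB; have /andP[k0 kn'] := kn.
have u0 : 0 < u by rewrite divr_gt0 ?ltr0n.
have mlow : measurable_fun setT (fun z => (f z <= A0 * u)%R).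
  exact: measurable_fun_ler.
have mexp : measurable_fun setT (fun z =>
    (U z <= 1)%R%:R * (U z * expR (- (k%:R * U z ^+ 2 / 8)))).
  apply: measurable_funM; first by apply: measurable_boolR; exact: measurable_fun_ler.
  apply: measurable_funM => //; apply: measurableT_comp => //.
  apply: measurable_funN; apply: measurable_funM => //; apply: measurable_funM => //.
  exact: measurable_funX.
have mb : measurable_fun setT (fun z => (biased u z)%:R * U z).
  by apply: measurable_funM => //; apply: measurable_boolR; apply: mbiased; exact: ltW.
rewrite -lee_fin (excess_riskE M nrm_norm).
apply: (@le_trans _ _ (\int[P]_z (((f z <= A0 * u)%R%:R%:E + (expR (- k%:R))%:E) +
   (((U z <= 1)%R%:R * (U z * expR (- (k%:R * U z ^+ 2 / 8))))%:E +
    ((biased u z)%:R * U z)%:E)))%E).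
  apply: ae_ge0_le_integral => //.
  - by move=> z _; rewrite mule_ge0 ?lee_fin.
  - apply: emeasurable_funM; first exact/measurable_EFinP.
    exact: measurable_error_prob.
  - move=> z _; rewrite -!EFinD lee_fin !addr_ge0 ?expR_ge0 ?mulr_ge0 ?expR_ge0//.
  - apply: emeasurable_funD.
      by apply: emeasurable_funD => //; exact/measurable_EFinP/measurable_boolR.
    by apply: emeasurable_funD; exact/measurable_EFinP.
  apply: filterS (ae_reg_le1 M) => z U1 _.
  rewrite -/(U z) in U1 *.
  have T1 : (tuple_measure P n.+1 [set s | knn_classifier nrm k s z.1 !=
      label_sign (reg M z.1)] <= 1)%E.
    rewrite -(tuple_measure_setT P n.+1); apply: le_measure; rewrite ?inE//.
    apply: measurable_set_bool.
    exact: (measurable_wrong_at M nrm_norm k z.1).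
  have E0 : 0 <= expR (- k%:R) :> R by exact: expR_ge0.
  have G0 : 0 <= U z * expR (- (k%:R * U z ^+ 2 / 8)) by rewrite mulr_ge0 ?expR_ge0.
  have B0 : 0 <= (biased u z)%:R * U z by rewrite mulr_ge0.
  rewrite U1 mul1r -!EFinD.
  have UT : ((U z)%:E * tuple_measure P n.+1 [set s | knn_classifier nrm k s z.1 !=
      label_sign (reg M z.1)] <= (U z)%:E)%E.
    by rewrite -[leRHS]mule1; apply: lee_wpmul2l; rewrite ?lee_fin.
  have [fl|fl] := leP (f z) (A0 * u).
    by apply: le_trans UT _; rewrite lee_fin -[true%:R]/(1 : R); lra.
  have [bi|bi] := boolP (biased u z).
    rewrite bi mul1r in B0 *; apply: le_trans UT _.
    by rewrite lee_fin -[false%:R]/(0 : R); lra.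
  move: bi; rewrite /biased U1 fl/= -ltNge => bi.
  have eta0 : reg M z.1 != 0.
    rewrite -normr_gt0; apply: le_lt_trans bi.
    by rewrite mulr_ge0// mulr_ge0// powR_ge0.
  have := knn_error_in_class d_gt0 nrm_norm Cd_gt0 D0_gt0 smooth minmass kn fl U1
    (ltW bi) eta0.
  rewrite -(_ : U z ^+ 2 = reg M z.1 ^+ 2); last by rewrite /U real_normK// num_real.
  move=> Tle; apply: le_trans (lee_wpmul2l _ Tle) _; first by rewrite lee_fin.
  rewrite -EFinM lee_fin mulrDr -[false%:R]/(0 : R).
  have : U z * expR (- k%:R) <= expR (- k%:R) by rewrite ler_piMl.
  by lra.
have mlowE : measurable_fun setT (fun z => (f z <= A0 * u)%R%:R%:E : \bar R).
  exact/measurable_EFinP/measurable_boolR.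
rewrite ge0_integralD//; last 4 first.
- by move=> z _; rewrite -EFinD lee_fin addr_ge0// expR_ge0.
- exact: emeasurable_funD.
- by move=> z _; rewrite -EFinD lee_fin addr_ge0// !mulr_ge0// expR_ge0.
- by apply: emeasurable_funD; exact/measurable_EFinP.
rewrite ge0_integralD//.
rewrite ge0_integralD//; last 4 first.
- by move=> z _; rewrite lee_fin !mulr_ge0// expR_ge0.
- exact/measurable_EFinP.
- by move=> z _; rewrite lee_fin mulr_ge0.
- exact/measurable_EFinP.
rewrite [X in (_ <= X%:E)%E](_ : _ = (Cb * (A0 * u) `^ beta + expR (- k%:R)) +
  (K * k%:R `^ (- ((1 + alpha) / 2)) + B)); last by ring.
rewrite !EFinD; apply: leeD.
  apply: leeD.
    by rewrite integral_boolR//; apply: dtail; rewrite mulr_gt0.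
  rewrite integral_cst// -[leRHS]mule1; apply: lee_wpmul2l; last exact: probability_le1.
  by rewrite lee_fin expR_ge0.
by apply: leeD => //; exact: HK.
Qed.

(** [J] stays free, to be chosen later according to the position of [beta] relative to [2 / d]. The
    constant involves [D0] and thus depends on the model. *)
Lemma excess_in_class_le : exists2 C : R, 0 <= C &
  forall (n k J : nat) (u := k%:R / n.+1%:R : R), (0 < k <= n)%N ->
  excess_risk nrm k n.+1 M <=
  C * (u `^ beta + k%:R `^ (- ((1 + alpha) / 2)) +
       u `^ beta * \sum_(j < J) (2 `^ (beta - 2 / d%:R)) ^+ j +
       (2 ^+ J) `^ (- (2 / d%:R * (1 + alpha)))).
Proof.
have [K HK] := margin_integral_le Ca alpha_gt0.
(* [exp (- k)] is at most [(m / k) ^ m], and this [m] makes that a multiple of the variance term,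
   which absorbs it. *)
pose m := (Num.truncn ((1 + alpha) / 2)).+1.
have m_gt : (1 + alpha) / 2 < m%:R by exact: truncnS_gt.
pose c1 := Cb * A0 `^ beta.
pose c2 := `|K| + m%:R ^+ m.
pose c3 := 2 * A1 * (Cb * 2 `^ beta * A0 `^ (beta - gam)).
pose c4 := Ca * (2 * A1 * A0 `^ (- gam)) `^ (1 + alpha).
have c10 : 0 <= c1 by rewrite mulr_ge0// powR_ge0.
have c20 : 0 <= c2 by rewrite addr_ge0// exprn_ge0.
have c30 : 0 <= c3 by rewrite !mulr_ge0// powR_ge0.
have c40 : 0 <= c4 by rewrite mulr_ge0// powR_ge0.
exists (c1 + c2 + c3 + c4); first by rewrite !addr_ge0.
move=> n k J u kn; have /andP[k0 _] := kn.
have k0' : 0 < k%:R :> R by rewrite ltr0n.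
have u0 : 0 < u by rewrite divr_gt0.
have A00 := ltW A0_gt0.
apply: le_trans (excess_le_bias HK kn (bias_integral_le J u0)) _.
rewrite -/gam; set S := \sum_(j < J) _.
have S0 : 0 <= S by apply: sumr_ge0 => j _; rewrite exprn_ge0// powR_ge0.
have -> : Cb * (A0 * u) `^ beta = c1 * u `^ beta.
  by rewrite powRM ?(ltW u0)// mulrA.
have -> : (2 * A1 * A0 `^ (- gam) * (2 ^+ J) `^ (- gam)) `^ (1 + alpha) =
    (2 * A1 * A0 `^ (- gam)) `^ (1 + alpha) * (2 ^+ J) `^ (- (gam * (1 + alpha))).
  rewrite powRM ?powR_ge0//; last by rewrite !mulr_ge0// powR_ge0.
  by rewrite -powRrM mulNr.
have e2 : expR (- k%:R) <= m%:R ^+ m * k%:R `^ (- ((1 + alpha) / 2)).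
  apply: le_trans (expRN_le_powR (ltn0Sn _ : (0 < m)%N) k0') _.
  rewrite expr_div_n ler_wpM2l ?exprn_ge0// -powR_mulrn ?ler0n// -powRN.
  by rewrite ler_powR ?ler1n// lerN2 ltW.
have e3 : K * k%:R `^ (- ((1 + alpha) / 2)) <= `|K| * k%:R `^ (- ((1 + alpha) / 2)).
  by rewrite ler_wpM2r ?powR_ge0// ler_norm.
rewrite [Ca * (_ * _)]mulrA -/c4 -/c3.
set X1 := u `^ beta; set X2 := k%:R `^ _ in e2 e3 *; set X4 := (2 ^+ J) `^ _.
have X10 : 0 <= X1 by exact: powR_ge0.
have X20 : 0 <= X2 by exact: powR_ge0.
have X30 : 0 <= X1 * S by exact: mulr_ge0.
have X40 : 0 <= X4 by exact: powR_ge0.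
have le1 x1 c c' : 0 <= x1 -> 0 <= c' -> c * x1 <= (c + c') * x1.
  by move=> *; rewrite mulrDl lerDl mulr_ge0.
have E2 : expR (- k%:R) + K * X2 <= c2 * X2 by rewrite /c2 mulrDl; lra.
have L1 : c1 * X1 <= (c1 + c2 + c3 + c4) * X1.
  by rewrite -!addrA le1// !addr_ge0.
have L2 : c2 * X2 <= (c1 + c2 + c3 + c4) * X2.
  by rewrite (_ : c1 + c2 + c3 + c4 = c2 + (c1 + c3 + c4)) ?le1 ?addr_ge0//; ring.
have L3 : c3 * (X1 * S) <= (c1 + c2 + c3 + c4) * (X1 * S).
  by rewrite (_ : c1 + c2 + c3 + c4 = c3 + (c1 + c2 + c4)) ?le1 ?addr_ge0//; ring.
have L4 : c4 * X4 <= (c1 + c2 + c3 + c4) * X4.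
  by rewrite (_ : c1 + c2 + c3 + c4 = c4 + (c1 + c2 + c3)) ?le1 ?addr_ge0//; ring.
by rewrite !mulrDr; lra.
Qed.

End excess_in_class.

(** * Rates *)

Section rate_arithmetic.
Context (R : realType).

Lemma pow2_between (y : R) : 1 <= y -> exists J, y <= 2 ^+ J <= 2 * y.
Proof.
move=> y1; have ex : exists J, y <= 2 ^+ J.
  exists (Num.truncn y).+1; apply/ltW/(lt_le_trans (truncnS_gt _)).
  by rewrite -natrX ler_nat ltnW// ltn_expl.
case: (ex_minnP ex) => J yJ minJ; exists J; rewrite yJ/=.
case: J yJ minJ => [|J] yJ minJ; first by rewrite expr0; lra.
have : ~~ (y <= 2 ^+ J) by apply/negP => /minJ; rewrite ltnn.
by rewrite -ltNge exprS => /ltW; rewrite ler_pM2l.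
Qed.

Lemma powRN_le (x y a : R) : 0 < x -> x <= y -> 0 <= a -> y `^ (- a) <= x `^ (- a).
Proof.
move=> x0 xy a0; have y0 := lt_le_trans x0 xy.
rewrite !powRN lef_pV2 ?posrE ?powR_gt0//.
by rewrite ge0_ler_powR// nnegrE ltW.
Qed.

Variables (d : nat) (alpha beta : R).
Hypothesis d_gt0 : (0 < d)%N.
Hypothesis alpha_gt0 : 0 < alpha.
Hypothesis beta_gt0 : 0 < beta.
Let kappa := k_exponent d alpha beta.
Let gam : R := 2 / d%:R.
Let dR : R := d%:R.
Let d0 : 0 < dR. Proof. by rewrite ltr0n. Qed.
Let gam0 : 0 < gam. Proof. by rewrite divr_gt0. Qed.
Let gd : gam * dR = 2. Proof. by rewrite divfK// gt_eqF. Qed.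

Let den1 : 0 < 2 * beta + alpha + 1.
Proof. by rewrite !addr_gt0 ?mulr_gt0. Qed.
Let den2 : 0 < 2 * alpha + beta * (dR + 4).
Proof.
have bd : 0 < beta * dR by rewrite mulr_gt0.
have a0 := alpha_gt0; have b0 := beta_gt0.
by rewrite mulrDr; lra.
Qed.

Lemma k_exponent_bounds : 0 < kappa < 1.
Proof.
have bd : 0 < beta * dR by rewrite mulr_gt0.
have a0 := alpha_gt0; have b0 := beta_gt0.
rewrite /kappa /k_exponent; case: ifP => _.
  by rewrite divr_gt0 ?mulr_gt0//= ltr_pdivrMr// mul1r; lra.
by rewrite divr_gt0 ?mulr_gt0//= ltr_pdivrMr// mul1r -/dR; lra.
Qed.

Lemma rate_exponent1_gt0 : 0 < rate_exponent1 alpha beta.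
Proof. by rewrite divr_gt0// mulr_gt0// addr_gt0. Qed.

Lemma rate_exponent2_gt0 : 0 < rate_exponent2 d alpha beta.
Proof.
have bd : 0 < beta * dR by rewrite mulr_gt0.
have a0 := alpha_gt0; have b0 := beta_gt0.
have a1 : 0 < alpha + 1 by lra.
apply: divr_gt0; first by rewrite !mulr_gt0.
by rewrite -/dR; lra.
Qed.

(** Once the common factor [beta * (alpha + 1)] cancels, the denominators
    [2 * (2 * beta + alpha + 1)] and [beta * d + 2 * (alpha + 2 * beta)] differ only by 2 against
    [beta * d]. *)
Lemma rate_exponent_le : (rate_exponent1 alpha beta <= rate_exponent2 d alpha beta) =
  (beta <= gam).
Proof.
have bd : 0 < beta * dR by rewrite mulr_gt0.
have a0 := alpha_gt0; have b0 := beta_gt0.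
rewrite /rate_exponent1 /rate_exponent2 -/dR.
rewrite ler_pdivrMr// mulrAC ler_pdivlMr; last by lra.
rewrite (_ : 2 * beta * (alpha + 1) * (2 * beta + alpha + 1) =
  beta * (alpha + 1) * (2 * (2 * beta + alpha + 1))); last by ring.
rewrite ler_pM2l; last by rewrite mulr_gt0//; lra.
have -> : (beta <= gam) = (beta * dR <= 2) by rewrite -(ler_pM2r d0) gd.
by apply/idP/idP; lra.
Qed.

Lemma upper_rate_lt (N : nat) : beta < gam ->
  upper_rate d alpha beta N = N%:R `^ (- rate_exponent1 alpha beta).
Proof.
move=> bg; rewrite /upper_rate (lt_eqF bg) /lower_rate min_l//.
by rewrite rate_exponent_le ltW.
Qed.

Lemma upper_rate_gt (N : nat) : gam < beta ->
  upper_rate d alpha beta N = N%:R `^ (- rate_exponent2 d alpha beta).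
Proof.
move=> bg; rewrite /upper_rate (gt_eqF bg) /lower_rate min_r//.
by apply/ltW; rewrite ltNge rate_exponent_le -ltNge.
Qed.

Section rate_from_bound.
Variables (ex : nat -> nat -> R) (C : R).
Hypothesis C0 : 0 <= C.
Hypothesis exC : forall (n k J : nat) (u := k%:R / n.+1%:R : R), (0 < k <= n)%N ->
  ex k n.+1 <=
  C * (u `^ beta + k%:R `^ (- ((1 + alpha) / 2)) +
       u `^ beta * \sum_(j < J) (2 `^ (beta - gam)) ^+ j +
       (2 ^+ J) `^ (- (gam * (1 + alpha)))).

(* The three regimes of [beta] differ by which end of the dyadic sum dominates;
   [2 ^ J] is taken of order [1 / u] in the first two. *)
Lemma ex_le_lt : beta < gam -> exists2 K, 0 <= K &
  forall n k (u := k%:R / n.+1%:R : R), (0 < k <= n)%N ->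
  ex k n.+1 <= K * (u `^ beta + k%:R `^ (- ((1 + alpha) / 2))).
Proof.
move=> bg; have a0 := alpha_gt0; have b0 := beta_gt0; have g0 := gam0.
have ga1 : 0 <= gam * (1 + alpha) by apply: mulr_ge0; lra.
have r01 : 0 <= (2 : R) `^ (beta - gam) < 1.
  rewrite powR_ge0/= -opprB powRN invf_lt1 ?powR_gt0//.
  have : (1 : R) `^ (gam - beta) < 2 `^ (gam - beta).
    by apply: gt0_ltr_powR; rewrite ?nnegrE ?ltr1n//; lra.
  by rewrite powR1.
pose S := (1 - (2 : R) `^ (beta - gam))^-1.
have S0 : 0 <= S by rewrite invr_ge0 subr_ge0 ltW//; case/andP: r01.
exists (C * (2 + S)) => [|n k u kn]; first by rewrite mulr_ge0// addr_ge0.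
have /andP[k0 kn'] := kn.
have k0' : 0 < k%:R :> R by rewrite ltr0n.
have u0 : 0 < u by rewrite divr_gt0.
have u1 : u <= 1 by rewrite ler_pdivrMr// mul1r ler_nat (leq_trans kn').
have [J /andP[uJ _]] : exists J, u^-1 <= 2 ^+ J <= 2 * u^-1.
  by apply: pow2_between; rewrite invf_ge1.
apply: le_trans (exC J kn) _; rewrite -[leRHS]mulrA ler_wpM2l//.
(* As [2 ^ J >= 1 / u], the left side is at most [u] to the power [gam * (1 + alpha)], an exponent
   above [beta], and [u <= 1]. *)
have L4 : (2 ^+ J) `^ (- (gam * (1 + alpha))) <= u `^ beta.
  apply: (@le_trans _ _ (u^-1 `^ (- (gam * (1 + alpha))))).
    by apply: powRN_le; rewrite ?invr_gt0.
  rewrite -(powR_inv1 (ltW u0)) -powRrM mulrN mulN1r opprK.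
  apply: ger_powR; rewrite ?u0//.
  have : 0 < gam * alpha by rewrite mulr_gt0.
  by rewrite mulrDr; lra.
have L3 := sum_expr_le_lt1 J r01; rewrite -/S in L3.
have X0 : 0 <= u `^ beta by exact: powR_ge0.
have Y0 : 0 <= k%:R `^ (- ((1 + alpha) / 2)) :> R by exact: powR_ge0.
have h3 := ler_wpM2l X0 L3.
have h4 : 0 <= S * k%:R `^ (- ((1 + alpha) / 2)) by rewrite mulr_ge0.
move: L4 h3 h4 X0 Y0; set X := u `^ beta; set Y := k%:R `^ _.
by set Q := \sum_(j < J) _; set T := (2 ^+ J) `^ _; lra.
Qed.

(** The dyadic sum has ratio 1 and equals [J], which is at most of order [ln N]: the origin of the
    logarithm in the rate. *)
Lemma ex_le_eq : beta = gam -> exists2 K, 0 <= K &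
  forall n k (u := k%:R / n.+1%:R : R), (0 < k <= n)%N ->
  ex k n.+1 <= K * ((u `^ beta + k%:R `^ (- ((1 + alpha) / 2))) * ln n.+1%:R).
Proof.
move=> bg; have a0 := alpha_gt0; have b0 := beta_gt0; have g0 := gam0.
have ga1 : 0 <= gam * (1 + alpha) by apply: mulr_ge0; lra.
have l2 : 0 < ln 2 :> R by rewrite ln_gt0// ltr1n.
exists (C * (4 / ln 2)) => [|n k u kn].
  by rewrite mulr_ge0// divr_ge0// ltW.
have /andP[k0 kn'] := kn.
have k0' : 0 < k%:R :> R by rewrite ltr0n.
have u0 : 0 < u by rewrite divr_gt0.
have u1 : u <= 1 by rewrite ler_pdivrMr// mul1r ler_nat (leq_trans kn').
have [J /andP[uJ Ju]] : exists J, u^-1 <= 2 ^+ J <= 2 * u^-1.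
  by apply: pow2_between; rewrite invf_ge1.
apply: le_trans (exC J kn) _; rewrite -[leRHS]mulrA ler_wpM2l//.
have L4 : (2 ^+ J) `^ (- (gam * (1 + alpha))) <= u `^ beta.
  apply: (@le_trans _ _ (u^-1 `^ (- (gam * (1 + alpha))))).
    by apply: powRN_le; rewrite ?invr_gt0.
  rewrite -(powR_inv1 (ltW u0)) -powRrM mulrN mulN1r opprK.
  apply: ger_powR; rewrite ?u0//.
  have : 0 < gam * alpha by rewrite mulr_gt0.
  by rewrite mulrDr; lra.
have L3 : \sum_(j < J) ((2 : R) `^ (beta - gam)) ^+ j = J%:R.
  rewrite bg subrr powRr0 (eq_bigr (fun=> 1)) => [|j _]; last by rewrite expr1n.
  by rewrite sumr_const card_ord.
have lN : ln 2 <= ln n.+1%:R :> R.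
  by rewrite ler_ln ?posrE// ler_nat ltnS (leq_trans k0 kn').
(* The logarithm of [2 ^ J <= 2 / u <= 2 * n.+1], where [k >= 1] bounds [1 / u]. *)
have JlN : J%:R * ln 2 <= ln 2 + ln n.+1%:R :> R.
  rewrite -lnM ?posrE// mulr_natl -lnXn// ler_ln ?posrE ?exprn_gt0 ?mulr_gt0//.
  apply: le_trans Ju _; rewrite ler_pM2l// /u invf_div ler_pdivrMr//.
  by rewrite ler_peMr// ler1n.
rewrite L3; set X := u `^ beta in L4 *; set Y := k%:R `^ _; set l := ln n.+1%:R in lN JlN *.
have X0 : 0 <= X by exact: powR_ge0.
have Y0 : 0 <= Y by exact: powR_ge0.
have l1 : 1 <= l / ln 2 by rewrite ler_pdivlMr// mul1r.
have J2 : J%:R <= 2 * (l / ln 2).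
  by rewrite mulrA ler_pdivlMr//; lra.
have -> : 4 / ln 2 * ((X + Y) * l) = 4 * (X + Y) * (l / ln 2) by ring.
set q := l / ln 2 in l1 J2 *.
have h1 : 0 <= X * (2 * q - J%:R) by rewrite mulr_ge0// subr_ge0.
have h2 : 0 <= X * (q - 1) by rewrite mulr_ge0// subr_ge0.
have h3 : 0 <= Y * (q - 1) by rewrite mulr_ge0// subr_ge0.
by lra.
Qed.

(** Now the top shell dominates. With [2 ^ J] of order [u] to the power [- w], the shell term has
    exponent [beta - w * (beta - gam)] and the remainder [w * gam * (1 + alpha)]; they agree exactly
    when [w * (beta + gam * alpha) = beta]. *)
Lemma ex_le_gt (w := beta / (beta + gam * alpha)) : gam < beta ->
  exists2 K, 0 <= K &
  forall n k (u := k%:R / n.+1%:R : R), (0 < k <= n)%N ->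
  ex k n.+1 <= K * (u `^ (w * (gam * (1 + alpha))) + k%:R `^ (- ((1 + alpha) / 2))).
Proof.
move=> bg; have a0 := alpha_gt0; have b0 := beta_gt0; have g0 := gam0.
have ga1 : 0 <= gam * (1 + alpha) by apply: mulr_ge0; lra.
have ga0 : 0 < gam * alpha by rewrite mulr_gt0.
have wE : w * (beta + gam * alpha) = beta by rewrite divfK// gt_eqF//; lra.
have w0 : 0 < w by rewrite divr_gt0//; lra.
pose rho := (2 : R) `^ (beta - gam).
have rho1 : 1 < rho.
  have : (1 : R) `^ (beta - gam) < 2 `^ (beta - gam).
    by apply: gt0_ltr_powR; rewrite ?nnegrE ?ltr1n//; lra.
  by rewrite powR1.
pose S := rho / (rho - 1).
have S0 : 0 <= S by rewrite divr_ge0//; lra.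
exists (C * (2 + S)) => [|n k u kn]; first by rewrite mulr_ge0// addr_ge0.
have /andP[k0 kn'] := kn.
have k0' : 0 < k%:R :> R by rewrite ltr0n.
have u0 : 0 < u by rewrite divr_gt0.
have u1 : u <= 1 by rewrite ler_pdivrMr// mul1r ler_nat (leq_trans kn').
have uw0 : 0 < u `^ (- w) by rewrite powR_gt0.
have [J /andP[uJ Ju]] : exists J, u `^ (- w) <= 2 ^+ J <= 2 * u `^ (- w).
  apply: pow2_between; rewrite powRN invf_ge1 ?powR_gt0//.
  by rewrite -(powRr0 u); apply: ger_powR; rewrite ?u0// ltW.
apply: le_trans (exC J kn) _; rewrite -[leRHS]mulrA ler_wpM2l//.
set X := u `^ (w * _); set Y := k%:R `^ _.
have L4 : (2 ^+ J) `^ (- (gam * (1 + alpha))) <= X.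
  apply: (@le_trans _ _ ((u `^ (- w)) `^ (- (gam * (1 + alpha))))).
    exact: powRN_le.
  by rewrite -powRrM mulrNN.
have L1 : u `^ beta <= X.
  apply: ger_powR; rewrite ?u0//.
  have h : 0 <= w * (beta - gam) by rewrite mulr_ge0//; lra.
  by rewrite -[leRHS]wE !mulrDr; move: h; rewrite mulrBr; lra.
have L3 : u `^ beta * \sum_(j < J) rho ^+ j <= S * X.
  have h : rho ^+ J <= rho * (u `^ (- w)) `^ (beta - gam).
    have -> : rho ^+ J = (2 ^+ J) `^ (beta - gam).
      rewrite -(@powR_mulrn _ 2 J)// -powRrM mulrC powRrM.
      by rewrite powR_mulrn// powR_ge0.
    rewrite /rho -powRM//; last exact: ltW.
    apply: ge0_ler_powR => //; rewrite ?nnegrE ?mulr_ge0 ?powR_ge0 ?exprn_ge0//.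
    by rewrite subr_ge0 ltW.
  have h' : u `^ beta * (u `^ (- w)) `^ (beta - gam) = X.
    rewrite -powRrM -powRD; last by rewrite (gt_eqF u0) implybT.
    congr (_ `^ _); rewrite -{1}wE; ring.
  apply: le_trans (ler_wpM2l (powR_ge0 _ _) (sum_expr_le_gt1 J rho1)) _.
  apply: (@le_trans _ _ (u `^ beta * ((rho * (u `^ (- w)) `^ (beta - gam)) / (rho - 1)))).
    apply: ler_wpM2l; first exact: powR_ge0.
    by apply: ler_wpM2r => //; rewrite invr_ge0 subr_ge0 ltW.
  by rewrite -h' /S le_eqVlt; apply/orP; left; apply/eqP; ring.
have X0 : 0 <= X by exact: powR_ge0.
have Y0 : 0 <= Y by exact: powR_ge0.
have h4 : 0 <= S * Y by rewrite mulr_ge0.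
move: L4 L1 L3 h4 X0 Y0; set Q := u `^ beta * _; set T := (2 ^+ J) `^ _.
by lra.
Qed.

(** Since [kappa < 1], [c2 * N ^ kappa] is below [N] once [N] exceeds [c2] to the power
    [1 / (1 - kappa)], whence [N0]. The strict [k < N] leaves a point to serve as (k+1)-th
    neighbour. *)
Lemma k_admissible (c1 c2 : R) : 0 < c1 -> 0 < c2 -> exists N0,
  forall N k, (N0 <= N)%N -> c1 * N%:R `^ kappa <= k%:R <= c2 * N%:R `^ kappa ->
  exists2 n, N = n.+1 & (0 < k <= n)%N.
Proof.
move=> c10 c20; have /andP[kap0 kap1] := k_exponent_bounds.
have kap1' : 0 < 1 - kappa by rewrite subr_gt0.
exists (Num.truncn (c2 `^ (1 - kappa)^-1)).+1 => N k NN0 /andP[ck kc].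
have N0 : (0 < N)%N by exact: leq_ltn_trans NN0.
have NR0 : 0 < N%:R :> R by rewrite ltr0n.
have kN : (k < N)%N.
  rewrite -(ltr_nat R); apply: le_lt_trans kc _.
  apply: (@lt_le_trans _ _ (N%:R `^ (1 - kappa) * N%:R `^ kappa)); last first.
    rewrite -powRD; first by rewrite subrK powRr1// ltW.
    by rewrite (gt_eqF NR0) implybT.
  rewrite ltr_pM2r ?powR_gt0//.
  rewrite -[ltLHS](powRr1 (ltW c20)) -[X in c2 `^ X](mulVf (lt0r_neq0 kap1')) powRrM.
  apply: gt0_ltr_powR; rewrite ?nnegrE ?powR_ge0//.
  by apply: lt_le_trans (truncnS_gt _) _; rewrite ler_nat.
exists N.-1; first by rewrite prednK.
apply/andP; split; last by rewrite -ltnS prednK.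
rewrite -(ltr_nat R).
by apply: lt_le_trans ck; rewrite mulr_gt0// powR_gt0.
Qed.

Lemma ex_rate (c1 c2 : R) : 0 < c1 -> 0 < c2 -> exists2 K, 0 < K & exists N0,
  forall N k, (N0 <= N)%N -> c1 * N%:R `^ kappa <= k%:R <= c2 * N%:R `^ kappa ->
  ex k N <= K * upper_rate d alpha beta N.
Proof.
move=> c10 c20; have a0 := alpha_gt0; have b0 := beta_gt0; have g0 := gam0.
have bd : 0 < beta * dR by rewrite mulr_gt0.
have [N0 adm] := k_admissible c10 c20.
have /andP[kap0 kap1] := k_exponent_bounds.
have u_le N k a : (0 < N)%N -> 0 <= a -> k%:R <= c2 * N%:R `^ kappa ->
    (k%:R / N%:R) `^ a <= c2 `^ a * N%:R `^ (- ((1 - kappa) * a)).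
  move=> N1 a1 kc; have NR0 : 0 < N%:R :> R by rewrite ltr0n.
  have -> : N%:R `^ (- ((1 - kappa) * a)) = (N%:R `^ (kappa - 1)) `^ a :> R.
    by rewrite -powRrM; congr (_ `^ _); ring.
  rewrite -powRM ?powR_ge0 ?(ltW c20)//.
  apply: ge0_ler_powR; rewrite ?nnegrE ?divr_ge0 ?mulr_ge0 ?powR_ge0 ?(ltW c20)//.
  rewrite ler_pdivrMr// -mulrA -[X in _ * (_ * X)](powRr1 (ltW NR0)) -powRD.
    by rewrite subrK.
  by rewrite (gt_eqF NR0) implybT.
have k_le N k b : (0 < N)%N -> 0 <= b -> c1 * N%:R `^ kappa <= k%:R ->
    k%:R `^ (- b) <= c1 `^ (- b) * N%:R `^ (- (kappa * b)).
  move=> N1 b1 ck; have NR0 : 0 < N%:R :> R by rewrite ltr0n.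
  rewrite -mulrN powRrM -powRM ?powR_ge0 ?(ltW c10)//.
  by apply: powRN_le => //; rewrite mulr_gt0// powR_gt0.
pose b := (1 + alpha) / 2.
have b_ge0 : 0 <= b by rewrite /b; lra.
have den1' := den1; have den2' := den2.
(* [kappa] is the exponent at which the variance term and the term in [u = k / N] have the same
   order; the identities [e1k] and [e2k] check this in the two regimes. *)
have e1k : beta <= gam -> kappa * b = rate_exponent1 alpha beta /\
    (1 - kappa) * beta = rate_exponent1 alpha beta.
  move=> bg; rewrite /kappa /k_exponent bg /rate_exponent1 /b.
  by split; field; rewrite gt_eqF.
have e2k : gam < beta -> kappa * b = rate_exponent2 d alpha beta /\
    (1 - kappa) * (beta / (beta + gam * alpha) * (gam * (1 + alpha))) =
    rate_exponent2 d alpha beta.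
  move=> bg; rewrite /kappa /k_exponent leNgt bg/= /rate_exponent2 /b /gam -/dR.
  by split; field; rewrite !gt_eqF//; lra.
have pos x : 0 <= x -> x < x + 1 by move=> _; rewrite ltrDl.
case: (ltgtP beta gam) => bg.
- have [K K0 HK] := ex_le_lt bg; have [E1 E2] := e1k (ltW bg).
  pose C1 := K * (c2 `^ beta + c1 `^ (- b)).
  have C10 : 0 <= C1 by rewrite mulr_ge0// addr_ge0// powR_ge0.
  (* Adding 1 makes the constant positive even if [C1] is 0. *)
  exists (C1 + 1); first by lra.
  exists N0 => N k NN0 ckc; have [n NE kn] := adm N k NN0 ckc.
  have /andP[ck kc] := ckc.
  have N1 : (0 < N)%N by rewrite NE.
  rewrite upper_rate_lt//; apply: (@le_trans _ _ (C1 * N%:R `^ (- rate_exponent1 alpha beta))); last first.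
    by rewrite ler_wpM2r ?powR_ge0//; lra.
  rewrite /C1 -mulrA mulrDl -{1}E2 -E1 NE; apply: le_trans (HK n k kn) _.
  rewrite ler_wpM2l// lerD// -NE.
    by apply: u_le => //; exact: ltW.
  exact: k_le.
- have [K K0 HK] := ex_le_gt bg; have [E1 E2] := e2k bg.
  pose v := beta / (beta + gam * alpha) * (gam * (1 + alpha)).
  have v0 : 0 <= v.
    have h : 0 < gam * alpha by rewrite mulr_gt0.
    by rewrite /v mulr_ge0 ?divr_ge0 ?mulr_ge0//; lra.
  pose C1 := K * (c2 `^ v + c1 `^ (- b)).
  have C10 : 0 <= C1 by rewrite mulr_ge0// addr_ge0// powR_ge0.
  exists (C1 + 1); first by lra.
  exists N0 => N k NN0 ckc; have [n NE kn] := adm N k NN0 ckc.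
  have /andP[ck kc] := ckc.
  have N1 : (0 < N)%N by rewrite NE.
  rewrite upper_rate_gt//; apply: (@le_trans _ _ (C1 * N%:R `^ (- rate_exponent2 d alpha beta))); last first.
    by rewrite ler_wpM2r ?powR_ge0//; lra.
  rewrite /C1 -mulrA mulrDl -{1}E2 -E1 NE; apply: le_trans (HK n k kn) _.
  rewrite ler_wpM2l// lerD// -NE.
    exact: u_le.
  exact: k_le.
- have [K K0 HK] := ex_le_eq bg; have bg' : beta <= gam by rewrite bg.
  have [E1 E2] := e1k bg'.
  pose C1 := K * (c2 `^ beta + c1 `^ (- b)).
  have C10 : 0 <= C1 by rewrite mulr_ge0// addr_ge0// powR_ge0.
  exists (C1 + 1); first by lra.
  exists N0 => N k NN0 ckc; have [n NE kn] := adm N k NN0 ckc.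
  have /andP[ck kc] := ckc.
  have N1 : (0 < N)%N by rewrite NE.
  have lN : 0 <= ln N%:R :> R by rewrite ln_ge0// ler1n.
  rewrite /upper_rate {1}bg eqxx.
  apply: (@le_trans _ _ (C1 * (N%:R `^ (- rate_exponent1 alpha beta) * ln N%:R))); last first.
    by rewrite ler_wpM2r ?mulr_ge0 ?powR_ge0//; lra.
  rewrite /C1 -mulrA [X in K * X]mulrA mulrDl -{1}E2 -E1 NE; apply: le_trans (HK n k kn) _.
  rewrite ler_wpM2l// -NE ler_wpM2r// lerD//.
    by apply: u_le => //; exact: ltW.
  exact: k_le.
Qed.

End rate_from_bound.
End rate_arithmetic.

(** * Upper bound for a model of the class *)

Section upper_bound.
Context (R : realType) (d : nat) (d_gt0 : (0 < d)%N) (nrm : 'rV[R]_d -> R).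
Hypothesis nrm_norm : is_norm nrm.

Lemma excess_risk_ge0 (k N : nat) (M : model R d) : 0 <= excess_risk nrm k N M.
Proof.
rewrite -lee_fin (excess_riskE M nrm_norm).
by apply: integral_ge0 => z _; rewrite mule_ge0// lee_fin.
Qed.

Variables (alpha beta : R).
Hypothesis alpha_gt0 : 0 < alpha.
Hypothesis beta_gt0 : 0 < beta.
Variables (M : model R d) (Ca Cb Cc Cd : R).
Hypothesis Cd_gt0 : 0 < Cd.
Hypothesis classM : model_class nrm alpha beta Ca Cb Cc Cd M.
Let kappa := k_exponent d alpha beta.

Lemma excess_rate (c1 c2 : R) : 0 < c1 -> 0 < c2 -> exists2 K, 0 < K & exists N0,
  forall N k, (N0 <= N)%N -> c1 * N%:R `^ kappa <= k%:R <= c2 * N%:R `^ kappa ->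
  excess_risk nrm k N M <= K * upper_rate d alpha beta N.
Proof.
move=> c10 c20; have [margin dtail smooth [D0 D00 minmass]] := classM.
have [C C0 HC] := excess_in_class_le d_gt0 nrm_norm alpha_gt0 Cd_gt0 D00
  margin dtail smooth minmass.
exact: (ex_rate d_gt0 alpha_gt0 beta_gt0 C0 HC).
Qed.

Lemma excess_risk_bigO (k : nat -> nat) :
  (fun N => (k N)%:R : R) =Theta_\oo (fun N => N%:R `^ kappa) ->
  (fun N => excess_risk nrm (k N) N M) =O_\oo upper_rate d alpha beta.
Proof.
rewrite eqThetaE qualifE => /asboolP[[c1 c2] /= /andP[c10 c20] [N1 _ HN1]].
have [K K0 [N0 HK]] := excess_rate c10 c20.
apply/eqO_exP; exists K => //; exists (maxn N0 N1) => // N /=.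
rewrite geq_max => /andP[NN0 NN1].
rewrite ger0_norm ?excess_risk_ge0//.
apply: (@le_trans _ _ (K * upper_rate d alpha beta N)); last first.
  by apply: ler_wpM2l; [exact: ltW|exact: ler_norm].
apply: HK => //; have [] := HN1 N NN1.
by rewrite !ger0_norm ?powR_ge0// => -> ->.
Qed.

Lemma inf_excess_risk_bigO :
  (fun N => inf [set excess_risk nrm k N M | k in [set k | 1 <= k <= N]%N])
    =O_\oo upper_rate d alpha beta.
Proof.
have two0 : 0 < 2 :> R by [].
have [K K0 [N0 HK]] := excess_rate ltr01 two0.
have [N1 adm] := k_admissible d_gt0 alpha_gt0 beta_gt0 ltr01 two0.
have /andP[kap0 kap1] := k_exponent_bounds d_gt0 alpha_gt0 beta_gt0.
apply/eqO_exP; exists K => //; exists (maxn 1 (maxn N0 N1)) => // N /=.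
rewrite !geq_max => /and3P[N_gt0 NN0 NN1].
pose x := (N%:R : R) `^ kappa.
have x1 : 1 <= x.
  by rewrite /x -[leLHS](powRr0 (N%:R : R)) ler_powR ?ler1n// ltW.
(* The first integer above [x] is at most [x + 1], hence at most [2 * x] because [x >= 1]; this is
   why the constants 1 and 2 are used. *)
pose k := (Num.truncn x).+1.
have kx : 1 * x <= k%:R <= 2 * x.
  rewrite mul1r (ltW (truncnS_gt _))/= /k -natr1.
  have : (Num.truncn x)%:R <= x by rewrite truncn_le// (le_trans ler01).
  by lra.
have [n NE /andP[k0 kn]] := adm N k NN1 kx.
set A := [set _ | _ in _].
have Ak : A (excess_risk nrm k N M).
  by exists k => //=; rewrite NE (leq_trans kn).
have A0 : lbound A 0 by move=> _ [j _ <-]; exact: excess_risk_ge0.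
have inf0 : 0 <= inf A by apply: lb_le_inf => //; exists (excess_risk nrm k N M).
rewrite ger0_norm//; apply: (@le_trans _ _ (excess_risk nrm k N M)).
  by apply: ge_inf => //; exists 0.
apply: (@le_trans _ _ (K * upper_rate d alpha beta N)); first exact: HK.
by apply: ler_wpM2l; [exact: ltW|exact: ler_norm].
Qed.

End upper_bound.

(** * Two-valued regression functions on separated cells *)

Section cells.
Context (R : realType) (d : nat) (d_gt0 : (0 < d)%N) (n : nat).
Local Notation m := n.+1.
Implicit Types (c : 'I_m) (x y : 'rV[R]_d).

Let i0 : 'I_d := Ordinal d_gt0.

Let mV0 : 0 < m%:R^-1 :> R. Proof. by rewrite invr_gt0 ltr0n. Qed.
Let mV1 : m%:R^-1 <= 1 :> R. Proof. by rewrite invf_le1 ?ler1n ?ltr0n. Qed.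

(* Distinct cells are at distance at least 1 along [i0], so that the average of
   a piecewise constant [reg] over a small ball is its value at the centre. *)
Definition cell_lo c (i : 'I_d) : R := if i == i0 then c.*2%:R else 0.

Definition cell_hi c (i : 'I_d) : R :=
  if i == i0 then c.*2%:R + m%:R^-1 else 1.

Definition cell c : set 'rV[R]_d := box (cell_lo c) (cell_hi c).

Definition cells : set 'rV[R]_d := \bigcup_(c in [set: 'I_m]) cell c.

Lemma measurable_cell c : measurable (cell c).
Proof. exact: measurable_box. Qed.

Lemma measurable_cells : measurable cells.
Proof. by apply: fin_bigcup_measurable => // c _; exact: measurable_cell. Qed.

Lemma cell_side c i : m%:R^-1 <= cell_hi c i - cell_lo c i.
Proof. rewrite /cell_hi /cell_lo; by case: ifP => _; rewrite ?subr0 ?mV1// addrAC subrr add0r. Qed.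

Lemma lebesgue_cell c : lebesgue_rV (cell c) = m%:R^-1%:E.
Proof.
rewrite lebesgue_box; last by move=> i; rewrite -subr_ge0 (le_trans (ltW mV0))// cell_side.
rewrite (bigD1 i0)//= big1 ?mulr1 => [|i /negbTE ii0].
  by rewrite /cell_hi /cell_lo eqxx addrAC subrr add0r.
by rewrite /cell_hi /cell_lo ii0 subr0.
Qed.

(** Along [i0] the cells start at even integers and have length at most 1, so points less than 1
    apart have starts less than 2 apart. *)
Lemma cell_sep c c' x y : cell c x -> cell c' y ->
  (forall i, `|x ord0 i - y ord0 i| < 1) -> c = c'.
Proof.
move=> /(_ i0) + /(_ i0) + /(_ i0).
rewrite /cell_lo /cell_hi eqxx => /andP[x1 x2] /andP[y1 y2].
rewrite ltr_distl => /andP[d1 d2]; apply: val_inj => /=.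
have := mV1; move: (m%:R^-1) x2 y2 => v x2 y2 v1.
have : (c.*2%:R : R) < (c'.*2 + 2)%:R by rewrite natrD; lra.
have : (c'.*2%:R : R) < (c.*2 + 2)%:R by rewrite natrD; lra.
by rewrite !ltr_nat; lia.
Qed.

Lemma cell_inj c c' x : cell c x -> cell c' x -> c = c'.
Proof. by move=> xc xc'; apply: (cell_sep xc xc') => i; rewrite subrr normr0. Qed.

Lemma lebesgue_cells : lebesgue_rV cells = 1%E.
Proof.
have -> : cells = \big[setU/set0]_(c < m) cell c.
  rewrite -[RHS]big_enum/= -bigcup_seq; apply/seteqP.
  by split=> x [c _ xc]; exists c => //=; rewrite mem_enum.
rewrite measure_bigsetU_ord; last 2 first.
- exact: measurable_cell.
- by move=> c c' _ _ [x [xc xc']]; exact: cell_inj xc xc'.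
rewrite (eq_bigr (fun=> m%:R^-1%:E)); last by move=> c _; exact: lebesgue_cell.
by rewrite sumEFin sumr_const card_ord -(mulr_natr m%:R^-1) mulVf// pnatr_eq0.
Qed.

Lemma closed_cells : closed cells.
Proof.
apply: closed_bigcup => [|c _]; first exact: finite_finset.
rewrite (_ : cell c = \bigcap_(i in [set: 'I_d])
    ((fun x : 'rV[R]_d => x ord0 i) @^-1` `[cell_lo c i, cell_hi c i])).
  apply: closed_bigI => i _; apply: closed_comp; last exact: itv_closed.
  by move=> x _; exact: coord_continuous.
apply/seteqP; split=> x /= h i; first by move=> _; rewrite /= in_itv/=; exact: h.
by have := h i Logic.I; rewrite /= in_itv.
Qed.

Definition unif : set 'rV[R]_d -> \bar R :=
  mrestr (@lebesgue_rV R d) measurable_cells.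

HB.instance Definition _ := Measure.on unif.

Let unifT : unif setT = 1%E.
Proof. by rewrite /unif /mrestr setTI lebesgue_cells. Qed.

HB.instance Definition _ := Measure_isProbability.Build _ _ _ unif unifT.

Variable theta : {ffun 'I_m -> bool}.

Definition negative_cells : set 'rV[R]_d :=
  \bigcup_(c in [set c | ~~ theta c]) cell c.

Lemma measurable_negative_cells : measurable negative_cells.
Proof.
apply: fin_bigcup_measurable; first exact: finite_finset.
by move=> c _; exact: measurable_cell.
Qed.

(** Serves as [reg], hence defined everywhere; the value 1 outside the cells concerns a set of mass
    0. *)
Definition cell_label (x : 'rV[R]_d) : R := if x \in negative_cells then -1 else 1.

Lemma cell_label1 x : cell_label x = 1 \/ cell_label x = -1.
Proof. by rewrite /cell_label; case: ifP => _; [right|left]. Qed.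

Lemma cell_labelE c x : cell c x -> cell_label x = if theta c then 1 else -1.
Proof.
move=> xc; rewrite /cell_label; case: ifPn => [/set_mem[c' /= tc' xc']|].
  by rewrite (cell_inj xc xc') (negbTE tc').
by case: ifPn => // tc /negP[]; apply/mem_set; exists c.
Qed.

Lemma measurable_cell_label : measurable_fun setT cell_label.
Proof.
apply: measurable_fun_ifT => //; apply: (measurable_fun_bool true).
rewrite setTI (_ : _ @^-1` _ = negative_cells); first exact: measurable_negative_cells.
by apply/seteqP; split=> x /= => [/set_mem|/mem_set].
Qed.

(** There is no label noise: the absolute value of [reg] is 1, and the excess risk is the
    probability of disagreeing with [cell_label]. *)
Definition labeled (x : 'rV[R]_d) : 'rV[R]_d * R := (x, cell_label x).

Lemma measurable_labeled : measurable_fun setT labeled.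
Proof. by apply: measurable_fun_pair => //; exact: measurable_cell_label. Qed.

HB.instance Definition _ := isMeasurableFun.Build _ _ _ _ labeled measurable_labeled.

Let P : probability ('rV[R]_d * R)%type R := distribution unif labeled.

Let PE A : P A = lebesgue_rV (labeled @^-1` A `&` cells). Proof. by []. Qed.

Let labels1 : P [set z | z.2 = 1 \/ z.2 = -1] = 1%E.
Proof.
rewrite PE (_ : _ `&` _ = cells) ?lebesgue_cells//; apply/setIidr => x _.
exact: cell_label1.
Qed.

Let mdens : measurable_fun setT (\1_cells : 'rV[R]_d -> R).
Proof. by apply: measurable_indic; exact: measurable_cells. Qed.

Let P_dens (A : set 'rV[R]_d) : measurable A ->
  P (A `*` setT) = (\int[@lebesgue_rV R d]_(x in A) (\1_cells x)%:E)%E.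
Proof.
move=> mA; rewrite integral_indic//; last exact: measurable_cells.
rewrite PE setIC; congr (lebesgue_rV (_ `&` _)).
by apply/seteqP; split=> x /=; [case|].
Qed.

Let P_reg (A : set 'rV[R]_d) : measurable A ->
  (\int[P]_(z in A `*` setT) (z.2)%:E =
   \int[P]_(z in A `*` setT) (cell_label z.1)%:E)%E.
Proof.
move=> mA; have m1 : measurable_fun setT (fun z : 'rV[R]_d * R => cell_label z.1).
  exact: (measurableT_comp measurable_cell_label).
apply: ae_eq_integral.
- exact: measurableX.
- by apply/measurable_EFinP/measurable_funTS.
- by apply/measurable_EFinP/measurable_funTS.
- exists [set z | z.2 != cell_label z.1]; split.
  + apply/measurable_set_bool/measurable_neg; exact: measurable_fun_eqr.
  + rewrite [LHS](PE _) (_ : _ `&` _ = set0)//.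
    by apply/seteqP; split=> x //= []; rewrite eqxx.
  + by move=> z /=; apply: contra_not_neq => ->.
Qed.

Definition cell_model : model R d :=
  @Model R d \1_cells cell_label P labels1
    (fun x => ltac:(by rewrite indicE)) mdens measurable_cell_label P_dens P_reg.

End cells.

(** * The cell models satisfy the four conditions *)

Section cell_class.
Context (R : realType) (d : nat) (d_gt0 : (0 < d)%N) (nrm : 'rV[R]_d -> R).
Hypothesis nrm_norm : is_norm nrm.
Variables (n : nat) (theta : {ffun 'I_n.+1 -> bool}).
Let M : model R d := cell_model R d_gt0 theta.
Let L := nrm_coef nrm.
Let L0 : 0 < L. Proof. exact: nrm_coef_gt0. Qed.
Local Notation cell := (@cell R d d_gt0 n).
Local Notation cells := (@cells R d d_gt0 n).
Local Notation B := (ball_ nrm).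
Local Notation label := (cell_label d_gt0 theta).

Lemma cell_lawE A : law M A = lebesgue_rV (labeled d_gt0 theta @^-1` A `&` cells).
Proof. by []. Qed.

Lemma massB_cell x r : massB nrm M x r = lebesgue_rV (B x r `&` cells).
Proof.
rewrite /massB cell_lawE; congr (lebesgue_rV (_ `&` _)).
by apply/seteqP; split=> y //= [].
Qed.

(** A cube of side [e] with a corner at [x] serves, pushed back along the axes where it would leave
    the cell: hence the [Num.min]. *)
Lemma massB_cell_ge (c : 'I_n.+1) x (r e : R) : cell c x -> 0 < e <= n.+1%:R^-1 ->
  e * L < r -> ((e ^+ d)%:E <= massB nrm M x r)%E.
Proof.
move=> xc /andP[e0 em] er; rewrite massB_cell.
pose a i := Num.min (x ord0 i) (cell_hi R d_gt0 c i - e).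
have side i : e <= cell_hi R d_gt0 c i - cell_lo R d_gt0 c i.
  by apply: le_trans em _; exact: cell_side.
have aE : lebesgue_rV (box a (fun i => a i + e)) = (e ^+ d)%:E.
  rewrite lebesgue_box; last by move=> i; rewrite lerDl; exact: ltW.
  by rewrite (eq_bigr (fun=> e)) ?prodr_const ?card_ord// => i _; rewrite addrAC subrr add0r.
rewrite -aE; apply: le_measure; rewrite ?inE; first exact: measurable_box.
  apply: measurableI; [exact: measurable_ball_nrm|exact: measurable_cells].
move=> y ya; split.
  rewrite /ball_/=; apply: le_lt_trans er; apply: (nrm_le_box nrm_norm); first exact: ltW.
  move=> i; rewrite !mxE distrC ler_distl.
  have := ya i; have /andP[x1 x2] := xc i; rewrite /a.
  by case: (leP (x ord0 i) (cell_hi R d_gt0 c i - e)) => h /andP[y1 y2]; apply/andP; split; lra.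
exists c => // i; have := ya i; have /andP[x1 x2] := xc i; have := side i; rewrite /a.
by case: (leP (x ord0 i) (cell_hi R d_gt0 c i - e)) => h s /andP[y1 y2]; apply/andP; split; lra.
Qed.

(** The event is empty for [t < 1], and for [t >= 1] the right side is at least 1. The same
    dichotomy gives [cell_tail], the density being 1 on the cells. *)
Lemma cell_margin Ca alpha : 0 < alpha -> 1 <= Ca -> margin_cond Ca alpha M.
Proof.
move=> a0 Ca1 t t0; have abs1 x : `|label x| = 1.
  by case: (cell_label1 d_gt0 theta x) => ->; rewrite ?normrN normr1.
have [t1|t1] := ltP t 1.
  rewrite (_ : [set z | _] = set0) ?measure0 ?lee_fin ?mulr_ge0 ?powR_ge0//.
    by rewrite (le_trans _ Ca1).
  by apply/seteqP; split=> z //=; rewrite abs1 ltr01/= leNgt t1.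
rewrite (_ : [set z | _] = setT); last first.
  by apply/seteqP; split=> z //= _; rewrite abs1 ltr01.
apply: (@le_trans _ _ 1%E); first exact: probability_le1.
rewrite lee_fin -[leLHS]mul1r ler_pM//.
by rewrite -[leLHS](powRr0 t) ler_powR// ltW.
Qed.

Lemma cell_tail Cb beta : 0 < beta -> 1 <= Cb -> tail_cond Cb beta M.
Proof.
move=> a0 Cb1 t t0; have [t1|t1] := ltP t 1.
  rewrite (_ : law M _ = 0%E) ?lee_fin ?mulr_ge0 ?powR_ge0//.
    by rewrite (le_trans _ Cb1).
  rewrite cell_lawE (_ : _ `&` _ = set0)//; apply/seteqP; split=> x //= [].
  by rewrite indicE => + xU; rewrite mem_set// leNgt t1.
apply: (@le_trans _ _ 1%E).
  apply: probability_le1; apply: measurable_set_bool; apply: measurable_fun_ler => //.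
  exact: (measurableT_comp (measurable_dens M)).
rewrite lee_fin -[leLHS]mul1r ler_pM//.
by rewrite -[leLHS](powRr0 t) ler_powR// ltW.
Qed.

Variables (kap : R).
Hypothesis kap0 : 0 < kap.
Hypothesis kapP : forall (x : 'rV[R]_d) i, kap * `|x ord0 i| <= nrm x.

(** A ball of radius at most [kap] sees only the cell of its centre, so there is no bias. For larger
    radii both values lie between -1 and 1, and their difference of at most 2 is covered by
    [2 / kap ^ 2 * r ^ 2]. *)
Lemma cell_smooth Cc : 2 / kap ^+ 2 <= Cc -> smooth_cond nrm Cc M.
Proof.
move=> Cc2 r x r0 xU.
have {xU} [c _ xc] : cells x.
  rewrite ((closure_id cells).1 (@closed_cells R d d_gt0 n)).
  apply: closure_subset xU => y /=; rewrite indicE.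
  by case: (boolP (y \in _)) => [/set_mem//|]; rewrite eqxx.
(* [regB] divides by this mass and would take the value 0 if it vanished. *)
have m0 : (0 < massB nrm M x r)%E.
  pose e := Num.min n.+1%:R^-1 (r / (2 * L)).
  have e0 : 0 < e by rewrite lt_min invr_gt0 ltr0n/= divr_gt0// mulr_gt0.
  apply: lt_le_trans (massB_cell_ge xc (e := e) _ _).
  - by rewrite lte_fin exprn_gt0.
  - by rewrite e0 ge_min lexx.
  - apply: (@le_lt_trans _ _ (r / (2 * L) * L)).
      by rewrite ler_pM2r// ge_min lexx orbT.
    rewrite invfM mulrA mulrVK ?unitfE ?gt_eqF//.
    by rewrite ltr_pdivrMr// ltr_pMr// ltr1n.
have mB : measurable (B x r `*` [set: R]).
  by apply: measurable_cylinder; exact: measurable_ball_nrm.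
have mf : massB nrm M x r \is a fin_num by exact: fin_num_measure.
have f0 : 0 < fine (massB nrm M x r) by rewrite fine_gt0// m0 ltey_eq mf.
have [rk|kr] := leP r kap.
  suff -> : regB nrm M x r = reg M x.
    by rewrite subrr normr0 mulr_ge0 ?sqr_ge0// (le_trans _ Cc2)// divr_ge0// sqr_ge0.
  rewrite /regB (@ae_eq_integral _ _ _ _ _ (cst (reg M x)%:E))//.
  - rewrite integral_cst// -/(massB nrm M x r) fineM// mulfK// gt_eqF//.
  - by apply/measurable_EFinP/measurable_funTS.
  - exists ((B x r `*` setT) `&` [set z | z.2 != reg M x]); split.
    + apply: measurableI => //; apply/measurable_set_bool/measurable_neg.
      exact: measurable_fun_eqr.
    + rewrite [LHS]cell_lawE (_ : _ `&` _ = set0)//.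
      apply/seteqP; split=> y //= [[[xy _]] + [c' _ yc']].
      rewrite /= (cell_labelE _ xc) (cell_labelE _ yc').
      rewrite (cell_sep xc yc') ?eqxx// => i.
      have := kapP (x - y) i; rewrite !mxE => h.
      by rewrite -(ltr_pM2l kap0) mulr1 (le_lt_trans h)// (lt_le_trans xy).
    + move=> z /= /not_implyP[zB]; move=> zx; split => //.
      by apply/eqP => e; apply: zx; rewrite e.
apply: (@le_trans _ _ 2); last first.
  rewrite -(@divfK _ (kap ^+ 2) _ 2) ?gt_eqF ?exprn_gt0//.
  apply: ler_pM => //; first by rewrite divr_ge0// sqr_ge0.
    exact: sqr_ge0.
  by rewrite lerXn2r ?nnegrE ?ltW.
have reg1 : `|regB nrm M x r| <= 1.
  have If := integrable_fin_num mB (integrable_label M mB).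
  rewrite /regB normrM normfV (ger0_norm (ltW f0)) ler_pdivrMr// mul1r.
  rewrite -lee_fin fineK// -abse_EFin fineK//.
  apply: le_trans (le_abse_integral _ mB _) _.
    by apply/measurable_EFinP/measurable_funTS.
  rewrite (@ae_eq_integral _ _ _ _ _ (cst 1%E))//.
  - by rewrite integral_cst// mul1e.
  - apply/measurable_EFinP; apply: measurableT_comp => //.
    exact: measurable_funTS.
  - apply: filterS (ae_label M) => z h _ /=; congr EFin.
    by case: h => ->; rewrite ?normrN normr1.
rewrite (le_trans (ler_normB _ _))// -[leRHS]/(1 + 1) lerD//.
by case: (cell_label1 d_gt0 theta x) => xE; rewrite [reg M x]xE ?normrN normr1.
Qed.

(** For [r] below the cell width, the cell holds a cube of side [r / (2 * L)] inside the ball, while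
    the whole ball lies in a cube of side [2 * r / kap]. The ratio of these volumes is free of [n],
    so one [Cd] serves all cell models. *)
Lemma cell_min_mass Cd : 0 < Cd <= (kap / (4 * L)) ^+ d -> min_mass_cond nrm Cd M.
Proof.
move=> /andP[Cd0 Cd1]; exists n.+1%:R^-1; first by rewrite invr_gt0 ltr0n.
move=> x r /andP[r0 rm]; rewrite /= indicE.
have [/set_mem[c _ xc]|_] := boolP (x \in _); last by rewrite mulr0 mul0e.
rewrite mulr1; pose e := r / (2 * L).
have e0 : 0 < e by rewrite divr_gt0// mulr_gt0.
have eL : e * L * 2 = r by rewrite /e; field; rewrite gt_eqF.
have L1 : 1 <= L by rewrite lerDl sumr_ge0// => i _; exact: is_norm_ge0.
apply: (@le_trans _ _ ((kap / (4 * L)) ^+ d * (2 * r / kap) ^+ d)%:E).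
  rewrite EFinM; apply: lee_pmul.
  - by rewrite lee_fin ltW.
  - exact: measure_ge0.
  - by rewrite lee_fin.
  - exact: lebesgue_ball_le.
have kapE : kap / (4 * L) * (2 * r / kap) = e.
  by rewrite /e; field; rewrite (gt_eqF kap0) (gt_eqF L0).
rewrite -exprMn kapE.
apply: (massB_cell_ge xc); last first.
  have : 0 < e * L by rewrite mulr_gt0.
  by lra.
rewrite e0 (le_trans _ (ltW rm))// -eL; nra.
Qed.

End cell_class.

(** * Averaging over the labels *)

Section map_tuple_distribution.
Context d d' (T : measurableType d) (T' : measurableType d') (R : realType).
Variables (P : probability T R) (X : {mfun T >-> T'}).
Local Open Scope ereal_scope.

Lemma map_tuple_cons n x (t : n.-tuple T) :
  map_tuple X (Defs.cons_tuple (x, t)) = Defs.cons_tuple (X x, map_tuple X t).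
Proof. exact: val_inj. Qed.

Lemma measurable_map_tuple n :
  measurable_fun setT (fun t : n.-tuple T => map_tuple X t).
Proof.
apply/measurable_fun_tnthP => i; rewrite (_ : _ \o _ = fun t => X (tnth t i)).
  by apply: measurable_comp_tnth.
by apply/funext => t /=; rewrite tnth_map.
Qed.

(** Presents the samples of all labellings as images of the same uniform points, so that labellings
    can be compared at a fixed tuple. *)
Lemma integral_tuple_distribution N (H : N.-tuple T' -> \bar R) :
  measurable_fun setT H -> (forall s, 0 <= H s) ->
  \int[tuple_measure (distribution P X) N]_s H s =
  \int[tuple_measure P N]_t H (map_tuple X t).
Proof.
elim: N H => [|N IH] H mH H0.
  have E (d1 : measure_display) (T1 : measurableType d1)
      (nu : {measure set (0.-tuple T1) -> \bar R}) (F : 0.-tuple T1 -> \bar R) :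
      nu setT = 1 -> \int[nu]_s F s = F [tuple].
    move=> nuT; rewrite (eq_integral (cst (F [tuple]))); last by move=> s _; rewrite [s]tuple0.
    by rewrite integral_cst// nuT mule1.
  rewrite !E; first by rewrite (tuple0 (map_tuple _ _)).
  - exact: (tuple_measure_setT P 0).
  - exact: (tuple_measure_setT (distribution P X) 0).
rewrite integral_tuple_measureS// integral_tuple_measureS; last 2 first.
- by apply: (measurableT_comp mH); exact: measurable_map_tuple.
- by move=> t; exact: H0.
rewrite ge0_integral_distribution; last 2 first.
- apply: (@measurable_fun_fubini_tonelli_F _ _ _ _ _ _
    (fun z : T' * N.-tuple T' => H (Defs.cons_tuple z))) => //.
  exact: (measurableT_comp mH (@measurable_cons_tuple _ T' N)).
- by move=> x; exact: integral_ge0.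
apply: eq_integral => x _ /=; rewrite IH//; last first.
  apply: (measurableT_comp mH).
  apply: (measurableT_comp (@measurable_cons_tuple _ T' N)).
  exact: measurable_fun_pair.
by apply: eq_integral => t _; rewrite map_tuple_cons.
Qed.

End map_tuple_distribution.

Section averaging.
Context (R : realType) (d : nat) (d_gt0 : (0 < d)%N) (nrm : 'rV[R]_d -> R).
Hypothesis nrm_norm : is_norm nrm.
Variables (k N : nat).
Let n := N.*2.
Local Notation cell := (@cell R d d_gt0 n).
Local Notation cells := (@cells R d d_gt0 n).
Local Notation label := (@cell_label R d d_gt0 n).
Local Notation mu := (@unif R d d_gt0 n).
Local Notation Z := ('rV[R]_d * R)%type.
Implicit Types (theta : {ffun 'I_n.+1 -> bool}) (c : 'I_n.+1).

Let flip c theta : {ffun 'I_n.+1 -> bool} := [ffun c' => (c' == c) (+) theta c'].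

Let flipK c : involutive (flip c).
Proof. by move=> theta; apply/ffunP => c'; rewrite !ffunE addbA addbb. Qed.

Let label_flip_in c theta x : cell c x -> label (flip c theta) x = - label theta x.
Proof.
move=> xc; rewrite !(cell_labelE _ xc) ffunE eqxx.
by case: (theta c); rewrite /= ?opprK.
Qed.

Let label_flip_out c theta x : ~ cell c x -> label (flip c theta) x = label theta x.
Proof.
move=> xc; rewrite /cell_label; congr (if _ then _ else _).
have E (th : {ffun 'I_n.+1 -> bool}) :
    negative_cells d_gt0 th x <-> exists2 c', c' != c & ~~ th c' /\ cell c' x.
  split=> [[c' /= th' xc']|[c' _ [th' xc']]]; exists c' => //.
  by apply: contra_notN xc => /eqP <-.
apply/idP/idP => /set_mem/E[c' c'c [th' xc']]; apply/mem_set/E; exists c' => //;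
  by move: th'; rewrite ffunE (negbTE c'c).
Qed.

Let err theta x (t : N.-tuple 'rV[R]_d) : bool :=
  knn_classifier nrm k (map_tuple (labeled d_gt0 theta) t) x != label theta x.

Let missed c (t : N.-tuple 'rV[R]_d) : R :=
  \prod_(i < N) (tnth t i \notin cell c)%:R.

Let measurable_err theta x :
  measurable_fun setT (fun t => (err theta x t)%:R%:E : \bar R).
Proof.
apply/measurable_EFinP; apply: measurable_boolR; apply/measurable_neg.
apply: measurable_fun_eqr => //.
apply: (measurable_knn_classifier (measurable_nrm nrm_norm)) => //.
exact: (measurable_map_tuple (labeled d_gt0 theta)).
Qed.

Let measurable_notin_cell c : measurable_fun setT (fun x => x \notin cell c).
Proof.
apply: measurable_neg; apply: (measurable_fun_bool true).
rewrite setTI (_ : _ @^-1` _ = cell c); first exact: measurable_cell.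
by apply/seteqP; split=> x /= => [/set_mem|/mem_set].
Qed.

Let measurable_missed c : measurable_fun setT (fun t => (missed c t)%:E).
Proof.
apply/measurable_EFinP; apply: measurable_prodR => i.
apply: (measurable_comp_tnth i (f := fun x => (x \notin cell c)%:R : R)).
exact: measurable_boolR.
Qed.

Let missed_ge0 c t : 0 <= missed c t.
Proof. by rewrite prodr_ge0. Qed.

(** Labellings are paired by [flip c]. If no training point lies in [c], the two members of a pair
    yield the same training data but opposite labels at [x], so one of them errs. *)
Let sum_err_ge c x t : cell c x ->
  #|{ffun 'I_n.+1 -> bool}|%:R / 2 * missed c t <= \sum_theta (err theta x t)%:R :> R.
Proof.
move=> xc; have [tc|] := boolP [forall i, tnth t i \notin cell c]; last first.
  rewrite negb_forall => /existsP[i]; rewrite negbK => ti.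
  by rewrite /missed (bigD1 i)//= ti mul0r mulr0 sumr_ge0.
rewrite /missed big1 ?mulr1; last by move=> i _; rewrite (forallP tc i).
(* The sum is doubled and one copy reindexed by [flip c], so that each term holds a labelling
   together with its flip. *)
rewrite ler_pdivrMr// -natr1 mulrDr mulr1 {2}(reindex_inj (inv_inj (flipK c)))/=.
rewrite -big_split/= -sum1_card natr_sum; apply: ler_sum => theta _.
have mapE : map_tuple (labeled d_gt0 (flip c theta)) t =
            map_tuple (labeled d_gt0 theta) t.
  apply: eq_from_tnth => i; rewrite !tnth_map /labeled label_flip_out//.
  by move=> tic; have /negP[] := forallP tc i; exact/mem_set.
rewrite /err mapE (label_flip_in _ xc).
have n1 : ((1 : R) == -1) = false by apply/eqP; lra.
have n2 : ((-1 : R) == 1) = false by apply/eqP; lra.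
by rewrite /knn_classifier /label_sign; case: ifP => _;
  case: (cell_label1 d_gt0 theta x) => ->; rewrite ?opprK ?eqxx ?n1 ?n2/= -natrD ler_nat.
Qed.

Let integral_missed c :
  (\int[tuple_measure mu N]_t (missed c t)%:E = ((1 - n.+1%:R^-1) ^+ N)%:E)%E.
Proof.
have muc : mu (cell c) = n.+1%:R^-1%:E.
  rewrite -(lebesgue_cell R d_gt0 c); congr (lebesgue_rV _).
  by apply/setIidl => x xc; exists c.
rewrite -[in RHS](card_ord N) -prodr_const.
apply: (@integral_tuple_prod _ _ _ mu N (fun _ x => (x \notin cell c)%:R)
  (fun=> 1 - n.+1%:R^-1)) => // _.
  exact: measurable_boolR.
rewrite integral_boolR//.
have -> : [set x | x \notin cell c] = ~` cell c.
  by apply/seteqP; split=> x /=; [move=> /negP h xc; apply: h; exact/mem_set|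
    move=> h; apply/negP => /set_mem].
by rewrite [LHS](@probability_setC _ _ _ mu _ (measurable_cell d_gt0 c)) [X in (_ - X)%E]muc.
Qed.

(** Bernoulli's inequality gives [1 - N / (2 * N + 1)]; this explains the number of cells. *)
Let missed_prob : 2^-1 <= (1 - n.+1%:R^-1) ^+ N :> R.
Proof.
pose a : R := n.+1%:R^-1.
have a0 : 0 < a by rewrite invr_gt0 ltr0n.
have a1 : a <= 1 by rewrite invf_le1 ?ler1n ?ltr0n.
have B j : 1 - j%:R * a <= (1 - a) ^+ j.
  elim: j => [|j IH]; first by rewrite mul0r subr0 expr0.
  rewrite exprS; apply: (@le_trans _ _ ((1 - a) * (1 - j%:R * a))); last first.
    by rewrite ler_wpM2l// subr_ge0.
  have j0 : 0 <= j%:R * a * a by rewrite !mulr_ge0// ltW.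
  by rewrite -natr1; nra.
apply: le_trans (B N).
have : N%:R * a * 2 <= 1.
  rewrite /a mulrAC -natrM ler_pdivrMr ?ltr0n// mul1r ler_nat /n; lia.
by lra.
Qed.

Let Q theta (x : 'rV[R]_d) : \bar R :=
  tuple_measure (law (cell_model R d_gt0 theta)) N
    [set s | knn_classifier nrm k s x != label_sign (label theta x)].

Let QE theta x : Q theta x = (\int[tuple_measure mu N]_t (err theta x t)%:R%:E)%E.
Proof.
have m1 := @measurable_wrong_at _ _ (cell_model R d_gt0 theta) nrm nrm_norm k N x.
rewrite /Q -integral_boolR//.
rewrite (@integral_tuple_distribution _ _ _ _ R mu (labeled d_gt0 theta))//.
- apply: eq_integral => t _; rewrite /err (_ : label_sign _ = label theta x)//.
  rewrite /label_sign; case: (cell_label1 d_gt0 theta x) => ->.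
    by rewrite ler01.
  by rewrite lerNr oppr0 ler10.
- by apply/measurable_EFinP; exact: measurable_boolR.
Qed.

Let measurable_Q theta : measurable_fun setT (Q theta).
Proof.
have /measurableT_comp h := measurable_error_prob (cell_model R d_gt0 theta) nrm_norm k N.
exact: (h _ _ _ _ (measurable_labeled d_gt0 theta)).
Qed.

Let excess_Q theta : (excess_risk nrm k N (cell_model R d_gt0 theta))%:E =
  (\int[mu]_x Q theta x)%E.
Proof.
rewrite (excess_riskE _ nrm_norm).
rewrite (@ge0_integral_distribution _ _ _ _ R mu (labeled d_gt0 theta)).
- apply: eq_integral => x _ /=.
  rewrite (_ : `|label theta x| = 1) ?mul1e//.
  by case: (cell_label1 d_gt0 theta x) => ->; rewrite ?normrN normr1.
- apply: emeasurable_funM; last exact: measurable_error_prob.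
  apply/measurable_EFinP; apply: measurableT_comp => //.
  exact: measurable_reg1.
- by move=> z; rewrite mule_ge0.
Qed.

(** Pigeonhole over the [K] labellings: their excess risks add up to at least [K / 4], with one
    factor 1/2 from the pairing and one from the chance of missing the cell. *)
Lemma cell_excess_ge : exists theta : {ffun 'I_n.+1 -> bool},
  4^-1 <= excess_risk nrm k N (cell_model R d_gt0 theta).
Proof.
pose K := #|{ffun 'I_n.+1 -> bool}|.
have K0 : (0 < K)%N by apply/card_gt0P; exists [ffun=> true].
apply: contrapT => /forallNP small.
have le_sum : ((K%:R * 4^-1 : R)%:E <=
    (\sum_(theta : {ffun 'I_n.+1 -> bool}) excess_risk nrm k N (cell_model R d_gt0 theta))%R%:E)%E.
  rewrite -sumEFin; under eq_bigr do rewrite excess_Q.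
  rewrite -ge0_integral_sum//.
  (* The pairing needs a test point in some cell; the cells carry all the mass. *)
  apply: (@le_trans _ _ (\int[mu]_(x in cells) (K%:R * 4^-1 : R)%:E)%E).
    rewrite integral_cst; last exact: measurable_cells.
    rewrite [X in (_ * X)%E](_ : _ = 1%E) ?mule1//.
    by rewrite -(lebesgue_cells R d_gt0 n); congr (lebesgue_rV _); rewrite setIid.
  have mS : measurable_fun setT (fun x => \sum_theta Q theta x)%E.
    by apply: emeasurable_sum => theta; exact: measurable_Q.
  have S0 x : (0 <= \sum_theta Q theta x)%E.
    by apply: sume_ge0 => theta _; exact: measure_ge0.
  apply: (@le_trans _ _ (\int[mu]_(x in cells) \sum_theta Q theta x)%E); last first.
    by apply: ge0_subset_integral => //; exact: measurable_cells.
  apply: ge0_le_integral => //.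
  - exact: measurable_cells.
  - exact: measurable_funTS.
  move=> x [c _ xc]; under eq_bigr do rewrite QE.
  rewrite -ge0_integral_sum//.
  have K20 : 0 <= K%:R / 2 :> R by [].
  apply: (@le_trans _ _ (\int[tuple_measure mu N]_t
      ((K%:R / 2)%:E * (missed c t)%:E))%E).
    rewrite ge0_integralZl//; last by move=> t _; rewrite lee_fin.
    rewrite integral_missed -EFinM lee_fin.
    apply: (@le_trans _ _ (K%:R / 2 * 2^-1)); last by rewrite ler_wpM2l.
    by lra.
  apply: ge0_le_integral => //.
  + by move=> t _; rewrite mule_ge0// lee_fin.
  + by apply: emeasurable_funM.
  + by apply: emeasurable_sum.
  + by move=> t _; rewrite sumEFin -EFinM lee_fin; exact: sum_err_ge.
move: le_sum; rewrite lee_fin; apply/negP; rewrite -ltNge.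
rewrite /K -sum1_card natr_sum mulr_suml; apply: ltr_sum.
  by apply/hasP; exists [ffun=> true]; rewrite ?mem_index_enum.
move=> theta _; rewrite mul1r ltNge; apply/negP; exact: small.
Qed.

End averaging.

(** * From one bad labelling to the lower bound *)

Section lower_bound.
Context (R : realType) (d : nat) (d_gt0 : (0 < d)%N) (nrm : 'rV[R]_d -> R).
Hypothesis nrm_norm : is_norm nrm.

(** Supplies the upper bound without which the supremum over the class would be a default value. *)
Lemma excess_risk_le1 (k N : nat) (M : model R d) : excess_risk nrm k N M <= 1.
Proof.
rewrite -lee_fin (excess_riskE M nrm_norm).
have mE := @measurable_error_prob _ _ M nrm nrm_norm k N.
apply: (@le_trans _ _ (\int[law M]_z 1)%E); last first.
  by rewrite integral_cst// mul1e; exact: probability_le1.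
apply: ae_ge0_le_integral => //.
- by move=> z _; rewrite mule_ge0.
- apply: emeasurable_funM => //.
  apply/measurable_EFinP; apply: measurableT_comp => //.
  exact: measurable_reg1.
- apply: filterS (ae_reg_le1 M) => z rz _; rewrite -[leRHS]mule1.
  apply: lee_pmul => //.
  rewrite -(tuple_measure_setT (law M) N); apply: le_measure; rewrite ?inE//.
  exact: (measurable_set_bool (measurable_wrong_at M nrm_norm k z.1)).
Qed.

Lemma lower_rate_le1 (alpha beta : R) N : 0 < alpha -> 0 < beta -> (0 < N)%N ->
  lower_rate d alpha beta N <= 1.
Proof.
move=> a0 b0 N0; rewrite /lower_rate powRN invf_le1.
  rewrite -[leLHS](powRr0 (N%:R : R)) ler_powR ?ler1n// le_min.
  rewrite (ltW (rate_exponent1_gt0 a0 b0)).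
  by rewrite (ltW (rate_exponent2_gt0 d_gt0 a0 b0)).
by rewrite powR_gt0 ?ltr0n.
Qed.

(** The labelling from [cell_excess_ge] depends on [k] and [N], which a supremum taken inside the
    infimum permits. The thresholds are the ones required by [cell_margin], [cell_tail],
    [cell_smooth] and [cell_min_mass], uniformly in [N]. *)
Lemma inf_sup_excess_risk_Omega (alpha beta : R) : 0 < alpha -> 0 < beta ->
  exists Ca0 Cb0 Cc0 Cd0 : R, 0 < Cd0 /\
    forall Ca Cb Cc Cd : R,
      Ca0 <= Ca -> Cb0 <= Cb -> Cc0 <= Cc -> 0 < Cd <= Cd0 ->
      (fun N => inf [set sup [set excess_risk nrm k N M |
                    M in model_class nrm alpha beta Ca Cb Cc Cd] |
                  k in [set k | 1 <= k <= N]%N])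
        =Omega_\oo lower_rate d alpha beta.
Proof.
move=> a0 b0; have [kap kap0 kapP] := nrm_ge_coord nrm_norm d_gt0.
exists 1, 1, (2 / kap ^+ 2), ((kap / (4 * nrm_coef nrm)) ^+ d); split.
  by rewrite exprn_gt0// divr_gt0// mulr_gt0// nrm_coef_gt0.
move=> Ca Cb Cc Cd Ca1 Cb1 Cc2 Cd1.
rewrite eqOmegaE qualifE; apply/asboolP; exists 4^-1 => /=.
  by rewrite invr_gt0.
exists 1%N => // N /= N0.
rewrite (ger0_norm (powR_ge0 _ _)).
apply: (@le_trans _ _ 4^-1).
  by rewrite -[leRHS]mulr1 ler_wpM2l// lower_rate_le1.
apply: le_trans (ler_norm _); apply: lb_le_inf.
  (* [N >= 1] admits [k = 1]; over an empty range the infimum would be a default value. *)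
  by exists (sup [set excess_risk nrm 1 N M |
    M in model_class nrm alpha beta Ca Cb Cc Cd]); exists 1%N.
move=> _ [k _ <-]; have [theta ex4] := cell_excess_ge d_gt0 nrm_norm k N.
apply: le_trans ex4 _; apply: ub_le_sup.
  by exists 1 => _ [M _ <-]; exact: excess_risk_le1.
exists (cell_model R d_gt0 theta) => //; split.
- exact: cell_margin.
- exact: cell_tail.
- exact: cell_smooth kapP _ Cc2.
- exact: cell_min_mass kapP _ Cd1.
Qed.

End lower_bound.

Theorem theorem1 (R : realType) (d : nat) (d_gt0 : (0 < d)%N)
    (nrm : 'rV[R]_d -> R) (nrm_norm : is_norm nrm)
    (alpha beta : R) (alpha_gt0 : 0 < alpha) (beta_gt0 : 0 < beta) :
  (forall (M : model R d) (Ca Cb Cc Cd : R), 0 < Cd ->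
     model_class nrm alpha beta Ca Cb Cc Cd M ->
     ((fun N => inf [set excess_risk nrm k N M | k in [set k | 1 <= k <= N]%N])
        =O_\oo upper_rate d alpha beta) /\
     (forall k : nat -> nat,
        (fun N => (k N)%:R : R) =Theta_\oo
          (fun N => N%:R `^ k_exponent d alpha beta) ->
        (fun N => excess_risk nrm (k N) N M) =O_\oo upper_rate d alpha beta)) /\
  (exists Ca0 Cb0 Cc0 Cd0 : R, 0 < Cd0 /\
     forall Ca Cb Cc Cd : R,
       Ca0 <= Ca -> Cb0 <= Cb -> Cc0 <= Cc -> 0 < Cd <= Cd0 ->
       (fun N => inf [set sup [set excess_risk nrm k N M |
                     M in model_class nrm alpha beta Ca Cb Cc Cd] |
                   k in [set k | 1 <= k <= N]%N])
         =Omega_\oo lower_rate d alpha beta).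
Proof.
split=> [M Ca Cb Cc Cd Cd_gt0 classM|]; last exact: inf_sup_excess_risk_Omega.
split; first exact: inf_excess_risk_bigO Cd_gt0 classM.
by move=> k; exact: excess_risk_bigO Cd_gt0 classM k.
Qed.
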